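(* Let $F$ be a monotone differential-henselian valued differential field with valuation $v$ and constant field $C_F$, such that $v(C_F^\times)$ is a pure subgroup of $v(F^\times)$. Then there exist a linearly surjective differential field $\boldsymbol{k}$, an ordered abelian group $\Gamma$, and an additive map $c:\Gamma\to\boldsymbol{k}$ with $c(\Gamma)\cap\boldsymbol{k}^\dagger=\{0\}$ such that $F$ is elementarily equivalent, as a valued differential field, to $K_c=\boldsymbol{k}((t^\Gamma))_c$.
   Context: All differential fields have characteristic $0$ and a single distinguished derivation, written $f\mapsto f'$. For a differential field $F$: $C_F=\{f\in F: f'=0\}$, $f^\dagger=f'/f$ for $f\in F^\times$, and $F^\dagger=\{f^\dagger: f\in F^\times\}$. A valued differential field is a differential field $F$ together with a (Krull) valuation $v:F^\times\to v(F^\times)$ whose residue field has characteristic $0$; $\mathcal{O}$ is its valuation ring and $\mathfrak{m}$ the maximal ideal of $\mathcal{O}$. $F$ is monotone if $v(f')\ge v(f)$ for all $f\in F$. If $F$ is monotone, then its derivation is small, i.e. $\mathfrak{m}'\subseteq\mathfrak{m}$, and also $\mathcal{O}'\subseteq\mathcal{O}$, so the residue field $\mathcal{O}/\mathfrak{m}$ becomes a differential field with the induced derivation. A valued differential field with small derivation is differential-henselian if every differential polynomial $P\in\mathcal{O}\{Y\}=\mathcal{O}[Y,Y',Y'',\dots]$ whose reduction $\overline{P}\in(\mathcal{O}/\mathfrak{m})\{Y\}$ has total degree $1$ has a zero in $\mathcal{O}$. A differential field $\boldsymbol{k}$ with derivation $\partial$ is linearly surjective if for every nonzero linear differential operator $A=a_0+a_1\partial+\dots+a_n\partial^n$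 over $\boldsymbol{k}$ we have $A(\boldsymbol{k})=\boldsymbol{k}$. For a differential field $\boldsymbol{k}$ with derivation $\partial$, an ordered abelian group $\Gamma$, and an additive map $c:\Gamma\to\boldsymbol{k}$, $\boldsymbol{k}((t^\Gamma))_c$ is the Hahn field $\boldsymbol{k}((t^\Gamma))$ with its usual valuation and the derivation $\partial_c\big(\sum_\gamma a_\gamma t^\gamma\big)=\sum_\gamma\big(\partial(a_\gamma)+c(\gamma)a_\gamma\big)t^\gamma$. Elementary equivalence is in the first-order language of valued differential fields (ring language with symbols for the derivation and the valuation, e.g. a predicate for the valuation ring). *)

(* Defs.v *)
(* Mathematical Components, with the classical layer of MathComp-Analysis. *)
From HB Require Import structures.
From mathcomp Require Import all_boot all_order all_algebra.
From mathcomp Require Import generic_quotient ring_quotient finmap mpoly.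
From mathcomp Require Import boolp classical_sets functions cardinality fsbigop.

Set Implicit Arguments.
Unset Strict Implicit.
Unset Printing Implicit Defensive.

Import Order.TTheory GRing.Theory.
Local Open Scope ring_scope.
Local Open Scope classical_set_scope.

(* [Num.POrderedZmodule] relates the order and the addition by no axiom. *)
HB.mixin Record isOrderedAbGroup G of Num.POrderedZmodule G := {
  oag_total : total (<=%R : rel G);
  oag_lerD2r : forall z x y : G, x <= y -> x + z <= y + z
}.

#[short(type="oagType")]
HB.structure Definition OrderedAbGroup :=
  {G of Num.POrderedZmodule G & isOrderedAbGroup G}.

HB.mixin Record isDifferential F of GRing.Field F := {
  der : F -> F;
  derD : {morph der : x y / x + y};
  derM : forall x y : F, der (x * y) = der x * y + x * der y;
  diff_pchar0 : [pchar F] =i pred0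
}.

#[short(type="diffFieldType")]
HB.structure Definition DiffField := {F of GRing.Field F & isDifferential F}.

Section DiffFieldDefs.
Variable k : diffFieldType.

Definition constants : set k := [set f | der f = 0].

Definition logder_set : set k := [set der f / f | f in [set f | f != 0]].

Definition linearly_surjective : Prop :=
  forall (n : nat) (a : 'I_n.+1 -> k), (exists i, a i != 0) ->
  forall g : k, exists f : k, \sum_i a i * iter i der f = g.

End DiffFieldDefs.

Arguments constants : clear implicits.
Arguments logder_set : clear implicits.

(* [valuation 0] is a junk value (mathematically it is +oo), so every use of
   the valuation is guarded; the value group is the image of [F^*] in [G]. *)
HB.mixin Record isValued (G : oagType) F of GRing.Field F := {
  valuation : F -> G;
  valM : forall x y : F, x != 0 -> y != 0 ->
    valuation (x * y) = valuation x + valuation y;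
  valD : forall x y : F, x != 0 -> y != 0 -> x + y != 0 ->
    Order.min (valuation x) (valuation y) <= valuation (x + y)
}.

#[short(type="valuedFieldType")]
HB.structure Definition ValuedField (G : oagType) :=
  {F of GRing.Field F & isValued G F}.

Section OagTheory.
Variable G : oagType.
Implicit Types x y z : G.

Lemma oag_cmp x y : x >=< y.
Proof. exact: oag_total. Qed.

Lemma oag_lerD2rE z x y : (x + z <= y + z) = (x <= y).
Proof.
apply/idP/idP; last exact: oag_lerD2r.
by move=> /(oag_lerD2r (- z)); rewrite !addrK.
Qed.

Lemma oag_ltrD2rE z x y : (x + z < y + z) = (x < y).
Proof. by rewrite !comparable_ltNge ?oag_cmp // oag_lerD2rE. Qed.

Lemma oag_lerD x y z t : x <= y -> z <= t -> x + z <= y + t.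
Proof.
move=> xy zt; apply: (@le_trans _ _ (y + z)); first exact: oag_lerD2r.
by rewrite ![y + _]addrC oag_lerD2r.
Qed.

Lemma oag_subr_ge0 x y : (0 <= y - x) = (x <= y).
Proof. by rewrite -(oag_lerD2rE x 0) add0r subrK. Qed.

Lemma oag_subr_gt0 x y : (0 < y - x) = (x < y).
Proof. by rewrite -(oag_ltrD2rE x 0) add0r subrK. Qed.

Lemma oag_addr_ge0 x y : 0 <= x -> 0 <= y -> 0 <= x + y.
Proof. by move=> x0 y0; rewrite -[0]addr0 oag_lerD. Qed.

Lemma oag_ltr_leD x y z t : x < y -> z <= t -> x + z < y + t.
Proof.
move=> xy zt; apply: (@lt_le_trans _ _ (y + z)); first by rewrite oag_ltrD2rE.
by rewrite ![y + _]addrC oag_lerD2r.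
Qed.

Lemma oag_double_eq0 x : x + x = 0 -> x = 0.
Proof.
move=> xx; case: (comparable_ltgtP (oag_cmp x 0)) => // h.
  by move: (oag_ltr_leD h (ltW h)); rewrite addr0 xx ltxx.
by move: (oag_ltr_leD h (ltW h)); rewrite addr0 xx ltxx.
Qed.

End OagTheory.

Section ValuationRing.
Variables (G : oagType) (F : valuedFieldType G).
Local Notation v := (@valuation G F).
Implicit Types x y : F.

Lemma val1 : v 1 = 0.
Proof.
have := @valM G F 1 1 (oner_neq0 _) (oner_neq0 _); rewrite mulr1 => /eqP.
by rewrite -subr_eq subrr eq_sym => /eqP.
Qed.

Lemma valN1 : v (-1) = 0.
Proof.
have n1 : (-1 : F) != 0 by rewrite oppr_eq0 oner_neq0.
by apply: oag_double_eq0; rewrite -valM // mulrNN mulr1 val1.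
Qed.

Lemma valN x : x != 0 -> v (- x) = v x.
Proof. by move=> x0; rewrite -mulN1r valM ?oppr_eq0 ?oner_neq0 // valN1 add0r. Qed.

Definition in_valring : {pred F} := [pred x | (x == 0) || (0 <= v x)].

Lemma in_valringP x : reflect (x = 0 \/ 0 <= v x) (x \in in_valring).
Proof. by rewrite inE; apply: (iffP orP) => -[/eqP|]; [left|right|left|right]. Qed.

Lemma in_valring_subring : subring_closed in_valring.
Proof.
split=> [|x y|x y]; rewrite ?inE ?val1 ?lexx ?orbT //.
  case: (eqVneq x 0) => [->|x0] /=.
    rewrite sub0r oppr_eq0 => _; case: (eqVneq y 0) => //= y0.
    by rewrite valN.
  case: (eqVneq y 0) => [->|y0] /=; first by rewrite subr0 (negPf x0).
  case: (eqVneq (x - y) 0) => //= xy0 vx vy.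
  have ny0 : - y != 0 by rewrite oppr_eq0.
  apply: (le_trans _ (valD _ _ x0 ny0 xy0)); rewrite valN //.
  by rewrite comparable_le_min ?vx // oag_cmp.
case: (eqVneq x 0) => [->|x0] /=; first by rewrite mul0r eqxx.
case: (eqVneq y 0) => [->|y0] /=; first by rewrite mulr0 eqxx.
by move=> vx vy; rewrite valM // oag_addr_ge0 ?orbT.
Qed.

HB.instance Definition _ :=
  GRing.isSubringClosed.Build F in_valring in_valring_subring.

Record valring := Valring { valring_val : F; _ : valring_val \in in_valring }.

HB.instance Definition _ := [isSub for valring_val].
HB.instance Definition _ := [Choice of valring by <:].
HB.instance Definition _ := [SubChoice_isSubComNzRing of valring by <:].

Definition maxideal : {pred valring} :=
  [pred x | (val x == 0) || (0 < v (val x))].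

Lemma maxideal_idealr : idealr_closed maxideal.
Proof.
split=> [||a x y]; rewrite ?inE /= ?eqxx //.
  by rewrite oner_eq0 val1 ltxx.
have := valP a; rewrite inE.
rewrite /=.
move: (valring_val a) (valring_val x) (valring_val y) => {}a {}x {}y.
have aux : (a == 0) || (0 <= v a) -> (x == 0) || (0 < v x) ->
    (a * x == 0) || (0 < v (a * x)).
  case: (eqVneq a 0) => [->|a0] /=; first by rewrite mul0r eqxx.
  case: (eqVneq x 0) => [->|x0] /=; first by rewrite mulr0 eqxx.
  by move=> va vx; have := oag_ltr_leD vx va; rewrite addr0 valM // addrC => ->; rewrite orbT.
move=> /aux /[apply]; move: (a * x) => {aux} x'.
case: (eqVneq x' 0) => [->|x0] /=; first by rewrite add0r.
case: (eqVneq y 0) => [->|y0] /=; first by rewrite addr0 (negPf x0).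
case: (eqVneq (x' + y) 0) => //= xy0 vx vy.
by apply: (lt_le_trans _ (valD _ _ x0 y0 xy0)); rewrite comparable_lt_min ?vx ?oag_cmp.
Qed.

HB.instance Definition _ := isIdealr.Build valring maxideal maxideal_idealr.

Definition residue := {ideal_quot maxideal}.

HB.instance Definition _ := GRing.ComNzRing.on residue.

Definition reduction (x : valring) : residue := (\pi_{ideal_quot maxideal} x)%qT.

HB.instance Definition _ :=
  GRing.RMorphism.copy reduction (\pi_{ideal_quot maxideal})%qT.

Lemma reduction_eq0 (x : valring) : (reduction x == 0) = (x \in maxideal).
Proof.
rewrite -[0](rmorph0 reduction) /reduction.
by rewrite -Quotient.idealrBE subr0.
Qed.

End ValuationRing.

HB.mixin Record hasResidueChar0 (G : oagType) F of ValuedField G F := {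
  residue_pchar0 : [pchar residue F] =i pred0
}.

#[short(type="valuedDiffFieldType")]
HB.structure Definition ValuedDiffField (G : oagType) :=
  {F of DiffField F & ValuedField G F & hasResidueChar0 G F}.

Section ValuedDiffFieldDefs.
Variables (G : oagType) (F : valuedDiffFieldType G).
Local Notation v := (@valuation G F).

Definition monotone : Prop :=
  forall f : F, f != 0 -> der f != 0 -> v f <= v (der f).

Definition small_derivation : Prop :=
  forall f : valring F, f \in @maxideal G F ->
  exists2 g : valring F, g \in @maxideal G F & val g = der (val f).

(* A differential polynomial of order at most [r] is a polynomial in the
   [r.+1] variables Y, Y', ..., Y^(r); [msize] is one plus the total degree. *)
Definition diff_henselian : Prop :=
  small_derivation /\
  forall (r : nat) (P : {mpoly (valring F)[r.+1]}),
    msize (map_mpoly (@reduction G F) P) = 2%N ->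
  exists y : valring F,
    (map_mpoly val P).@[fun i => iter i der (val y)] = 0.

Definition constant_value_group : set G :=
  [set v f | f in [set f | constants F f /\ f != 0]].

Definition value_group : set G := [set v f | f in [set f | f != 0]].

End ValuedDiffFieldDefs.

Definition pure_subgroup (G : zmodType) (A B : set G) : Prop :=
  A `<=` B /\
  forall (n : nat) (b : G), (0 < n)%N -> B b -> A (b *+ n) ->
    exists2 a, A a & a *+ n = b *+ n.

Inductive term (n : nat) : Type :=
| Var of 'I_n
| Zero
| One
| Add of term n & term n
| Opp of term n
| Mul of term n & term n
| Der of term n.

(* A [formula n] has its free variables among 0, ..., n-1, so a [formula 0] is
   a sentence; [All] binds variable 0 and shifts the others. *)
Inductive formula : nat -> Type :=
| Eq n of term n & term n : formula n
| InValring n of term n : formula n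
| Bot n : formula n
| Imp n of formula n & formula n : formula n
| All n of formula n.+1 : formula n.

Section Semantics.
Variables (G : oagType) (F : valuedDiffFieldType G).

Fixpoint eval n (e : 'I_n -> F) (t : term n) : F :=
  match t with
  | Var i => e i
  | Zero => 0
  | One => 1
  | Add t u => eval e t + eval e u
  | Opp t => - eval e t
  | Mul t u => eval e t * eval e u
  | Der t => der (eval e t)
  end.

Definition env_cons n (x : F) (e : 'I_n -> F) : 'I_n.+1 -> F :=
  fun i => oapp e x (unlift ord0 i).

Fixpoint holds n (phi : formula n) : ('I_n -> F) -> Prop :=
  match phi in formula n return ('I_n -> F) -> Prop with
  | Eq _ t u => fun e => eval e t = eval e u
  | InValring _ t => fun e => eval e t \in @in_valring G F
  | Bot _ => fun=> False
  | Imp _ phi psi => fun e => holds phi e -> holds psi e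
  | All _ phi => fun e => forall x : F, holds phi (env_cons x e)
  end.

Definition models (phi : formula 0) : Prop :=
  forall e : 'I_0 -> F, holds phi e.

End Semantics.

Definition elem_equiv (G H : oagType) (F : valuedDiffFieldType G)
    (K : valuedDiffFieldType H) : Prop :=
  forall phi : formula 0, models F phi <-> models K phi.

Section WellOrderedSets.
Variable G : oagType.
Implicit Types A B C : set G.

Definition well_ordered A : Prop :=
  forall B, B `<=` A -> B !=set0 -> exists2 m, B m & forall x, B x -> m <= x.

Definition sumset A B : set G := [set a + b | a in A & b in B].

Lemma well_orderedS A B : A `<=` B -> well_ordered B -> well_ordered A.
Proof. by move=> AB wB C CA; apply: wB; apply: subset_trans AB. Qed.

Lemma well_ordered1 x : well_ordered [set x].
Proof.
move=> B Bx [y By]; exists y => // z Bz.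
by rewrite (Bx _ By) (Bx _ Bz) lexx.
Qed.

Lemma well_orderedU A B :
  well_ordered A -> well_ordered B -> well_ordered (A `|` B).
Proof.
move=> wA wB C CAB C0.
have [CA0|/set0P/negP/negPn/eqP CA0] := pselect ((C `&` A) !=set0); last first.
  apply: wB => // x Cx; case: (CAB x Cx) => // Ax.
  by have : (C `&` A) x by []; rewrite CA0.
have [CB0|/set0P/negP/negPn/eqP CB0] := pselect ((C `&` B) !=set0); last first.
  apply: wA => // x Cx; case: (CAB x Cx) => // Bx.
  by have : (C `&` B) x by []; rewrite CB0.
have [a [Ca _] am] := wA _ (@subIsetr _ C A) CA0.
have [b [Cb _] bm] := wB _ (@subIsetr _ C B) CB0.
case/orP: (oag_total a b) => ab; [exists a|exists b] => // x Cx.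
  by case: (CAB x Cx) => ?; [apply: am|apply: (le_trans ab); apply: bm].
by case: (CAB x Cx) => ?; [apply: (le_trans ab); apply: am|apply: bm].
Qed.

Lemma well_ordered_sumset A B :
  well_ordered A -> well_ordered B -> well_ordered (sumset A B).
Proof.
move=> wA wB C CAB [c0 Cc0].
pose good a b := [/\ A a, B b, C (a + b) &
  forall a' b', A a' -> B b' -> C (a' + b') -> a' + b' <= a + b -> a <= a'].
have below c : C c -> exists a b, good a b /\ a + b <= c.
  move=> Cc.
  pose Q := [set a | A a /\ exists2 b, B b & C (a + b) /\ a + b <= c].
  have [||a [Aa [b Bb [Cab abc]]] am] := wA Q; first by move=> a [].
  - have [a Aa [b Bb abc]] := CAB c Cc.
    by exists a; split=> //; exists b => //; rewrite abc.
  exists a, b; split=> //; split=> // a' b' Aa' Bb' Cab' le'.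
  by apply: am; split=> //; exists b' => //; split=> //; apply: le_trans abc.
pose D := [set b | exists a, good a b].
have [||b0 [a0 g0] bm] := wB D; first by move=> b [a []].
  by have [a [b [gab _]]] := below _ Cc0; exists b, a.
case: (g0) => Aa0 Bb0 C0 min0.
exists (a0 + b0) => // c /below[a [b [gab abc]]]; apply: le_trans abc.
case: (gab) => Aa Bb Cab _.
case: (comparable_leP (oag_cmp (a0 + b0) (a + b))) => // lt.
have : a0 + b0 <= a + b.
  by apply: oag_lerD; [apply: (min0 a b) => //; apply: ltW|apply: bm; exists a].
by rewrite comparable_leNgt ?oag_cmp // lt.
Qed.

Lemma finite_two_sided A :
  well_ordered A ->
  (forall B, B `<=` A -> B !=set0 -> exists2 m, B m & forall x, B x -> x <= m) ->
  finite_set A.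
Proof.
move=> wA rA.
pose P := [set x | A x /\ finite_set (A `&` [set y | y <= x])].
have [[a0 Aa0]|/set0P/negP/negPn/eqP ->] := pselect (A !=set0); last first.
  exact: finite_set0.
have PA : P `<=` A by move=> x [].
have [|M [AM fM] maxM] := rA P PA.
  have [m Am mm] := wA A (@subset_refl _ A) (ex_intro _ a0 Aa0).
  exists m; split=> //; apply: (@sub_finite_set _ _ [set m]).
    move=> x [Ax /= xm]; apply/eqP; rewrite eq_le xm /=; exact: mm.
  exact: finite_set1.
have [/(wA (A `\` P) (@subDsetl _ _ _))[m [Am nPm] mm]|] :=
    pselect ((A `\` P) !=set0).
  case: nPm; split=> //.
  apply: (@sub_finite_set _ _ ([set m] `|` (A `&` [set y | y <= M]))).
    move=> x [Ax /= xm]; have [Px|nPx] := pselect (P x).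
      by right; split=> //; apply: maxM.
    by left; apply/eqP; rewrite eq_le xm /=; apply: mm; split.
  by rewrite finite_setU; split=> //; apply: finite_set1.
move=> /set0P/negP/negPn/eqP; rewrite setD_eq0 => AP.
apply: (sub_finite_set _ fM) => x Ax; split=> //=; apply: maxM; exact: AP.
Qed.

Lemma finite_sum_decompositions A B (c : G) :
  well_ordered A -> well_ordered B ->
  finite_set [set a | A a /\ B (c - a)].
Proof.
move=> wA wB; apply: finite_two_sided.
  by apply: well_orderedS wA => a [].
move=> C CAB [a0 Ca0].
have [||m [a Ca <-] mm] := wB [set c - a | a in C]; first last.
- exists a => // x Cx; have : c - a <= c - x by apply: mm; exists x.
  by rewrite -[_ <= c - x]oag_subr_ge0 opprB addrC addrA subrK oag_subr_ge0.
- by exists (c - a0), a0.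
- by move=> _ [a Ca <-]; case: (CAB a Ca).
Qed.

End WellOrderedSets.

Section HahnZmod.
Variables (k : fieldType) (G : oagType).

Definition supp (f : G -> k) : set G := [set x | f x != 0].

Definition wo_supp : {pred (G -> k)} := fun f => `[< well_ordered (supp f) >].

Record hahn := Hahn { hcoef :> G -> k; _ : hcoef \in wo_supp }.

HB.instance Definition _ := [isSub for hcoef].
HB.instance Definition _ := [Choice of hahn by <:].

Lemma wo_supp_zmod : zmod_closed wo_supp.
Proof.
split=> [|f g].
  by apply/asboolP => B B0 [x /B0]; rewrite /supp /= eqxx.
move=> /asboolP wf /asboolP wg; apply/asboolP.
apply: well_orderedS (well_orderedU wf wg) => x; rewrite /supp /=.
case: (eqVneq (f x) 0) => [fx0|]; last by left.
case: (eqVneq (g x) 0) => [gx0|]; last by right.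
by move=> /eqP[]; rewrite -[LHS]/(f x - g x) fx0 gx0 subr0.
Qed.

HB.instance Definition _ := GRing.isZmodClosed.Build (G -> k) wo_supp wo_supp_zmod.
HB.instance Definition _ := [SubChoice_isSubZmodule of hahn by <:].

End HahnZmod.

Section HahnField.
Variables (k : fieldType) (G : oagType).
Local Notation hahn := (hahn k G).
Implicit Types f g h : hahn.

Lemma hahn_wo f : well_ordered (supp f).
Proof. by have /asboolP := valP f. Qed.

Definition mkhahn (f : G -> k) (wf : well_ordered (supp f)) : hahn :=
  Hahn (introT (asboolP _) wf).

Lemma hahnP f g : f =1 g <-> f = g.
Proof. by split=> [fg|->//]; apply/val_inj/funext. Qed.

Lemma hahnD f g x : (f + g) x = f x + g x. Proof. by []. Qed.
Lemma hahnN f x : (- f) x = - f x. Proof. by []. Qed.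
Lemma hahn0 x : (0 : hahn) x = 0. Proof. by []. Qed.

(* The sum over [G] is the library's sum over a finite support; the support is
   finite when [supp f] and [supp g] are well ordered, see [hmulE]. *)
Definition conv (f g : G -> k) : G -> k :=
  fun c => \sum_(a \in [set: G]) f a * g (c - a).

Lemma convE (f g : G -> k) c (D : {fset G}) :
  (forall a, f a != 0 -> g (c - a) != 0 -> a \in D) ->
  conv f g c = \sum_(a <- D) f a * g (c - a).
Proof.
move=> fgD; apply: fsbigTE => a aD.
apply/eqP/negPn/negP; rewrite mulf_eq0 negb_or => /andP[fa ga].
by rewrite fgD in aD.
Qed.

Lemma conv_supp (f g : G -> k) : supp (conv f g) `<=` sumset (supp f) (supp g).
Proof.
move=> c; rewrite /supp /= => /eqP fgc; apply: contrapT => nc; apply: fgc.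
apply: fsbig1 => a _; apply/eqP/negPn/negP; rewrite mulf_eq0 negb_or.
move=> /andP[fa ga]; apply: nc; exists a => //; exists (c - a) => //.
by rewrite addrC subrK.
Qed.

Lemma conv_wo f g : well_ordered (supp (conv f g)).
Proof.
by apply: well_orderedS (@conv_supp f g) (well_ordered_sumset _ _); apply: hahn_wo.
Qed.

Definition hmul f g : hahn := mkhahn (@conv_wo f g).

Lemma single_wo (b : k) (e : G) :
  well_ordered (supp (fun x => if x == e then b else 0)).
Proof.
apply: well_orderedS (@well_ordered1 _ e) => x; rewrite /supp /=.
by case: (x =P e) => // _; rewrite eqxx.
Qed.

Definition hmonom b e : hahn := mkhahn (@single_wo b e).

Definition hdom f g c : {fset G} :=
  fset_set [set a | supp f a /\ supp g (c - a)].

Lemma mem_hdom f g c a : f a != 0 -> g (c - a) != 0 -> a \in hdom f g c.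
Proof.
move=> fa ga; rewrite in_fset_set ?inE //.
by apply: finite_sum_decompositions; apply: hahn_wo.
Qed.

Lemma hmulE f g c : hmul f g c = \sum_(a <- hdom f g c) f a * g (c - a).
Proof. by apply: convE => a; apply: mem_hdom. Qed.

Lemma hmonomE b e f c : hmul (hmonom b e) f c = b * f (c - e).
Proof.
rewrite [LHS](@convE _ _ _ [fset e]%fset) ?big_seq_fset1 /= ?eqxx // => a /=.
by rewrite inE; case: (a == e) => //; rewrite eqxx.
Qed.

Lemma hmulC : commutative hmul.
Proof.
move=> f g; apply/hahnP => c; rewrite hmulE [RHS](@convE _ _ _
  [fset (c - a)%R | a in hdom f g c]%fset).
  rewrite big_imfset /=; last by move=> x y _ _ /(congr1 (fun z => c - z)); rewrite !subKr.
  by apply: eq_bigr => a _; rewrite subKr mulrC.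
move=> a ga fa; apply/imfsetP; exists (c - a) => /=; last by rewrite subKr.
by apply: mem_hdom => //; rewrite subKr.
Qed.

Lemma hmul1 : left_id (hmonom 1 0) hmul.
Proof. by move=> f; apply/hahnP => c; rewrite hmonomE mul1r subr0. Qed.

Lemma hmulDl : left_distributive hmul +%R.
Proof.
move=> f g h; apply/hahnP => c; rewrite hahnD.
pose D := (hdom f h c `|` hdom g h c)%fset.
rewrite ![hmul _ h c](@convE _ _ _ D); first last.
- move=> a fga ha; rewrite inE; have [fa|fa] := eqVneq (f a) 0.
    by rewrite (@mem_hdom g h) ?orbT //; move: fga; rewrite hahnD fa add0r.
  by rewrite mem_hdom.
- by move=> a fa ha; rewrite inE mem_hdom.
- by move=> a fa ha; rewrite inE (mem_hdom fa) ?orbT.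
by rewrite -big_split; apply: eq_bigr => a _; rewrite hahnD mulrDl.
Qed.

Lemma hmulA : associative hmul.
Proof.
move=> f g h; apply/hahnP => c.
pose A := fset_set [set a | supp f a /\ sumset (supp g) (supp h) (c - a)].
pose B := fset_set [set b | sumset (supp f) (supp g) b /\ supp h (c - b)].
have wo := hahn_wo.
have memA a b : f a != 0 -> g (b - a) != 0 -> h (c - b) != 0 -> a \in A.
  move=> fa gb hc; rewrite in_fset_set ?inE /=.
    split=> //; exists (b - a) => //; exists (c - b) => //.
    by rewrite addrC addrA subrK.
  by apply: finite_sum_decompositions => //; apply: well_ordered_sumset.
have memB a b : f a != 0 -> g (b - a) != 0 -> h (c - b) != 0 -> b \in B.
  move=> fa gb hc; rewrite in_fset_set ?inE /=.
    split=> //; exists a => //; exists (b - a) => //.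
    by rewrite addrC subrK.
  by apply: finite_sum_decompositions => //; apply: well_ordered_sumset.
have neq0 (x y : k) : x * y != 0 -> x != 0 /\ y != 0.
  by rewrite mulf_eq0 negb_or => /andP.
rewrite [LHS](@convE _ _ _ A); last first.
  move=> a fa /conv_supp[b gb [d hd bd]]; apply: (memA a (b + a)) => //.
    by rewrite addrK.
  by rewrite opprD addrCA -bd addKr.
rewrite [RHS](@convE _ _ _ B); last first.
  move=> b /conv_supp[a fa [d gd <-]] hb; apply: (memB a) => //.
  by rewrite addrC addKr.
transitivity (\sum_(a <- A) \sum_(b <- B) f a * (g (b - a) * h (c - b))).
  apply: eq_bigr => a _; rewrite -big_distrr /=.
  have [->|fa] := eqVneq (f a) 0; first by rewrite !mul0r.
  congr (_ * _); rewrite (@convE _ _ _ [fset (b - a)%R | b in B]%fset).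
    rewrite big_imfset /=; last by move=> x y _ _; apply: addIr.
    by apply: eq_bigr => b _; rewrite opprB addrA subrK.
  move=> d gd hd; apply/imfsetP; exists (d + a) => /=; last by rewrite addrK.
  by apply: (memB a) => //; rewrite ?addrK // opprD addrA addrAC.
rewrite exchange_big; apply: eq_bigr => b _ /=.
have [hb|hb] := eqVneq (h (c - b)) 0.
  by rewrite hb mulr0 big1 // => a _; rewrite !mulr0.
rewrite (@convE _ _ _ A); last by move=> a fa gb; apply: (memA a b).
by rewrite big_distrl /=; apply: eq_bigr => a _; rewrite mulrA.
Qed.

Lemma hahn1_neq0 : hmonom 1 0 != 0.
Proof.
by apply/eqP => /hahnP/(_ 0)/eqP; rewrite /= eqxx oner_eq0.
Qed.

HB.instance Definition _ := GRing.Zmodule_isComNzRing.Build hahn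
  hmulA hmulC hmul1 hmulDl hahn1_neq0.

Lemma supp_geP (f : G -> k) m :
  (forall x, f x != 0 -> m <= x) <-> (forall x, x < m -> f x = 0).
Proof.
split=> fm x.
  move=> xm; apply/eqP/negPn/negP => /fm.
  by rewrite comparable_leNgt ?oag_cmp // xm.
move=> fx; rewrite comparable_leNgt ?oag_cmp //; apply/negP => /fm fx0.
by rewrite fx0 eqxx in fx.
Qed.

Lemma supp_lt0 (f : G -> k) m x :
  (forall x, f x != 0 -> m <= x) -> x < m -> f x = 0.
Proof. by move=> /supp_geP; apply. Qed.

(* The least element of the support; [hval 0] is a junk value. *)
Definition hval f : G :=
  xget 0 [set m | supp f m /\ forall x, supp f x -> m <= x].

Lemma hvalP f : f != 0 -> f (hval f) != 0 /\ forall x, f x != 0 -> hval f <= x.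
Proof.
move=> f0; suff [m mf] : exists m, [set m | supp f m /\
  forall x, supp f x -> m <= x] m by apply: (xgetI 0 mf).
have [|m fm mm] := hahn_wo (@subset_refl _ (supp f)); last by exists m.
apply: contrapT => n0; move/eqP: f0; apply; apply/hahnP => x.
by apply/eqP/negPn/negP => fx; apply: n0; exists x.
Qed.

Lemma hval_ge f m : f != 0 -> (forall x, f x != 0 -> m <= x) -> m <= hval f.
Proof. by move=> /hvalP[fv _]; apply. Qed.

Lemma hval_eq f m : f m != 0 -> (forall x, f x != 0 -> m <= x) -> hval f = m.
Proof.
move=> fm mm; have f0 : f != 0 by apply: contraNneq fm => ->.
by have [fv lv] := hvalP f0; apply/eqP; rewrite eq_le lv ?mm.
Qed.

Lemma hmul_supp_ge f g m n c :
  (forall x, f x != 0 -> m <= x) -> (forall x, g x != 0 -> n <= x) ->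
  (f * g) c != 0 -> m + n <= c.
Proof.
by move=> fm gn /conv_supp[a fa [b gb <-]]; apply: oag_lerD; [apply: fm|apply: gn].
Qed.

Lemma hmul_lead f g m n :
  (forall x, f x != 0 -> m <= x) -> (forall x, g x != 0 -> n <= x) ->
  (f * g) (m + n) = f m * g n.
Proof.
move=> fm gn; rewrite [LHS](@convE _ _ _ [fset m]%fset).
  by rewrite big_seq_fset1 addrAC subrr add0r.
move=> a /fm ma /gn; rewrite inE eq_le ma andbT.
by rewrite -oag_subr_ge0 addrAC addrK oag_subr_ge0.
Qed.

(* Inverses: a maximal partial solution [g] of [f * g = 1] is a solution,
   since the leading term of a nonzero [1 - f * g] could be cancelled. *)
Lemma hahn_inverse f : f != 0 -> exists g, g * f = 1.
Proof.
move=> f0; have [fm mf] := hvalP f0; set m := hval f in fm mf.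
apply: contrapT => ninv.
pose r g := 1 - g * f; pose d g := hval (r g).
have r0 g : r g != 0.
  by apply/eqP => rg; apply: ninv; exists g; apply/eqP; rewrite eq_sym -subr_eq0; apply/eqP.
have rP g := hvalP (r0 g).
pose le g g' := g = g' \/ (d g < d g' /\ forall x, x < d g - m -> g' x = g x).
have le_refl g : `[< le g g >] by apply/asboolP; left.
have le_tr g1 g2 g3 : `[< le g1 g2 >] -> `[< le g2 g3 >] -> `[< le g1 g3 >].
  move=> /asboolP[->//|[d12 e12]] /asboolP[<-|[d23 e23]]; apply/asboolP; right=> //.
  split=> [|x xd]; first exact: lt_trans d23.
  by rewrite e23 ?e12 //; apply: (lt_trans xd); rewrite oag_ltrD2rE.
have le_anti g1 g2 : `[< le g1 g2 >] -> `[< le g2 g1 >] -> g1 = g2.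
  move=> /asboolP[->//|[d12 _]] /asboolP[->//|[d21 _]].
  by have := lt_trans d12 d21; rewrite ltxx.
have [//|//|//||g maxg] := @Zorn hahn (fun g g' => `[< le g g' >]).
  move=> C totC.
  have [[t Ct tC]|nmax] := pselect (exists2 t, C t & forall s, C s -> le s t).
    by exists t => s Cs; apply/asboolP/tC.
  have next s : C s -> exists2 t, C t & d s < d t /\ forall x, x < d s - m -> t x = s x.
    move=> Cs; apply: contrapT => nt; apply: nmax; exists s => // t Ct.
    case: (totC s t Cs Ct) => /asboolP // -[->|lt]; first by left.
    by case: nt; exists t.
  have coh s t x : C s -> C t -> x < d s - m -> x < d t - m -> s x = t x.
    move=> Cs Ct xs xt; case: (totC s t Cs Ct) => /asboolP[->//|[_ e]].
      by rewrite e.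
    exact: e.
  pose u x := xget 0 [set y | exists2 s, C s & x < d s - m /\ s x = y].
  have uE s x : C s -> x < d s - m -> u x = s x.
    move=> Cs xs; rewrite /u; case: xgetP => [y _ [t Ct [xt <-]]|/(_ (s x))[]].
      exact: coh.
    by exists s.
  have u0 x : u x != 0 -> exists2 s, C s & x < d s - m.
    by rewrite /u; case: xgetP => [y _ [t Ct [xt _]]|]; [exists t|rewrite eqxx].
  have wu : well_ordered (supp u).
    move=> B Bu [x Bx]; have [s Cs xs] := u0 x (Bu x Bx).
    have [||y [By yx] ym] := hahn_wo (f := s) (B := B `&` [set y | y <= x]).
    - move=> y [By yx]; rewrite /supp /= -(uE s) //; first exact: Bu.
      exact: le_lt_trans xs.
    - by exists x; split=> //=.
    exists y => // z Bz; case/orP: (oag_total z x) => zx; first by apply: ym.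
    exact: le_trans zx.
  exists (mkhahn wu) => s Cs; apply/asboolP; right.
  have dge t : C t -> d t <= d (mkhahn wu).
    move=> Ct; apply: hval_ge => //; apply/supp_geP => x xd.
    have -> : r (mkhahn wu) = r t - (mkhahn wu - t) * f.
      by rewrite /r mulrBl opprB addrA subrK.
    rewrite hahnD hahnN (supp_lt0 (rP t).2) // sub0r.
    apply/eqP; rewrite oppr_eq0; apply/eqP; move: x xd; apply/supp_geP => x.
    rewrite -[d t](subrK m); apply: hmul_supp_ge => //; apply/supp_geP => y yd.
    by rewrite hahnD hahnN /= (uE t) // subrr.
  split=> [|x xs]; last exact: uE.
  have [t Ct [st _]] := next s Cs.
  exact: lt_le_trans (dge t Ct).
have [rg minr] := rP g; rewrite -/(d g) in rg minr.
pose p := hmonom (r g (d g) / f m) (d g - m).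
have rgp x : r (g + p) x = r g x - r g (d g) / f m * f (x - (d g - m)).
  by rewrite /r mulrDl opprD addrA hahnD hahnN hmonomE.
have dlt : d g < d (g + p).
  rewrite lt_neqAle; apply/andP; split.
    apply/eqP => dd; have [+ _] := rP (g + p); rewrite -/(d _) -dd rgp.
    by rewrite subKr divfK // subrr eqxx.
  apply: hval_ge => //; apply/supp_geP => x xd; rewrite rgp.
  rewrite (supp_lt0 minr) // (@supp_lt0 f m (x - (d g - m)) mf) ?mulr0 ?subr0 //.
  by rewrite opprB addrCA -oag_subr_gt0 opprD addrA subrr sub0r opprB
    oag_subr_gt0.
have /maxg gp : `[< le g (g + p) >].
  apply/asboolP; right; split=> // x xd; rewrite hahnD /=.
  by rewrite (lt_eqF xd) addr0.
by move: dlt; rewrite gp ltxx.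
Qed.

Definition hinv f : hahn := if f == 0 then 0 else xget 0 [set g | g * f = 1].

Lemma hmulVf f : f != 0 -> hinv f * f = 1.
Proof.
move=> f0; have [g gf] := hahn_inverse f0; rewrite /hinv (negPf f0).
exact: (xgetI 0 (P := [set g | g * f = 1]) gf).
Qed.

Lemma hinv0 : hinv 0 = 0. Proof. by rewrite /hinv eqxx. Qed.

HB.instance Definition _ := GRing.ComNzRing_isField.Build hahn hmulVf hinv0.

Lemma hvalM f g : f != 0 -> g != 0 -> hval (f * g) = hval f + hval g.
Proof.
move=> /hvalP[f0 fm] /hvalP[g0 gm]; apply: hval_eq.
  by rewrite hmul_lead // mulf_neq0.
by move=> x; apply: hmul_supp_ge.
Qed.

Lemma hvalD f g : f != 0 -> g != 0 -> f + g != 0 ->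
  Order.min (hval f) (hval g) <= hval (f + g).
Proof.
move=> /hvalP[f0 fm] /hvalP[g0 gm] fg0; apply: hval_ge => // x.
rewrite hahnD comparable_ge_min ?oag_cmp //.
have [->|/fm ->//] := eqVneq (f x) 0.
by rewrite add0r => /gm ->; rewrite orbT.
Qed.

HB.instance Definition _ := isValued.Build G hahn hvalM hvalD.

Lemma hahn_natr n : (n%:R : hahn) = hmonom n%:R 0.
Proof.
apply/hahnP => x; elim: n => [|n IH]; first by rewrite /=; case: ifP.
by rewrite !mulrS hahnD IH /=; case: ifP => _; rewrite ?addr0 // mulrS.
Qed.

End HahnField.

Section HahnDerivation.
Variables (k : diffFieldType) (G : oagType).

(* The derivation depends on [c], which is therefore recorded in the type. *)
Definition hahn_c (c : {additive G -> k}) : Type := hahn k G.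

Variable c : {additive G -> k}.
Local Notation K := (hahn_c c).

HB.instance Definition _ := GRing.Field.on K.
HB.instance Definition _ := ValuedField.on K.
Implicit Types f g : K.

Lemma der0 : der (0 : k) = 0.
Proof. by apply: (addIr (der 0)); rewrite -derD !add0r. Qed.

Lemma der_sum (I : Type) (r : seq I) (F : I -> k) :
  der (\sum_(i <- r) F i) = \sum_(i <- r) der (F i).
Proof. exact: (big_morph _ (@derD k) der0). Qed.

Lemma hder_wo f : well_ordered (supp (fun x : G => der (f x) + c x * f x)).
Proof.
apply: (well_orderedS _ (@hahn_wo _ _ f)) => x; rewrite /supp /=; apply: contraNneq => ->.
by rewrite der0 mulr0 addr0.
Qed.

Definition hder f : K := mkhahn (@hder_wo f).

Lemma hderD : {morph hder : f g / f + g}.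
Proof.
move=> f g; apply/hahnP => x.
rewrite -[LHS]/(der (f x + g x) + c x * (f x + g x)).
by rewrite -[RHS]/((der (f x) + c x * f x) + (der (g x) + c x * g x))
  derD mulrDr addrACA.
Qed.

Lemma hderM f g : hder (f * g) = hder f * g + f * hder g.
Proof.
apply/hahnP => x; rewrite -[RHS]/((hder f * g) x + (f * hder g) x).
have fgD a : f a != 0 -> g (x - a) != 0 -> a \in hdom f g x.
  exact: mem_hdom.
have hder0 (h : K) a : hder h a != 0 -> h a != 0.
  by apply: contraNneq => /= ->; rewrite der0 mulr0 addr0.
have -> : (hder f * g) x = \sum_(a <- hdom f g x) hder f a * g (x - a).
  by apply: convE => a /hder0; apply: fgD.
have -> : (f * hder g) x = \sum_(a <- hdom f g x) f a * hder g (x - a).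
  by apply: convE => a fa /hder0; apply: fgD.
have -> : hder (f * g) x = der ((f * g) x) + c x * (f * g) x by [].
have -> : (f * g) x = \sum_(a <- hdom f g x) f a * g (x - a) by exact: hmulE.
rewrite der_sum big_distrr -!big_split; apply: eq_bigr => a _ /=.
have -> : c x = c a + c (x - a) by rewrite -raddfD addrC subrK.
rewrite derM !mulrDl !mulrDr -!addrA; congr (_ + _).
rewrite [RHS]addrCA; congr (_ + _).
by rewrite mulrA; congr (_ + _); rewrite mulrCA.
Qed.

Lemma hahn_natr_eq0 n : (n%:R == 0 :> K) = (n%:R == 0 :> k).
Proof.
apply/eqP/eqP => [|n0]; rewrite (hahn_natr k G n).
  by move=> /hahnP/(_ 0); rewrite /= eqxx.
by apply/hahnP => x /=; case: ifP.
Qed.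

Lemma natr_neq0 n : (0 < n)%N -> n%:R != 0 :> k.
Proof. by move: (@diff_pchar0 k) => /pcharf0P ->; rewrite -lt0n. Qed.

Lemma hahn_pchar0 : [pchar K] =i pred0.
Proof. by apply/pcharf0P => n; rewrite hahn_natr_eq0; move: n; apply/pcharf0P/diff_pchar0. Qed.

HB.instance Definition _ := isDifferential.Build K hderD hderM hahn_pchar0.

Lemma hahn_residue_pchar0 : [pchar (@residue G K)] =i pred0.
Proof.
move=> p; rewrite !inE; apply/negP => /andP[/prime_gt0 p0].
rewrite -(rmorph_nat (@reduction G K)) reduction_eq0 inE rmorph_nat.
rewrite hahn_natr_eq0 (negPf (natr_neq0 p0)) /= /valuation /= (hahn_natr k G p).
rewrite (hval_eq (m := 0)) ?ltxx //= ?eqxx ?natr_neq0 // => x /=.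
by case: (x =P 0) => [-> //|]; rewrite eqxx.
Qed.

HB.instance Definition _ := hasResidueChar0.Build G K hahn_residue_pchar0.

End HahnDerivation.

Arguments hahn_c {k G} c.

(* Main.v *)
(** Let [K] be an ultrapower of [F] over a nonprincipal ultrafilter on [nat], with
    [F] valued in its value group. It is elementarily equivalent to [F], it remains
    monotone and differential-henselian, countable families of pairwise meeting balls
    of [K] have a common point, and countable systems [a_i = w_i * a_(i+1)^(n_i)] in
    units [w_i] are solvable in units.

    A maximal differential subfield [k] of [K] on which the valuation is trivial maps
    onto the residue field, by Newton approximation; it is linearly surjective because
    linear equations over [k] have roots in the valuation ring. Solvability of the
    systems above extends a multiplicative section of the valuation from a pure
    subgroup to the pure hull of that subgroup with one more element. This gives first
    a section with constant values on the value group of the constant field and then,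
    as that subgroup is pure, a section [s] on the whole group with [s(g)' = c(g) s(g)]
    and [c(g)] in [k]. If [c(g) = a'/a] then [s(g)/a] is a constant of value [g], hence
    [s(g)] is a constant and [c(g) = 0].

    [K] and the Hahn field over [(k, c)] now have the same residue field and sections
    with the same logarithmic derivative [c]. They are elementarily equivalent by a back
    and forth between countable differential subfields [S] of [K1 * K2] in which both
    components of every nonzero pair have the same leading term [a * s(g)]. To put a new
    [y] in the domain, take a differential polynomial of minimal complexity which varies
    on every ball around [y] with center in the domain: its derivatives are constant up
    to smaller terms near [y], so Newton approximation yields roots in both fields that
    lie in all these balls, and the subfields generated by such roots are matched. *)

Require Import Defs.
From HB Require Import structures.
From mathcomp Require Import all_boot all_order all_algebra.
From mathcomp Require Import generic_quotient mpoly.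
From mathcomp Require Import boolp classical_sets functions filter.

Set Implicit Arguments.
Unset Strict Implicit.
Unset Printing Implicit Defensive.

Import Order.TTheory GRing.Theory.
Local Open Scope ring_scope.
Local Open Scope classical_set_scope.

(** * Valuation bounds and Gauss norms *)

(** Countability is the obstacle that shapes the proof. An ultrapower over [nat] gives common points
    only to countable families of balls, so the subfields matched in the back and forth have to be
    countable, while [k] and the value group need not be. Hence all of [k] and the whole section are
    adjoined in one stroke, and the result is then cut down to a countable set closed under the
    operations in use. Only [F] needs an ultrapower; the Hahn field is spherically complete as it
    stands.

    The value group is not assumed divisible. The pure hull of one more element may be an infinite
    chain of roots, for which values of the section must be chosen compatibly; this compatibility is
    what the systems [a_i = w_i * a_(i+1)^(n_i)] express.

    The polynomial that controls a new [y] need not vanish at [y], so the root adjoined may differ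
    from [y]. It is new all the same, and a subfield that is maximal inside the countable set must
    therefore contain [y]. *)

Section OrderedGroup.
Variable G : oagType.
Implicit Types x y z : G.

Lemma oag_leNgt x y : (x <= y) = ~~ (y < x).
Proof. by rewrite comparable_leNgt // oag_cmp. Qed.

Lemma oag_ltNge x y : (x < y) = ~~ (y <= x).
Proof. by rewrite comparable_ltNge // oag_cmp. Qed.

Lemma oag_leD2l z x y : (z + x <= z + y) = (x <= y).
Proof. by rewrite ![z + _]addrC oag_lerD2rE. Qed.

Lemma oag_ltD2l z x y : (z + x < z + y) = (x < y).
Proof. by rewrite ![z + _]addrC oag_ltrD2rE. Qed.

Lemma oag_leN2 x y : (- x <= - y) = (y <= x).
Proof. by rewrite -[LHS]oag_subr_ge0 opprK addrC oag_subr_ge0. Qed.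

Lemma oag_lt_subl x y z : (x - y < z) = (x < z + y).
Proof. by rewrite -[LHS](oag_ltrD2rE y) subrK. Qed.

Lemma oag_le_subr x y z : (z <= x - y) = (z + y <= x).
Proof. by rewrite -[LHS](oag_lerD2rE y) subrK. Qed.

Lemma oag_lt_subr x y z : (z < x - y) = (z + y < x).
Proof. by rewrite -[LHS](oag_ltrD2rE y) subrK. Qed.

Lemma oag_leMn n x y : x <= y -> x *+ n <= y *+ n.
Proof.
by move=> xy; elim: n => [|n IH]; rewrite ?mulr0n ?lexx // !mulrS oag_lerD.
Qed.

Lemma oag_ltMn n x y : (0 < n)%N -> x < y -> x *+ n < y *+ n.
Proof. by case: n => // n _ xy; rewrite !mulrS oag_ltr_leD // oag_leMn // ltW. Qed.

Lemma oag_mulIn n x y : (0 < n)%N -> x *+ n = y *+ n -> x = y.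
Proof.
move=> n0 xy; case: (comparable_ltgtP (oag_cmp x y)) => // /(oag_ltMn n0);
by rewrite xy ltxx.
Qed.

Lemma oag_ltMnr x m n : 0 < x -> (m < n)%N -> x *+ m < x *+ n.
Proof.
move=> g0 /subnKC <-; rewrite addSnnS mulrnDr -{1}[x *+ m]addr0 oag_ltD2l.
by rewrite -{1}(mul0rn G (n - m.+1).+1) oag_ltMn.
Qed.

End OrderedGroup.

Section ValuationBounds.
Variables (G : oagType) (K : valuedFieldType G).
Local Notation v := (@valuation G K).
Implicit Types (x y : K) (g h : G) (s : bool).

(* [v x > g] or [v x >= g], with [v 0] read as infinity. *)
Definition vb s g x := (x == 0) || (if s then g < v x else g <= v x).

Lemma vb0 s g : vb s g 0. Proof. by rewrite /vb eqxx. Qed.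

Lemma vbN s g x : vb s g (- x) = vb s g x.
Proof. by rewrite /vb oppr_eq0; case: eqVneq => //= x0; rewrite valN. Qed.

Lemma vbD s g x y : vb s g x -> vb s g y -> vb s g (x + y).
Proof.
rewrite /vb; have [->|x0] := eqVneq x 0; first by rewrite add0r.
have [->|y0] := eqVneq y 0; first by rewrite addr0 (negPf x0).
have [//|xy0] /= := eqVneq (x + y) 0; have := valD x y x0 y0 xy0.
case: s => h hx hy; [apply: lt_le_trans h|apply: le_trans h].
  by rewrite comparable_lt_min ?oag_cmp // hx.
by rewrite comparable_le_min ?oag_cmp // hx.
Qed.

Lemma vbB s g x y : vb s g x -> vb s g y -> vb s g (x - y).
Proof. by move=> hx hy; apply: vbD; rewrite ?vbN. Qed.

Lemma vb_dist s g x y z : vb s g (x - z) -> vb s g (y - z) -> vb s g (x - y).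
Proof. by move=> hx hy; have := vbB hx hy; rewrite opprB addrA subrK. Qed.

Lemma vb_sum s g (I : Type) (r : seq I) (P : pred I) (F : I -> K) :
  (forall i, P i -> vb s g (F i)) -> vb s g (\sum_(i <- r | P i) F i).
Proof. by move=> h; elim/big_ind: _ => // [|x y]; [apply: vb0|apply: vbD]. Qed.

Lemma vbM s t g h x y : vb s g x -> vb t h y -> vb (s || t) (g + h) (x * y).
Proof.
rewrite /vb; have [->|x0] := eqVneq x 0; first by rewrite mul0r eqxx.
have [->|y0] := eqVneq y 0; first by rewrite mulr0 eqxx.
rewrite mulf_eq0 (negPf x0) (negPf y0) /= Defs.valM //.
case: s; case: t => /= hx hy; rewrite ?oag_lerD //.
- by rewrite oag_ltr_leD // ltW.
- by rewrite oag_ltr_leD.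
by rewrite addrC [X in _ < X]addrC oag_ltr_leD.
Qed.

Lemma vbW s g x : vb true g x -> vb s g x.
Proof. by case: s => // /orP[/eqP->|/ltW h]; rewrite /vb ?eqxx // h orbT. Qed.

Lemma vb_le s g h x : h <= g -> vb s g x -> vb s h x.
Proof.
move=> hg /orP[/eqP->|]; first exact: vb0.
by rewrite /vb orbC; case: s => xg; rewrite ?(le_lt_trans hg) ?(le_trans hg).
Qed.

Lemma vb_lt s g h x : h < g -> vb false g x -> vb s h x.
Proof.
move=> hg /orP[/eqP->|xg]; first exact: vb0.
by apply: vbW; rewrite /vb (lt_le_trans hg) ?orbT.
Qed.

Lemma vb_val x : vb false (v x) x. Proof. by rewrite /vb lexx orbT. Qed.

Lemma vb1 : vb false 0 (1 : K). Proof. by rewrite /vb Defs.val1 lexx orbT. Qed.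

Lemma vb_natr n : vb false 0 (n%:R : K).
Proof. by elim: n => [|n IH]; [apply: vb0|rewrite mulrS vbD // vb1]. Qed.

Lemma vbMn s g x n : vb s g x -> vb s g (x *+ n).
Proof. by move=> hx; elim: n => [|n IH]; [apply: vb0|rewrite mulrS vbD]. Qed.

Lemma vbX g x n : vb false g x -> vb false (g *+ n) (x ^+ n).
Proof.
by move=> hx; elim: n => [|n IH]; [apply: vb1|rewrite exprS mulrS; apply: (vbM hx IH)].
Qed.

Lemma vb_prod (I : finType) (F : I -> K) (f : I -> G) (n : I -> nat) :
  (forall i, vb false (f i) (F i)) ->
  vb false (\sum_i f i *+ n i) (\prod_i F i ^+ n i).
Proof.
move=> h; elim/big_ind2: _ => [|x a y b hx hy|i _]; first exact: vb1.
  exact: (vbM hx hy).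
exact: vbX.
Qed.

Lemma val_eq x y : x != 0 -> vb true (v x) (y - x) -> (y != 0) * (v y = v x).
Proof.
move=> x0 h; have y0 : y != 0.
  by apply: contraTneq h => ->; rewrite sub0r vbN /vb (negPf x0) ltxx.
split=> //; apply/eqP; rewrite eq_le; apply/andP; split; last first.
  have : vb false (v x) y by rewrite -[X in vb _ _ X](subrK x y) vbD ?vb_val // (vbW _ h).
  by rewrite /vb (negPf y0).
rewrite oag_leNgt; apply/negP => lt.
have : vb true (v x) x.
  by rewrite -[X in vb _ _ X](subKr y x) vbB // /vb lt orbT.
by rewrite /vb (negPf x0) ltxx.
Qed.

Lemma valV x : x != 0 -> v x^-1 = - v x.
Proof.
move=> x0; apply: (@addrI _ (v x)); rewrite -Defs.valM ?invr_eq0 //.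
by rewrite mulfV // Defs.val1 subrr.
Qed.

Lemma valX x n : x != 0 -> v (x ^+ n) = v x *+ n.
Proof.
by move=> x0; elim: n => [|n IH]; rewrite ?Defs.val1 // exprS mulrS Defs.valM ?expf_neq0 ?IH.
Qed.

Lemma vb_neq0 s g x : x != 0 -> vb s g x = if s then g < v x else g <= v x.
Proof. by move=> x0; rewrite /vb (negPf x0). Qed.

Lemma vb_divr s g x y : y != 0 -> vb s g (x / y) = vb s (g + v y) x.
Proof.
move=> y0; rewrite /vb mulf_eq0 invr_eq0 (negPf y0) orbF.
have [//|x0] /= := eqVneq x 0; rewrite Defs.valM ?invr_eq0 // valV //.
by rewrite oag_lt_subr oag_le_subr.
Qed.

Lemma vb_mull s g x y : y != 0 -> vb s g (y * x) = vb s (g - v y) x.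
Proof.
move=> y0; rewrite -[y]invrK [_^-1 * x]mulrC vb_divr ?invr_eq0 //.
by rewrite invrK valV.
Qed.

Lemma vb_true_val x : vb true (v x) x = (x == 0).
Proof. by rewrite /vb ltxx orbF. Qed.

Lemma vb_not s g x : ~~ vb s g x -> x != 0 /\ (if s then v x <= g else v x < g).
Proof.
by rewrite /vb negb_or => /andP[-> h]; split=> //; case: s h;
  rewrite -?oag_leNgt -?oag_ltNge.
Qed.

End ValuationBounds.

Section GaussNorm.
Variables (G : oagType) (K : valuedFieldType G).
Local Notation v := (@valuation G K).
Implicit Types (g h e : G) (s : bool) (n : nat).

(* The Gauss norm bound [v_g P > e] or [>= e] when each variable has weight [g]. *)
Definition nb n s g e (P : {mpoly K[n]}) :=
  forall m, vb s (e - g *+ mdeg m) P@_m.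

Lemma nb0 n s g e : nb s g e (0 : {mpoly K[n]}).
Proof. by move=> m; rewrite mcoeff0 vb0. Qed.

Lemma nbD n s g e (P Q : {mpoly K[n]}) : nb s g e P -> nb s g e Q -> nb s g e (P + Q).
Proof. by move=> hP hQ m; rewrite mcoeffD vbD. Qed.

Lemma nb_sum n s g e (I : Type) (r : seq I) (F : I -> {mpoly K[n]}) :
  (forall i, nb s g e (F i)) -> nb s g e (\sum_(i <- r) F i).
Proof. by move=> h; elim/big_ind: _ => // [|x y]; [apply: nb0|apply: nbD]. Qed.

Lemma nbC n s g e c : vb s e c -> nb s g e (c%:MP : {mpoly K[n]}).
Proof.
move=> hc m; rewrite mcoeffC; case: eqVneq => [->|_]; last by rewrite mulr0 vb0.
by rewrite mdeg0 mulr0n subr0 mulr1.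
Qed.

Lemma nb_var n g (i : 'I_n) : nb false g g ('X_i : {mpoly K[n]}).
Proof.
move=> m; rewrite mcoeffX; case: eqVneq => [<-|_]; last exact: vb0.
by rewrite mdeg1 mulr1n subrr vb1.
Qed.

Lemma nbM n s t g e h (P Q : {mpoly K[n]}) :
  nb s g e P -> nb t g h Q -> nb (s || t) g (e + h) (P * Q).
Proof.
move=> hP hQ m; rewrite mcoeffM; apply: vb_sum => k /eqP /(congr1 mdeg).
rewrite mdegD => def_m; have := vbM (hP k.1) (hQ k.2).
by rewrite addrACA -opprD -mulrnDr -def_m.
Qed.

Lemma nb1 n g : nb false g 0 (1 : {mpoly K[n]}).
Proof. by rewrite -mpolyC1; apply/nbC/vb1. Qed.

Lemma nb_exp n g e (P : {mpoly K[n]}) k : nb false g e P -> nb false g (e *+ k) (P ^+ k).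
Proof.
by move=> hP; elim: k => [|k IH]; [apply: nb1|rewrite exprS mulrS; apply: (nbM hP IH)].
Qed.

Lemma nb_prod n g (I : finType) (F : I -> {mpoly K[n]}) (f : I -> G) :
  (forall i, nb false g (f i) (F i)) -> nb false g (\sum_i f i) (\prod_i F i).
Proof.
move=> h; elim/big_ind2: _ => [|x a y b hx hy|i _]; [exact: nb1| |exact: h].
exact: (nbM hx hy).
Qed.

Lemma nb_wt n s g h e (P : {mpoly K[n]}) : g <= h -> nb s g e P -> nb s h e P.
Proof.
move=> gh hP m; apply: vb_le (hP m).
by rewrite oag_leD2l oag_leN2 oag_leMn.
Qed.

Lemma sum_mnm n g (m : 'X_{1..n}) : \sum_i g *+ m i = g *+ mdeg m.
Proof. by rewrite mdegE -sumrMnr. Qed.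

(** The weights compose: a monomial of degree [d] brings at least [e - g *+ d] from its coefficient
    and [g *+ d] from the polynomials substituted. *)
Lemma nb_comp n p s g h e (P : {mpoly K[n]}) (W : n.-tuple {mpoly K[p]}) :
  nb s g e P -> (forall i, nb false h g (tnth W i)) -> nb s h e (P \mPo W).
Proof.
move=> hP hW; rewrite comp_mpolyEX; apply: nb_sum => m.
rewrite comp_mpolyX -mul_mpolyC.
have := nbM (nbC h (hP m) (n := p)) (nb_prod (fun i => nb_exp (m i) (hW i))).
by rewrite sum_mnm orbF subrK.
Qed.

Lemma nb_eval n s g e (P : {mpoly K[n]}) (x : 'I_n -> K) :
  nb s g e P -> (forall i, vb false g (x i)) -> vb s e P.@[x].
Proof.
move=> hP hx; rewrite mevalE; apply: vb_sum => m _.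
have := vbM (hP m) (vb_prod m hx).
by rewrite sum_mnm orbF subrK.
Qed.

End GaussNorm.

(** * Newton approximation *)

Section Shift.
Variable n : nat.

(** Constants and variables generate the polynomial ring, so identities between substitutions,
    derivatives and evaluations need checking on these only. *)
Lemma mpoly_ring_ind (R : nzRingType) (T : {mpoly R[n]} -> Prop) :
  (forall c, T c%:MP) -> (forall i, T 'X_i) ->
  (forall p q, T p -> T q -> T (p + q)) -> (forall p q, T p -> T q -> T (p * q)) ->
  forall p, T p.
Proof.
move=> TC TX TD TM; elim/mpolyind => [|c m p _ _ IH]; first by rewrite -mpolyC0.
apply: TD => //; rewrite -mul_mpolyC mpolyXE_id; apply: (TM) => //.
elim/big_ind: _ => [|p1 p2|i _]; [by rewrite -mpolyC1|exact: TM|].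
by elim: (m i) => [|k IHk]; rewrite ?expr0 -?mpolyC1 // exprS; apply: (TM).
Qed.

Section Ring.
Variable R : comNzRingType.
Implicit Types (P Q : {mpoly R[n]}) (h x : 'I_n -> R).

(** The Taylor shift [P(X + h)]. Its constant and linear coefficients are the value and the first
    partial derivatives of [P] at [h]; the higher coefficients are only ever bounded. *)
Definition tau h P : {mpoly R[n]} := P \mPo [tuple 'X_i + (h i)%:MP | i < n].

Lemma tau_eval h P x : (tau h P).@[x] = P.@[fun i => x i + h i].
Proof.
rewrite comp_mpoly_meval; apply: meval_eq => i.
by rewrite tnth_mktuple mevalD mevalXU mevalC.
Qed.

Lemma tauC h c : tau h c%:MP = c%:MP. Proof. exact: comp_mpolyC. Qed.

Lemma tauD h : {morph tau h : P Q / P + Q}. Proof. exact: rmorphD. Qed.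

Lemma tau0 h : tau h 0 = 0. Proof. exact: rmorph0. Qed.

Lemma tauB h : {morph tau h : P Q / P - Q}. Proof. exact: rmorphB. Qed.

Lemma tauM h : {morph tau h : P Q / P * Q}. Proof. exact: rmorphM. Qed.

Lemma tauX h i : tau h 'X_i = 'X_i + (h i)%:MP.
Proof. by rewrite /tau comp_mpolyXU (nth_map i) ?size_enum_ord // nth_ord_enum. Qed.

Lemma tau_tau h h' P : tau h (tau h' P) = tau (fun i => h i + h' i) P.
Proof.
elim/mpoly_ring_ind: P => [c|i|p q hp hq|p q hp hq]; rewrite ?tauC ?tauD ?tauM ?hp ?hq //.
by rewrite !tauX tauD tauX tauC -addrA -mpolyCD.
Qed.

Lemma tau_eq h h' P : h =1 h' -> tau h P = tau h' P.
Proof.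
move=> e; elim/mpoly_ring_ind: P => [c|i|p q hp hq|p q hp hq];
by rewrite ?tauC ?tauD ?tauM ?hp ?hq // !tauX e.
Qed.

Lemma tau_deriv h P i : (tau h P)^`M(i) = tau h P^`M(i).
Proof.
elim/mpoly_ring_ind: P => [c|j|p q hp hq|p q hp hq].
- by rewrite tauC !mderivC tauC.
- rewrite tauX mderivD mderivC addr0 mderivX mnmE.
  have [->|_] := eqVneq i j; last by rewrite scale0r -mpolyC0 tauC.
  rewrite scale1r; have -> : (U_(j) - U_(j) = 0 :> 'X_{1..n})%MM.
    by apply/mnmP => l; rewrite mnmBE subnn mnmE.
  by rewrite mpolyX0 -mpolyC1 tauC.
- by rewrite tauD !mderivD tauD hp hq.
by rewrite tauM !mderivM tauD !tauM hp hq.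
Qed.

Lemma tau_coef0 h P : (tau h P)@_0 = P.@[h].
Proof.
have -> : P.@[h] = (tau h P).@[fun=> 0].
  by rewrite tau_eval; apply: meval_eq => i; rewrite add0r.
elim/mpoly_ring_ind: (tau h P) => [c|i|p q hp hq|p q hp hq].
- by rewrite mevalC mcoeffC eqxx mulr1.
- by rewrite mevalXU mcoeffX; case: eqVneq => // /mnmP/(_ i); rewrite !mnmE eqxx.
- by rewrite mevalD mcoeffD hp hq.
by rewrite mevalM rmorphM /= hp hq.
Qed.

End Ring.

Lemma map_tau (R S : comNzRingType) (f : {rmorphism R -> S}) (h : 'I_n -> R)
    (P : {mpoly R[n]}) :
  map_mpoly f (tau h P) = tau (f \o h) (map_mpoly f P).
Proof.
elim/mpoly_ring_ind: P => [c|i|p q hp hq|p q hp hq].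
- by rewrite tauC !map_mpolyC tauC.
- by rewrite tauX rmorphD /= map_mpolyC map_mpolyX tauX.
- by rewrite tauD !rmorphD /= tauD hp hq.
by rewrite tauM !rmorphM /= tauM hp hq.
Qed.

Lemma nb_tau (G : oagType) (K : valuedFieldType G) s g e (h : 'I_n -> K)
    (P : {mpoly K[n]}) :
  nb s g e P -> (forall i, vb false g (h i)) -> nb s g e (tau h P).
Proof.
move=> hP hh; apply: nb_comp hP _ => i; rewrite tnth_mktuple.
by apply: nbD; [apply: nb_var|apply: nbC].
Qed.

End Shift.

Section Derivations.
Variable K : diffFieldType.
Implicit Types x y : K.

Lemma derN x : der (- x) = - der x.
Proof. by apply: (addrI (der x)); rewrite -derD !subrr der0. Qed.

Lemma der1 : der (1 : K) = 0.
Proof.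
by apply: (addrI (der 1)); rewrite -[RHS]/(der 1 + 0) addr0 -[in RHS](mulr1 1) derM mulr1 mul1r.
Qed.

Lemma derV x : x != 0 -> der x^-1 = - der x / x ^+ 2.
Proof.
move=> x0; apply: (mulfI x0); apply: (addrI (der x * x^-1)).
rewrite -derM mulfV // der1 expr2 invfM !mulrA mulrN !mulNr.
by rewrite [x * der x]mulrC mulfK // subrr.
Qed.

Lemma iter_derD i x y : iter i der (x + y) = iter i der x + iter i der y.
Proof. by elim: i => //= i ->; rewrite derD. Qed.

Lemma iter_derN i x : iter i der (- x) = - iter i der x.
Proof. by elim: i => //= i ->; rewrite derN. Qed.

Definition jet n x : 'I_n -> K := fun i => iter i der x.

(* The coefficients of [u |-> (a u)^(i)]. *)
Fixpoint mulder (a : K) (i l : nat) : K :=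
  if i is i'.+1 then der (mulder a i' l) + (if l is l'.+1 then mulder a i' l' else 0)
  else if l == 0%N then a else 0.

Lemma mulder_gt a i l : (i < l)%N -> mulder a i l = 0.
Proof.
elim: i l => [|i IH] [|l] //= il; rewrite (IH l) // IH ?der0 ?addr0 //.
exact: leqW.
Qed.

Lemma mulder_diag a i : mulder a i i = a.
Proof. by elim: i => //= i IH; rewrite mulder_gt // der0 add0r. Qed.

Lemma mulderE a i n u : (i < n)%N ->
  iter i der (a * u) = \sum_(l < n) mulder a i l * iter l der u.
Proof.
elim: i => [|i IH] i_n /=.
  case: n i_n => // n _; rewrite big_ord_recl /= big1 ?addr0 // => l _.
  by rewrite mul0r.
rewrite IH; last exact: ltnW.
rewrite der_sum; under [LHS]eq_bigr do rewrite derM.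
rewrite big_split; under [RHS]eq_bigr do rewrite mulrDl.
rewrite [RHS]big_split; congr (_ + _).
case: n i_n {IH} => // n i_n; rewrite big_ord_recr [RHS]big_ord_recl /= mul0r add0r.
by rewrite mulder_gt // mul0r addr0.
Qed.

End Derivations.

Section Newton.
Variables (G : oagType) (K : valuedDiffFieldType G).
Local Notation v := (@valuation G K).
Hypothesis mono : monotone K.

Lemma vb_der s g (x : K) : vb s g x -> vb s g (der x).
Proof.
have [->|x0] := eqVneq x 0; first by rewrite der0.
have [->|dx0] := eqVneq (der x) 0; first by rewrite vb0.
have := mono x0 dx0; rewrite !vb_neq0 //; case: s => vx h; first exact: lt_le_trans vx.
exact: le_trans vx.
Qed.

Lemma vb_iter s g (x : K) i : vb s g x -> vb s g (iter i der x).
Proof. by move=> hx; elim: i => //= i; apply: vb_der. Qed.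

Lemma vb_mulder (a : K) i l : vb false (v a) (mulder a i l).
Proof.
elim: i l => [|i IH] l /=; first by case: ifP => _; [apply: vb_val|apply: vb0].
by apply: vbD; [apply: vb_der|case: l => [|l //]; apply: vb0].
Qed.

(* On the ball of radius [g] the terms of degree [1] of [P] have exact order [b + g]
   and dominate those of higher degree. *)
Definition lin_dom n g b (P : {mpoly K[n]}) : Prop :=
  [/\ forall m, (1 < mdeg m)%N -> vb true (b + g - g *+ mdeg m) P@_m,
      forall i, vb false b P@_(U_(i))
    & exists i, ~~ vb true b P@_(U_(i))].

End Newton.

(** Differential-henselianity without quotient rings: for a polynomial with integral coefficients,
    [lin_dom 0 0] says that the reduction has total degree 1. Stated through bounds on finitely many
    coefficients, the property passes easily to the value group and to ultrapowers. *)
Definition hens (G : oagType) (K : valuedDiffFieldType G) : Prop :=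
  forall n (P : {mpoly K[n]}), lin_dom 0 0 P -> vb false 0 P@_0 ->
  exists2 y : K, vb false 0 y & P.@[jet y] = 0.

Definition lin_part n (R : nzRingType) (P : {mpoly R[n]}) : {mpoly R[n]} :=
  \sum_(i < n) P@_(U_(i)) *: 'X_i.

Lemma lin_part_coef n (R : nzRingType) (P : {mpoly R[n]}) m :
  (lin_part P)@_m = if mdeg m == 1%N then P@_m else 0.
Proof.
rewrite raddf_sum /=; case: (boolP (mdeg m == 1%N)) => [/mdeg1P[i /eqP ->]|m1].
  rewrite (bigD1 i) //= mcoeffZ mcoeffX eqxx mulr1 big1 ?addr0 // => j /negPf ji.
  rewrite mcoeffZ mcoeffX; case: eqVneq => [/mnmP/(_ i)|]; last by rewrite mulr0.
  by rewrite !mnmE eqxx ji.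
rewrite big1 // => i _; rewrite mcoeffZ mcoeffX; case: eqVneq => [e|]; last by rewrite mulr0.
by rewrite -e mdeg1 eqxx in m1.
Qed.

Section LinearSubstitution.
Variables (n : nat) (R : comNzRingType) (c : nat -> nat -> R).

(** With [mulder a] for [c], this substitution carries the jet of [u] to the jet of [a * u]. *)
Definition lin_subst : n.-tuple {mpoly R[n]} :=
  [tuple \sum_(l < n) c i l *: 'X_l | i < n].

Lemma lin_subst_eval i x :
  (tnth lin_subst i).@[x] = \sum_(l < n) c i l * x l.
Proof.
rewrite tnth_mktuple (raddf_sum (meval x)); apply: eq_bigr => l _ /=.
by rewrite -mul_mpolyC mevalM mevalC mevalXU.
Qed.

Lemma lin_subst_coef1 i l : (tnth lin_subst i)@_(U_(l)) = c i l.
Proof.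
rewrite tnth_mktuple raddf_sum (bigD1 l) //= mcoeffZ mcoeffX eqxx mulr1 big1 ?addr0 //.
by move=> j jl; rewrite mcoeffZ mcoeffXU (negPf jl) mulr0.
Qed.

Lemma lin_subst_coefn i m : mdeg m != 1%N -> (tnth lin_subst i)@_m = 0.
Proof.
move=> m1; rewrite tnth_mktuple raddf_sum big1 // => j _; rewrite /= mcoeffZ mcoeffX.
by case: eqVneq => [e|]; rewrite ?mulr0 //; move: m1; rewrite -e mdeg1.
Qed.

Lemma comp_lin_subst (Q : {mpoly R[n]}) a N m : Q = a%:MP + lin_part Q + N ->
  (Q \mPo lin_subst)@_m = a * (m == 0%MM)%:R +
    \sum_i Q@_(U_(i)) * (tnth lin_subst i)@_m + (N \mPo lin_subst)@_m.
Proof.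
move=> {1}->; rewrite !rmorphD /= !mcoeffD comp_mpolyC mcoeffC; congr (_ + _ + _).
rewrite /lin_part (raddf_sum (comp_mpoly lin_subst)) raddf_sum; apply: eq_bigr => i _ /=.
by rewrite comp_mpolyZ mcoeffZ comp_mpolyXU -tnth_nth.
Qed.

End LinearSubstitution.

Section NewtonRoot.
Variables (G : oagType) (K : valuedDiffFieldType G).
Local Notation v := (@valuation G K).
Hypotheses (mono : monotone K) (hensK : hens K).

Lemma lin_dom_split n g b (Q : {mpoly K[n]}) : lin_dom g b Q ->
  exists2 N, Q = (Q@_0)%:MP + lin_part Q + N & nb true g (b + g) N.
Proof.
case=> hQ _ _; exists (Q - (Q@_0)%:MP - lin_part Q).
  by rewrite -[Q - _ - _]addrA -opprD [RHS]addrC subrK.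
move=> m; rewrite !mcoeffB lin_part_coef mcoeffC.
have [m0|m0] := eqVneq m 0%MM.
  by rewrite m0 mdeg0 /= mulr1 subrr mulr0n !subr0 vb0.
rewrite mulr0 subr0; case: eqVneq => m1; first by rewrite subrr vb0.
rewrite subr0; apply: hQ.
by case: (mdeg m) (mdeg_eq0 m) m1 => [|[|]] // /esym; rewrite (negPf m0).
Qed.

(** The substitution [Y = a * U] turns the ball of radius [v a] into the valuation ring. Division by
    [a] times a linear coefficient of least value [b] then gives the normal form that [hens] asks
    for. *)
Lemma lin_dom_subst n (Q : {mpoly K[n]}) a b : a != 0 -> lin_dom (v a) b Q ->
  vb false (b + v a) Q@_0 ->
  exists2 R, lin_dom 0 0 R /\ vb false 0 R@_0 &
    exists2 q, q != 0 & Q \mPo lin_subst n (mulder a) = q *: R.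
Proof.
move=> a0 domQ; have [N defQ nN] := lin_dom_split domQ.
have {defQ} := fun m => comp_lin_subst (mulder a) m defQ.
set W := lin_subst n (mulder a); move: (Q \mPo W) (Q@_0) => QW Q0 QWE hQ0.
case: domQ => _ lQ [i0 ui0]; have [q0 vq] := vb_not ui0; set q := Q@_(U_(i0)) in q0 vq.
have {}vq : v q = b.
  by apply/eqP; rewrite eq_le vq /=; have := lQ i0; rewrite vb_neq0.
have {nN} nR m : vb true (b + v a) (N \mPo W)@_m.
  rewrite -[b + v a](subr0 (b + v a)) -[0](mul0rn _ (mdeg m)).
  apply: nb_comp nN _ _ => i {}m; rewrite mul0rn subr0.
  have [/eqP/mdeg1P[l /eqP ->]|m1] := eqVneq (mdeg m) 1%N; last first.
    by rewrite lin_subst_coefn ?vb0.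
  by rewrite lin_subst_coef1; apply: vb_mulder.
move: (N \mPo W) QWE nR => {N} N QWE nN.
have QWl l : QW@_(U_(l)) = \sum_i Q@_(U_(i)) * mulder a i l + N@_(U_(l)).
  rewrite QWE; case: eqVneq => [/(congr1 mdeg)|_]; first by rewrite mdeg1 mdeg0.
  by rewrite mulr0 add0r; under eq_bigr do rewrite lin_subst_coef1.
have qa0 : q * a != 0 by rewrite mulf_neq0.
exists ((q * a)^-1 *: QW); last by exists (q * a); rewrite // scalerA mulfV // scale1r.
have RE s m : vb s 0 ((q * a)^-1 *: QW)@_m = vb s (b + v a) QW@_m.
  by rewrite mcoeffZ mulrC vb_divr // add0r Defs.valM // vq.
split; last first.
  rewrite RE QWE big1 => [|i _]; last by rewrite lin_subst_coefn ?mulr0 // mdeg0.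
  by rewrite eqxx mulr1 addr0; apply: vbD => //; apply: vbW.
split=> [m m1|i|].
- rewrite addr0 mul0rn subr0 RE QWE; case: eqVneq => [m0|_].
    by rewrite m0 mdeg0 in m1.
  rewrite mulr0 add0r big1 ?add0r // => i _; rewrite lin_subst_coefn ?mulr0 //.
  by case: (mdeg m) m1 => [|[]].
- rewrite RE QWl; apply: vbD; last exact: vbW.
  by apply: vb_sum => j _; apply: (vbM (lQ j) (vb_mulder mono a j i)).
(* Let [j] be the last index with a linear coefficient of exact value [b]. As [mulder] is triangular
   with [a] on the diagonal, the new coefficient at [j] is the old one times [a], up to
   contributions of later indices and of [N], all of value greater than [b + v a]. *)
case: (@arg_maxnP _ i0 (fun i => ~~ vb true b Q@_(U_(i))) (fun i => i) ui0) => j uj maxj.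
exists j; rewrite RE QWl; apply: contra uj => h.
have {h} : vb true (b + v a) (\sum_i Q@_(U_(i)) * mulder a i j).
  by rewrite -[X in vb _ _ X](addrK N@_(U_(j))) vbB.
rewrite (bigD1 j) //= mulder_diag => h.
rewrite -[X in vb _ _ X](mulfK a0) vb_divr //.
rewrite -[X in vb _ _ X](addrK (\sum_(i | i != j) Q@_(U_(i)) * mulder a i j)).
apply: vbB => //; apply: vb_sum => i ij; have [ji|] := ltnP j i; last first.
  by move=> le_ij; rewrite mulder_gt ?mulr0 ?vb0 // ltn_neqAle ij.
have ui : vb true b Q@_(U_(i)) by apply: contraTT ji => /maxj; rewrite -leqNgt.
exact: (vbM ui (vb_mulder mono a i j)).
Qed.

(** The root is [x + a * u], where [u] is an integral root of the polynomial shifted to [x] and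
    rescaled by [a]. *)
Lemma newton n (P : {mpoly K[n]}) (x a : K) b : a != 0 ->
  lin_dom (v a) b (tau (jet x) P) -> vb false (b + v a) P.@[jet x] ->
  exists2 z, vb false (v a) (z - x) & P.@[jet z] = 0.
Proof.
move=> a0 domQ; rewrite -(tau_coef0 (jet x) P) => Q0.
have [R [domR R0] [q q0 QR]] := lin_dom_subst a0 domQ Q0.
have [u u0 Ru] := hensK domR R0; exists (x + a * u).
  by rewrite [x + _]addrC addrK -[v a]addr0; apply: (vbM (vb_val a) u0).
have : (q *: R).@[jet u] = 0 by rewrite mevalZ Ru mulr0.
rewrite -QR comp_mpoly_meval tau_eval => <-; apply: meval_eq => i.
rewrite lin_subst_eval /jet iter_derD addrC; congr (_ + _).
exact: mulderE.
Qed.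

End NewtonRoot.

Lemma mderivXU n (R : nzRingType) (i j : 'I_n) :
  ('X_i : {mpoly R[n]})^`M(j) = (i == j)%:R.
Proof.
rewrite mderivX mnm1E; have [->|_] := eqVneq i j; last by rewrite scale0r.
rewrite scale1r (_ : _ - _ = 0)%MM ?mpolyX0 //.
by apply/mnmP => l; rewrite mnmBE subnn mnmE.
Qed.

(** * Polynomials viewed as univariate in the last variable *)

Section Univariate.
Variables (n : nat) (R : comNzRingType).
Implicit Types (P Q : {mpoly R[n.+1]}) (p q : {poly {mpoly R[n]}}).

Lemma muni_last : muni ('X_ord_max : {mpoly R[n.+1]}) = 'X.
Proof.
rewrite muniE msuppX big_seq1 mcoeffX eqxx mnm1E eqxx.
rewrite [X in 'X_[X]](_ : _ = 0%MM) ?mpolyX0 ?scale1r // ?alg_polyC //; last first.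
  apply/mnmP => i; rewrite !mnmE; case: eqVneq => // /(congr1 val) /= e.
  by have := ltn_ord i; rewrite -e ltnn.
Qed.

Lemma muni_widen i : muni ('X_(widen_ord (leqnSn n) i) : {mpoly R[n.+1]}) = ('X_i)%:P.
Proof.
rewrite muniE msuppX big_seq1 mcoeffX eqxx mnm1E.
case: eqVneq => [/(congr1 val) /= e|_]; first by have := ltn_ord i; rewrite e ltnn.
rewrite expr0 alg_polyC scale1r; congr ('X_[_])%:P.
apply/mnmP => j; rewrite !mnmE; congr (nat_of_bool _).
Qed.

Lemma muni_mwiden (p : {mpoly R[n]}) : muni (mwiden p) = p%:P.
Proof.
elim/mpoly_ring_ind: p => [c|i|p q hp hq|p q hp hq].
- by rewrite mwidenC muniC.
- by rewrite mwidenX mnmwiden1 muni_widen.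
- by rewrite !rmorphD /= hp hq.
by rewrite !rmorphM /= hp hq.
Qed.

(** The inverse of [muni], through which pseudo-division in the highest derivative is brought back
    to differential polynomials. *)
Definition of_uni p : {mpoly R[n.+1]} := (map_poly (@mwiden n R) p).['X_ord_max].

Lemma of_uniC c : of_uni c%:P = mwiden c.
Proof. by rewrite /of_uni map_polyC hornerC. Qed.

Lemma of_uniD p q : of_uni (p + q) = of_uni p + of_uni q.
Proof. by rewrite /of_uni rmorphD hornerD. Qed.

Lemma of_uniM p q : of_uni (p * q) = of_uni p * of_uni q.
Proof. by rewrite /of_uni rmorphM hornerM. Qed.

Lemma muniK P : of_uni (muni P) = P.
Proof.
elim/mpoly_ring_ind: P => [c|i|p q hp hq|p q hp hq].
- by rewrite muniC of_uniC mwidenC.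
- have [j ->|->] := unliftP ord_max i.
    have -> : lift ord_max j = widen_ord (leqnSn n) j by apply/ord_inj; rewrite lift_max.
    by rewrite muni_widen of_uniC mwidenX mnmwiden1.
  by rewrite muni_last /of_uni map_polyX hornerX.
- by rewrite -[RHS](f_equal2 +%R hp hq) -of_uniD muniD.
by rewrite -[RHS](f_equal2 *%R hp hq) -of_uniM muniM.
Qed.

Lemma of_uniK p : muni (of_uni p) = p.
Proof.
elim/poly_ind: p => [|p c IH]; first by rewrite /of_uni rmorph0 horner0 rmorph0.
rewrite of_uniD of_uniM of_uniC muniD muniM muni_mwiden IH.
by rewrite /of_uni map_polyX hornerX muni_last.
Qed.

Lemma muni_eq0 P : (muni P == 0) = (P == 0).
Proof.
apply/eqP/eqP => [P0|->]; last by rewrite muni0.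
by rewrite -(muniK P) P0 /of_uni rmorph0 horner0.
Qed.

Lemma muni_deriv_last P : muni P^`M(ord_max) = (muni P)^`().
Proof.
elim/mpoly_ring_ind: P => [c|i|p q hp hq|p q hp hq].
- by rewrite mderivC muni0 muniC derivC.
- rewrite mderivXU rmorph_nat; have [j ->|->] := unliftP ord_max i.
    have -> : lift ord_max j = widen_ord (leqnSn n) j by apply/ord_inj; rewrite lift_max.
    rewrite muni_widen derivC; case: eqVneq => // /(congr1 val) /= e.
    by have := ltn_ord j; rewrite e ltnn.
  by rewrite eqxx muni_last derivX.
- by rewrite mderivD !muniD derivD hp hq.
by rewrite mderivM !(muniM, muniD) derivM hp hq.
Qed.

Lemma muni_deriv_widen P j k :
  (muni P^`M(widen_ord (leqnSn n) j))`_k = ((muni P)`_k)^`M(j).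
Proof.
elim/mpoly_ring_ind: P k => [c|i|p q hp hq|p q hp hq] k.
- rewrite mderivC muni0 muniC [in RHS]coefC [LHS]coef0; case: (k == 0%N).
    by rewrite mderivC.
  by rewrite mderiv0.
- rewrite mderivXU rmorph_nat -polyC_natr coefC; have [l ->|->] := unliftP ord_max i.
    have -> : lift ord_max l = widen_ord (leqnSn n) l by apply/ord_inj; rewrite lift_max.
    rewrite muni_widen [in RHS]coefC -(inj_eq val_inj) /= (inj_eq val_inj).
    case: (k == 0%N); last by rewrite mderiv0.
    by rewrite mderivXU.
  rewrite muni_last coefX; have -> : (ord_max == widen_ord (leqnSn n) j) = false.
    by apply/eqP => /(congr1 val) /= e; have := ltn_ord j; rewrite -e ltnn.
  rewrite if_same; case: (k == 1%N); rewrite ?mderiv0 //.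
  by rewrite -mpolyC1 mderivC.
- rewrite mderivD !muniD [LHS]coefD [in RHS]coefD [RHS]mderivD.
  exact: (f_equal2 +%R (hp k) (hq k)).
rewrite mderivM muniD !muniM [LHS]coefD [X in X + _]coefM [X in _ + X]coefM [in RHS]coefM.
rewrite -big_split (raddf_sum (mderiv j)); apply: eq_bigr => i _ /=.
rewrite [RHS]mderivM; congr (_ * _ + _ * _); [exact: hp|exact: hq].
Qed.

Lemma size_muni_deriv_widen P j :
  (size (muni P^`M(widen_ord (leqnSn n) j)) <= size (muni P))%N.
Proof.
apply/leq_sizeP => k hk; rewrite muni_deriv_widen.
by have /leq_sizeP -> := leqnn (size (muni P)); rewrite ?mderiv0.
Qed.

End Univariate.

(** * Differential subfields with good nonzero elements *)

Section GoodSubfields.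
Variables (A : comUnitRingType) (D : A -> A) (good : set A).
Hypotheses (DD : {morph D : x y / x + y})
  (DM : forall x y, D (x * y) = D x * y + x * D y).
Hypotheses (good_unit : forall x, good x -> x \is a GRing.unit)
  (goodM : forall x y, good x -> good y -> good (x * y))
  (goodV : forall x, good x -> good x^-1)
  (goodN : forall x, good x -> good (- x))
  (good_natr : forall n, (0 < n)%N -> good n%:R).
Implicit Types (x y : A) (S T : set A).

Definition zgood : set A := [set x | x = 0 \/ good x].

Lemma good1 : good 1. Proof. exact: (@good_natr 1). Qed.

Lemma D0 : D 0 = 0. Proof. by apply: (addrI (D 0)); rewrite -DD !addr0. Qed.

Lemma D1 : D 1 = 0.
Proof. by apply: (addrI (D 1)); rewrite addr0 -[in RHS](mulr1 1) DM mulr1 mul1r. Qed.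

Lemma DN x : D (- x) = - D x.
Proof. by apply: (addrI (D x)); rewrite -DD !subrr D0. Qed.

Lemma DV x : x \is a GRing.unit -> D x^-1 = - (D x / x ^+ 2).
Proof.
move=> ux; apply: (mulrI ux); apply: (addrI (D x * x^-1)).
by rewrite -DM divrr // D1 mulrN expr2 invrM // [x * _]mulrCA mulVKr // subrr.
Qed.

Definition subring T := [/\ T 1, forall x y, T x -> T y -> T (x - y)
  & forall x y, T x -> T y -> T (x * y)].

(** The ambient ring need not be a field, since products of two fields will occur. It is goodness of
    the nonzero elements, hence invertibility, that makes [S] a field. [good] will mean value 0 when
    the residue field is lifted, and a common leading term in the back and forth. *)
Definition good_subfield S := [/\ subring S, S `<=` zgood,
  forall x, S x -> good x -> S x^-1 & forall x, S x -> S (D x)].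

Lemma subring0 T : subring T -> T 0.
Proof. by case=> T1 TB _; rewrite -(subrr 1); apply: TB. Qed.

Lemma subringD T x y : subring T -> T x -> T y -> T (x + y).
Proof.
move=> rT Tx Ty; case: (rT) => _ TB _; rewrite -[y]opprK; apply: (TB) => //.
by rewrite -sub0r; apply: TB => //; apply: subring0.
Qed.

Lemma subringN T x : subring T -> T x -> T (- x).
Proof. by move=> rT Tx; case: (rT) => _ TB _; rewrite -sub0r; apply: TB => //; apply: subring0. Qed.

Lemma subring_sum T (I : Type) (r : seq I) (F : I -> A) : subring T ->
  (forall i, T (F i)) -> T (\sum_(i <- r) F i).
Proof.
move=> rT h; elim/big_ind: _ => // [|x y]; [exact: subring0|exact: subringD].
Qed.

Definition frac T : set A :=
  [set u | exists a b, [/\ T a, T b, good b & u = a / b]].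

Lemma sub_frac T : subring T -> T `<=` frac T.
Proof. by case=> T1 _ _ x Tx; exists x, 1; split=> //; rewrite ?divr1 //; apply: good1. Qed.

Lemma frac_subring T : subring T -> subring (frac T).
Proof.
move=> rT; have [T1 TB TM] := rT; split=> [|x y|x y].
- exact: sub_frac.
- move=> [a [b [Ta Tb gb ->]]] [c [d [Tc Td gd ->]]].
  exists (a * d - c * b), (b * d); split; [|exact: TM|exact: goodM|].
    by apply: TB; apply: TM.
  have ub := good_unit gb; have ud := good_unit gd.
  rewrite invrM // mulrBl mulrA mulrK //; congr (_ - _).
  by rewrite mulrCA mulrA [_ * d^-1]mulrC -[RHS]mulrA mulrK // mulrC.
move=> [a [b [Ta Tb gb ->]]] [c [d [Tc Td gd ->]]].
exists (a * c), (b * d); split; [exact: TM|exact: TM|exact: goodM|].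
by rewrite invrM ?good_unit // mulrACA [d^-1 * _]mulrC.
Qed.

(** By the quotient rule it suffices that derivatives of elements of [T] are fractions. [T] itself
    need not be closed under [D], and it will not be when the highest derivative of a generator is a
    quotient. *)
Lemma frac_good_subfield T : subring T -> T `<=` zgood ->
  (forall x, T x -> frac T (D x)) -> good_subfield (frac T).
Proof.
move=> rT Tg TD; have rF := frac_subring rT; have [T1 TB TM] := rT.
have TF := sub_frac rT; have [_ _ FM] := rF; split=> // x [a [b [Ta Tb gb ->]]].
- case: (Tg _ Ta) => [->|ga]; [by left; rewrite mul0r|right].
  by apply: goodM => //; apply: goodV.
- move=> gab; have ga : good a by rewrite -(divrK (good_unit gb) a); apply: goodM.
  by exists b, a; split=> //; rewrite invrM ?unitrV ?good_unit // invrK.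
have Fb : frac T b^-1 by exists 1, b; split=> //; rewrite mul1r.
rewrite DM (DV (good_unit gb)) expr2 invrM ?good_unit //.
apply: subringD => //; first by apply: (FM) => //; apply: (TD).
apply: (FM); first exact: TF.
by apply: subringN => //; apply: (FM); [apply: TD|apply: FM].
Qed.

Section Chains.
Variables (W S0 : set A).

Lemma max_good_subfield : good_subfield S0 -> S0 `<=` W ->
  exists S, [/\ good_subfield S, S0 `<=` S, S `<=` W &
    forall S', good_subfield S' -> S `<=` S' -> S' `<=` W -> S' `<=` S].
Proof.
(* The union with [S0] is there for the empty chain, whose union is empty and not a subfield. *)
move=> gS0 S0W; pose Q S := good_subfield (S0 `|` S) /\ S `<=` W.
have [|S [[gS SW] maxS]] := @Zorn_bigcup A Q.
  move=> F FQ totF; split; last by move=> x [X /FQ[_ XW] /XW].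
  have [[X0 FX0]|F0] := pselect (exists X, F X); last first.
    rewrite (_ : \bigcup_(X in F) X = set0) ?setU0 //.
    by rewrite predeqE => x; split=> // -[X FX]; case: F0; exists X.
  pose U := S0 `|` \bigcup_(X in F) X.
  have UP x : U x <-> exists2 X, F X & (S0 `|` X) x.
    split=> [[S0x|[X FX Xx]]|[X FX [S0x|Xx]]]; [exists X0|exists X|left|right] => //.
    - by left.
    - by right.
    by exists X.
  have UP2 x y : U x -> U y -> exists2 X, F X & (S0 `|` X) x /\ (S0 `|` X) y.
    move=> /UP[X FX Xx] /UP[Y FY Yy]; case: (totF _ _ FX FY) => XY.
      by exists Y => //; split=> //; apply: setUS Xx.
    by exists X => //; split=> //; apply: setUS Yy.
  split; first split.
  - by apply/UP; exists X0 => //; have [[[X1 _ _] _ _ _] _] := FQ _ FX0.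
  - move=> x y Ux Uy; have [X FX [Xx Xy]] := UP2 _ _ Ux Uy.
    by apply/UP; exists X => //; have [[[_ XB _] _ _ _] _] := FQ _ FX; apply: XB.
  - move=> x y Ux Uy; have [X FX [Xx Xy]] := UP2 _ _ Ux Uy.
    by apply/UP; exists X => //; have [[[_ _ XM] _ _ _] _] := FQ _ FX; apply: XM.
  - by move=> x /UP[X FX Xx]; have [[_ Xg _ _] _] := FQ _ FX; apply: Xg.
  - move=> x /UP[X FX Xx] gx; apply/UP; exists X => //.
    by have [[_ _ XV _] _] := FQ _ FX; apply: XV.
  move=> x /UP[X FX Xx]; apply/UP; exists X => //.
  by have [[_ _ _ XD] _] := FQ _ FX; apply: XD.
exists (S0 `|` S); split=> //; first by move=> x []; [apply: S0W|apply: SW].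
move=> S' gS' SS' S'W x S'x; apply: contrapT => nSx.
apply: (maxS S'); last by split=> //; rewrite setUidr // => y Sy; apply: SS'; left.
rewrite properEneq; split; last by move=> y Sy; apply: SS'; right.
by apply/eqP => e; apply: nSx; right; rewrite e.
Qed.

End Chains.

(** These are the fractions of integers. Minimality and countability serve to start the back and
    forth. *)
Lemma prime_good_subfield : exists S0, [/\ good_subfield S0,
    forall S, good_subfield S -> S0 `<=` S
  & exists e : nat -> A, S0 `<=` range e].
Proof.
pose T : set A := [set n%:~R | n in [set: int]].
have rT : subring T.
  split=> [|_ _ [m _ <-] [n _ <-]|_ _ [m _ <-] [n _ <-]]; first by exists 1.
    by exists (m - n) => //; rewrite rmorphB.
  by exists (m * n) => //; rewrite rmorphM.
have Tg : T `<=` zgood.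
  move=> _ [[[|n]|n] _ <-]; [by left|by right; apply: (good_natr)|right].
  by rewrite NegzE rmorphN; apply: goodN; apply: good_natr.
exists (frac T); split.
- apply: frac_good_subfield => // _ [n _ <-]; apply: sub_frac => //.
  rewrite (_ : D _ = 0); first exact: subring0.
  have Dnat k : D k%:R = 0 by elim: k => [|k IH]; rewrite ?D0 // mulrS DD D1 IH addr0.
  by case: n => k; rewrite ?NegzE ?rmorphN ?DN /= Dnat ?oppr0.
- move=> S [rS _ SV _] _ [_ [_ [[m _ <-] [n _ <-] gn ->]]].
  have [S1 _ SM] := rS.
  have Sint (k : int) : S k%:~R.
    have Snat j : S j%:R.
      by elim: j => [|j IH]; [apply: subring0|rewrite mulrS; apply: subringD].
    by case: k => j; [apply: Snat|rewrite NegzE rmorphN; apply: subringN => //; apply: Snat].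
  by apply: SM => //; apply: SV.
exists (fun i => if unpickle i : option (int * int) is Some (m, n) then m%:~R / n%:~R else 0).
by move=> _ [_ [_ [[m _ <-] [n _ <-] _ ->]]]; exists (pickle (m, n)); rewrite ?pickleK.
Qed.

End GoodSubfields.

Section SubfieldType.
Variables (A : comUnitRingType) (D : A -> A) (good S : set A).
Hypotheses (DD : {morph D : x y / x + y})
  (DM : forall x y, D (x * y) = D x * y + x * D y).
Hypotheses (good_unit : forall x, good x -> x \is a GRing.unit)
  (good_natr : forall n, (0 < n)%N -> good n%:R)
  (gS : good_subfield D good S).

Definition mem_sub : {pred A} := fun x => `[< S x >].

Lemma mem_sub_subring : subring_closed mem_sub.
Proof.
case: gS => -[S1 SB SM] _ _ _; split=> [|x y|x y]; rewrite /in_mem /=; first exact/asboolP.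
  by move=> /asboolP Sx /asboolP Sy; apply/asboolP/SB.
by move=> /asboolP Sx /asboolP Sy; apply/asboolP/SM.
Qed.

HB.instance Definition _ := GRing.isSubringClosed.Build A mem_sub mem_sub_subring.

Record sub_of := SubOf { sub_val : A; _ : sub_val \in mem_sub }.

HB.instance Definition _ := [isSub for sub_val].
HB.instance Definition _ := [Choice of sub_of by <:].
HB.instance Definition _ := [SubChoice_isSubComNzRing of sub_of by <:].

Lemma sub_valP (x : sub_of) : S (val x). Proof. exact/asboolP/(valP x). Qed.

Lemma sub_inv_key (x : sub_of) : exists y : sub_of, if x == 0 then y = 0 else y * x = 1.
Proof.
have [_|x0] := eqVneq x 0; first by exists 0.
have [_ Sg SV _] := gS; case: (Sg _ (sub_valP x)) => [v0|gx].
  by case/eqP: x0; apply: val_inj.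
have Sy : (val x)^-1 \in mem_sub by apply/asboolP/(SV _ (sub_valP x)).
by exists (SubOf Sy); apply: val_inj; rewrite /= mulVr // good_unit.
Qed.

Definition sub_inv (x : sub_of) : sub_of := projT1 (cid (sub_inv_key x)).

Lemma sub_mulVf x : x != 0 -> sub_inv x * x = 1.
Proof. by move=> /negPf x0; rewrite /sub_inv; case: cid => y /=; rewrite x0. Qed.

Lemma sub_inv0 : sub_inv 0 = 0.
Proof. by rewrite /sub_inv; case: cid => y /=; rewrite eqxx. Qed.

HB.instance Definition _ := GRing.ComNzRing_isField.Build sub_of sub_mulVf sub_inv0.

Lemma sub_der_key (x : sub_of) : D (val x) \in mem_sub.
Proof. by apply/asboolP; have [_ _ _ SD] := gS; apply: SD; apply: sub_valP. Qed.

Definition sub_der (x : sub_of) : sub_of := SubOf (sub_der_key x).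

Lemma sub_derD : {morph sub_der : x y / x + y}.
Proof. by move=> x y; apply: val_inj; apply: DD. Qed.

Lemma sub_derM x y : sub_der (x * y) = sub_der x * y + x * sub_der y.
Proof. by apply: val_inj; apply: DM. Qed.

Lemma sub_pchar0 : [pchar sub_of] =i pred0.
Proof.
apply/pcharf0P => -[|n]; first exact: eqxx.
apply/negbTE/eqP => /(congr1 val); rewrite rmorph_nat rmorph0 => n0.
by have /good_unit := @good_natr n.+1 isT; rewrite n0 unitr0.
Qed.

HB.instance Definition _ := isDifferential.Build sub_of sub_derD sub_derM sub_pchar0.

(** Polynomials need a type of coefficients, so a subfield is traded for a differential field with
    an embedding [iota] whose image it is. *)
Lemma good_subfield_type : exists (E : diffFieldType) (iota : {rmorphism E -> A}),
  [/\ forall x, iota (der x) = D (iota x), injective iota &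
      forall a, S a <-> exists x, iota x = a].
Proof.
exists sub_of, (val : {rmorphism sub_of -> A}); split; [by []|exact: val_inj|move=> a].
split=> [Sa|[x <-]]; last exact: sub_valP.
by exists (SubOf (introT (asboolP _) Sa)).
Qed.

End SubfieldType.

(** * Differential subfields generated by one element *)

Section Generated.
Variables (A : comUnitRingType) (D : A -> A) (good : set A).
Hypotheses (DD : {morph D : x y / x + y})
  (DM : forall x y, D (x * y) = D x * y + x * D y).
Hypotheses (good_unit : forall x, good x -> x \is a GRing.unit)
  (goodM : forall x y, good x -> good y -> good (x * y))
  (goodV : forall x, good x -> good x^-1)
  (good_natr : forall n, (0 < n)%N -> good n%:R).
Variables (E : diffFieldType) (iota : {rmorphism E -> A}) (z : A).
Hypothesis iota_der : forall x, iota (der x) = D (iota x).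

Definition ev n : {mpoly E[n]} -> A := mmap iota (fun i : 'I_n => iter i D z).
HB.instance Definition _ n := GRing.RMorphism.copy (@ev n) (@ev n).

Lemma evC n c : ev (c%:MP : {mpoly E[n]}) = iota c. Proof. exact: mmapC. Qed.

Lemma evX n (i : 'I_n) : ev ('X_i : {mpoly E[n]}) = iter i D z.
Proof. by rewrite /ev mmapX mmap1U. Qed.

Lemma ev_widen n (P : {mpoly E[n]}) : ev (mwiden P) = ev P.
Proof.
elim/mpoly_ring_ind: P => [c|i|p q hp hq|p q hp hq].
- by rewrite mwidenC !evC.
- by rewrite mwidenX mnmwiden1 !evX.
- by rewrite !rmorphD /= hp hq.
by rewrite !rmorphM /= hp hq.
Qed.

Definition evs n : set A := range (@ev n).

Lemma evs_subring n : subring (evs n).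
Proof.
split=> [|_ _ [p _ <-] [q _ <-]|_ _ [p _ <-] [q _ <-]].
- by exists 1; rewrite ?rmorph1.
- by exists (p - q); rewrite ?rmorphB.
by exists (p * q); rewrite ?rmorphM.
Qed.

Lemma evs_le m n : (m <= n)%N -> evs m `<=` evs n.
Proof.
move=> /subnKC <-; elim: (n - m)%N => [|d IH]; first by rewrite addn0.
by move=> _ /IH[p _ <-]; rewrite addnS; exists (mwiden p); rewrite ?ev_widen.
Qed.

(** The chain rule; [R] is [P] with its coefficients differentiated. *)
Lemma ev_der n (P : {mpoly E[n]}) : exists R : {mpoly E[n]},
  D (ev P) = ev R + \sum_(j < n) ev P^`M(j) * iter j.+1 D z.
Proof.
elim/mpoly_ring_ind: P => [c|i|p q [R hp] [S hq]|p q [R hp] [S hq]].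
- exists (der c)%:MP; rewrite !evC iota_der big1 ?addr0 // => j _.
  by rewrite mderivC rmorph0 mul0r.
- exists 0; rewrite rmorph0 add0r evX (bigD1 i) //= mderivXU eqxx rmorph1 mul1r.
  rewrite big1 ?addr0 // => j /negPf ji; rewrite mderivXU eq_sym ji rmorph0 mul0r //.
- exists (R + S); rewrite !rmorphD DD hp hq addrACA -big_split; congr (_ + _).
  by apply: eq_bigr => j _; rewrite mderivD rmorphD mulrDl.
exists (R * q + p * S); rewrite rmorphM DM hp hq rmorphD !rmorphM /= mulrDl mulrDr.
rewrite addrACA; congr (_ + _); rewrite mulr_suml mulr_sumr -big_split; apply: eq_bigr => j _.
by rewrite mderivM rmorphD !rmorphM /= mulrDl mulrAC mulrA.
Qed.

Lemma evs_union_subring : subring (\bigcup_n evs n).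
Proof.
have U2 x y : (\bigcup_n evs n) x -> (\bigcup_n evs n) y ->
    exists n, evs n x /\ evs n y.
  move=> [m _ mx] [n _ ny]; exists (maxn m n).
  by split; [apply: evs_le mx; rewrite leq_maxl|apply: evs_le ny; rewrite leq_maxr].
split=> [|x y Ux Uy|x y Ux Uy]; first by exists 0%N => //; have [] := evs_subring 0.
  have [m [mx my]] := U2 _ _ Ux Uy; exists m => //.
  by have [_ mB _] := evs_subring m; apply: mB.
have [m [mx my]] := U2 _ _ Ux Uy; exists m => //.
by have [_ _ mM] := evs_subring m; apply: mM.
Qed.

(** Differentiation uses one more derivative of [z], so the union of all the rings [evs n] is closed
    under [D], and it only remains to take fractions. *)
Lemma generated_transcendental :
  (forall n (Q : {mpoly E[n]}), zgood good (ev Q)) ->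
  good_subfield D good (frac good (\bigcup_n evs n)).
Proof.
move=> gQ; have rU := evs_union_subring.
apply: frac_good_subfield => //; first by move=> _ [n _ [Q _ <-]]; apply: gQ.
move=> _ [n _ [Q _ <-]]; have [R ->] := ev_der Q.
apply: sub_frac => //; exists n.+1 => //; have rn := evs_subring n.+1.
have [_ _ nM] := rn; have le_n := evs_le (leqnSn n).
apply: subringD => //; first by apply: le_n; exists R.
apply: subring_sum => // j; apply: nM; first by apply: le_n; exists (Q^`M(j)).
by exists 'X_(lift ord0 j); rewrite ?evX.
Qed.

Lemma deriv_neq0 r (p : {poly {mpoly E[r]}}) : (1 < size p)%N -> p^`() != 0.
Proof.
move=> p1; apply/eqP => /(congr1 (fun q : {poly _} => q`_(size p).-2)) /eqP.
rewrite coef_deriv coef0; case sp: (size p) p1 => [|[|d]] //= _.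
have lp : p`_d.+1 != 0.
  by rewrite -[d.+1]/(d.+2.-1) -sp -lead_coefE lead_coef_eq0 -size_poly_gt0 sp.
rewrite -mulr_natr mulf_eq0 (negPf lp) /= => /eqP/(congr1 (mcoeff 0%MM)).
rewrite -mpolyC_nat mcoeffC eqxx mulr1 mcoeff0 => /eqP.
by rewrite (negPf (natr_neq0 _ _)).
Qed.

(** Here [P] plays the role of a minimal polynomial of [z]: its leading coefficient in the last
    variable and its separant take good values at [z]. The fractions of polynomials in the first
    [r.+1] derivatives, counted from [z] itself, then already form a differential field. *)
Lemma generated_algebraic r (P : {mpoly E[r.+1]}) :
  ev P = 0 -> (1 < size (muni P))%N ->
  (forall I : {mpoly E[r]}, I != 0 -> good (ev I)) ->
  (forall Q : {mpoly E[r.+1]}, Q != 0 -> (size (muni Q) < size (muni P))%N ->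
     good (ev Q)) ->
  good_subfield D good (frac good (evs r.+1)).
Proof.
move=> P0 sP gI gQ; have rT := evs_subring r.+1; have [_ _ TM] := rT.
have mP0 : muni P != 0 by rewrite -size_poly_gt0 ltnW.
have TC (p : {mpoly E[r.+1]}) : evs r.+1 (ev p) by exists p.
have TX j : (j < r.+1)%N -> evs r.+1 (iter j D z).
  by move=> jr; exists 'X_(Ordinal jr); rewrite ?evX.
have zg : evs r.+1 `<=` zgood good.
  (* Pseudo-division by [P]: a power of the leading coefficient [I] times [Q] is a multiple of [P]
     plus a remainder [rho] of lower degree. Hence [Q(z)] is [rho(z)] divided by a good element. *)
  move=> _ [Q _ <-]; have := Pdiv.Idomain.divp_eq (muni Q) (muni P).
  set I := lead_coef _; set m := scalp _ _; set q := _ %/ _; set rho := _ %% _ => e.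
  have gIm : good (ev I ^+ m).
    elim: m {e} => [|m IH]; first exact: (good_natr (n := 1)).
    by rewrite exprS; apply: goodM => //; apply: gI; rewrite lead_coef_eq0.
  have {}e : ev I ^+ m * ev Q = ev (of_uni rho).
    have : ev (mwiden (I ^+ m) * Q) = ev (of_uni rho).
      rewrite -of_uniC -[in LHS](muniK Q) -of_uniM mul_polyC e.
      by rewrite of_uniD of_uniM muniK rmorphD rmorphM /= P0 mulr0 add0r.
    by rewrite rmorphM /= ev_widen rmorphXn.
  have uI := good_unit gIm.
  have eQ : ev Q = ev (of_uni rho) / ev I ^+ m by rewrite -e mulrAC divrr // mul1r.
  have [r0|r0] := eqVneq (of_uni rho) 0; first by left; rewrite eQ r0 rmorph0 mul0r.
  right; rewrite eQ; apply: goodM; last exact: goodV.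
  by apply: gQ => //; rewrite of_uniK ltn_modp.
(* Differentiate [P(z) = 0] and solve for the new derivative. Its coefficient is the separant at
   [z], which is good because it has lower degree in the last variable than [P]. *)
have zr : frac good (evs r.+1) (iter r.+1 D z).
  have [R eR] := ev_der P; move: eR; rewrite P0 (@D0 _ _ DD) big_ord_recr /= addrA.
  set a := ev R + _ => /eqP; rewrite eq_sym addr_eq0 => /eqP ea.
  have gs : good (ev P^`M(ord_max)).
    apply: gQ; first by rewrite -muni_eq0 muni_deriv_last deriv_neq0.
    by rewrite muni_deriv_last lt_size_deriv.
  have Ta : evs r.+1 a.
    apply: subringD => //.
    by apply: subring_sum => // j; apply: (TM); [apply: TC|apply: (TX j.+1); rewrite ltnS].
  exists (- a), (ev P^`M(ord_max)); split=> //; first exact: subringN.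
  by rewrite ea opprK mulrC mulKr ?good_unit.
apply: frac_good_subfield => // _ [Q _ <-]; have [R ->] := ev_der Q.
have rF := frac_subring good_unit goodM good_natr rT; have [_ _ FM] := rF.
have TF := sub_frac good_natr rT.
apply: subringD => //; first exact/TF/TC.
rewrite big_ord_recr; apply: subringD => //; last by apply: FM => //; exact/TF/TC.
by apply: TF; apply: subring_sum => // j; apply: (TM); [apply: TC|apply: (TX j.+1); rewrite ltnS].
Qed.

End Generated.

(** * Lifting the residue field *)

Lemma mcoeffU_deriv n (R : nzRingType) (P : {mpoly R[n]}) i : P@_(U_(i)) = (P^`M(i))@_0%MM.
Proof. by rewrite mcoeff_deriv mnm0E mulr1n add0m. Qed.

Lemma tau_coefU n (R : comNzRingType) h (P : {mpoly R[n]}) i :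
  (tau h P)@_(U_(i)) = (P^`M(i)).@[h].
Proof. by rewrite mcoeffU_deriv tau_deriv tau_coef0. Qed.

Lemma msize_deriv_lt n (R : idomainType) (P : {mpoly R[n]}) i :
  P^`M(i) != 0 -> (msize P^`M(i) < msize P)%N.
Proof.
move=> d0; rewrite -mlead_deg //; have := mlead_supp d0.
rewrite mcoeff_msupp mcoeff_deriv => /eqP h.
have : (mlead P^`M(i) + U_(i))%MM \in msupp P.
  by rewrite mcoeff_msupp; apply/eqP => e; apply: h; rewrite e mul0rn.
by move=> /msize_mdeg_lt; rewrite mdegD mdeg1 addn1.
Qed.

(* A nonzero polynomial of minimal complexity lacking a property: least number of
   variables, then least degree in the last one, then least total degree. *)
Lemma minimal_polynomial (E : diffFieldType) (good : forall n, {mpoly E[n]} -> Prop) :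
  (forall n c, c != 0 -> good n c%:MP) ->
  (forall n (P : {mpoly E[n]}), good n P -> good n.+1 (mwiden P)) ->
  (exists n (P : {mpoly E[n]}), P != 0 /\ ~ good n P) ->
  exists r (P : {mpoly E[r.+1]}),
    [/\ ~ good _ P, (1 < size (muni P))%N,
        forall I : {mpoly E[r]}, I != 0 -> good _ I,
        forall Q : {mpoly E[r.+1]}, Q != 0 -> (size (muni Q) < size (muni P))%N -> good _ Q
      & forall i, P^`M(i) != 0 -> good _ P^`M(i)].
Proof.
move=> goodC goodW [n0 [P0 bad0]].
pose bad n (P : {mpoly E[n]}) := P != 0 /\ ~ good n P.
have exn : exists n, `[< exists P : {mpoly E[n]}, bad n P >].
  by exists n0; apply/asboolP; exists P0.
case: (ex_minnP exn) => -[|r] /asboolP[P1 bad1] minn.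
  case: bad1 => P1n []; rewrite -(mpolyKC P1) in P1n *; apply: goodC.
  by apply: contraNneq P1n => ->; rewrite mpolyC0.
have exd : exists d, `[< exists P : {mpoly E[r.+1]}, bad _ P /\ size (muni P) = d >].
  by exists (size (muni P1)); apply/asboolP; exists P1.
case: (ex_minnP exd) => d /asboolP[P2 [bad2 sP2]] mind.
have exm : exists m, `[< exists P : {mpoly E[r.+1]},
    [/\ bad _ P, size (muni P) = d & msize P = m] >].
  by exists (msize P2); apply/asboolP; exists P2.
case: (ex_minnP exm) => m /asboolP[P [badP sP mP]] minm.
have goodI (I : {mpoly E[r]}) : I != 0 -> good _ I.
  move=> I0; apply: contrapT => nI; suff : (r.+1 <= r)%N by rewrite ltnn.
  by apply: minn; apply/asboolP; exists I.
have good_lt (Q : {mpoly E[r.+1]}) : Q != 0 -> (size (muni Q) < size (muni P))%N -> good _ Q.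
  move=> Q0 ltQ; apply: contrapT => nQ; have : (d <= size (muni Q))%N.
    by apply: mind; apply/asboolP; exists Q.
  by rewrite -sP leqNgt ltQ.
have [Pn0 nP] := badP.
exists r, P; split=> //.
  (* If the last variable did not occur, [P] would be a widened polynomial in fewer variables, hence
     good. *)
  rewrite ltnNge; apply/negP => sP1; apply: nP.
  have [I0 eP] : exists2 I : {mpoly E[r]}, I != 0 & P = mwiden I.
    exists (muni P)`_0.
      apply: contraNneq Pn0 => e; rewrite -muni_eq0; apply/eqP.
      by rewrite (size1_polyC sP1) e polyC0.
    by rewrite -[LHS]muniK {1}(size1_polyC sP1) of_uniC.
  by move=> ->; apply: goodW; apply: goodI.
move=> i di0.
have le_i : (size (muni P^`M(i)) <= d)%N.
  rewrite -sP; have [j ->|->] := unliftP ord_max i.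
    have -> : lift ord_max j = widen_ord (leqnSn r) j by apply/ord_inj; rewrite lift_max.
    exact: size_muni_deriv_widen.
  by rewrite muni_deriv_last ltnW // lt_size_deriv // muni_eq0.
(* A derivative in a lower variable may keep the degree in the last one. It is excluded by its
   smaller total degree, which is why the total degree enters the complexity. *)
apply: contrapT => ni; have : (m <= msize P^`M(i))%N.
  apply: minm; apply/asboolP; exists P^`M(i); split; [by split| |by []].
  apply/eqP; rewrite eqn_leq; apply/andP; split; first exact: le_i.
  by apply: mind; apply/asboolP; exists P^`M(i).
by rewrite -mP leqNgt msize_deriv_lt.
Qed.

Lemma ev_meval (A : comUnitRingType) (D : A -> A) (E : diffFieldType)
    (iota : {rmorphism E -> A}) z n (P : {mpoly E[n]}) :
  ev D iota z P = (map_mpoly iota P).@[fun i : 'I_n => iter i D z].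
Proof.
elim/mpoly_ring_ind: P => [c|i|p q hp hq|p q hp hq].
- by rewrite evC map_mpolyC mevalC.
- by rewrite evX map_mpolyX mevalXU.
- by rewrite !rmorphD /= hp hq.
by rewrite !rmorphM /= hp hq.
Qed.

Lemma map_mderiv (R S : comNzRingType) (f : {rmorphism R -> S}) n (P : {mpoly R[n]}) i :
  map_mpoly f P^`M(i) = (map_mpoly f P)^`M(i).
Proof.
by apply/mpolyP => m; rewrite mcoeff_map_mpoly !mcoeff_deriv mcoeff_map_mpoly raddfMn.
Qed.

Section ResidueLift.
Variables (G : oagType) (K : valuedDiffFieldType G).
Local Notation v := (@valuation G K).

Lemma val_prime p : prime p -> v (p%:R : K) = 0.
Proof.
move=> pp; have : (p%:R : @residue G K) != 0.
  by have := @residue_pchar0 G K p; rewrite !inE pp /= => ->.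
rewrite -(rmorph_nat (@reduction G K)) reduction_eq0 inE rmorph_nat negb_or -oag_leNgt.
move=> /andP[n1 vn]; apply/eqP; rewrite eq_le vn /=.
by have := vb_natr K p; rewrite vb_neq0.
Qed.

Lemma val_natr n : (0 < n)%N -> v (n%:R : K) = 0.
Proof.
elim/ltn_ind: n => n IH n0; have [n1|n1] := leqP n 1.
  by rewrite (_ : n = 1%N) ?Defs.val1 //; case: n n0 n1 {IH} => [|[]].
rewrite -(divnK (pdiv_dvd n)) natrM.
have q0 : (0 < n %/ pdiv n)%N by rewrite divn_gt0 ?pdiv_gt0 // pdiv_leq.
rewrite Defs.valM ?natr_neq0 ?pdiv_gt0 // IH ?add0r //; last first.
  by rewrite ltn_Pdiv // prime_gt1 ?pdiv_prime.
by rewrite val_prime ?pdiv_prime.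
Qed.

Lemma vb_natMr s g (x : K) n : (0 < n)%N -> vb s g (x *+ n) = vb s g x.
Proof.
move=> n0; have nz : (n%:R : K) != 0 by apply: natr_neq0.
by rewrite -mulr_natl vb_mull // val_natr // subr0.
Qed.

Hypotheses (mono : monotone K) (hensK : hens K).

Definition unit_val : set K := [set x | x != 0 /\ v x = 0].

Lemma unit_valP x : vb false 0 x -> ~~ vb true 0 x -> unit_val x.
Proof.
move=> x0 /vb_not[xn vx]; split=> //; apply/eqP; rewrite eq_le vx /=.
by rewrite vb_neq0 in x0.
Qed.

Lemma unit_val_vb x : unit_val x -> vb false 0 x /\ ~~ vb true 0 x.
Proof. by move=> [x0 vx]; rewrite !vb_neq0 // vx lexx ltxx. Qed.

Lemma unit_val_unit x : unit_val x -> x \is a GRing.unit.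
Proof. by case=> x0 _; rewrite unitfE. Qed.

Lemma unit_valM x y : unit_val x -> unit_val y -> unit_val (x * y).
Proof. by move=> [x0 vx] [y0 vy]; split; rewrite ?mulf_neq0 // Defs.valM // vx vy addr0. Qed.

Lemma unit_valV x : unit_val x -> unit_val x^-1.
Proof. by move=> [x0 vx]; split; rewrite ?invr_eq0 // valV // vx oppr0. Qed.

Lemma unit_valN x : unit_val x -> unit_val (- x).
Proof. by move=> [x0 vx]; split; rewrite ?oppr_eq0 // valN. Qed.

Lemma unit_val_natr n : (0 < n)%N -> unit_val n%:R.
Proof. by move=> n0; split; [apply: natr_neq0|apply: val_natr]. Qed.

Lemma residue_lift : exists (k : diffFieldType) (iota : {rmorphism k -> K}),
  [/\ forall x, iota (der x) = der (iota x),
      forall x, x != 0 -> v (iota x) = 0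
    & forall a, vb false 0 a -> exists x, vb true 0 (a - iota x)].
Proof.
have [S0 [gS0 _ _]] := prime_good_subfield (@derD K) (@derM K) unit_val_unit unit_valM
  unit_valV unit_valN unit_val_natr.
have [S [gS _ _ maxS]] := max_good_subfield (W := setT) gS0 (fun _ _ => I).
have [k [iota [iotaD _ iotaS]]] :=
  good_subfield_type (@derD K) (@derM K) unit_val_unit unit_val_natr gS.
have iota_unit x : x != 0 -> unit_val (iota x).
  move=> x0; have [_ Sg _ _] := gS.
  have /Sg[/eqP|//] : S (iota x) by apply/iotaS; exists x.
  by rewrite fmorph_eq0 (negPf x0).
exists k, iota; split=> // [x /iota_unit[]//|a a0].
apply: contrapT => na.
have iota0 x : vb false 0 (iota x).
  by have [->|/iota_unit/unit_val_vb[]//] := eqVneq x 0; rewrite rmorph0 vb0.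
(* If an element congruent to [a] generated a subfield of units, this subfield would lie in [S] by
   maximality, and [a] would be congruent to an element of [k] after all. *)
have new_elt z T : vb true 0 (z - a) -> (forall x, T (iota x)) -> T z ->
    subring T -> ~ good_subfield der unit_val (frac unit_val T).
  move=> za TS Tz rT gF; have TF := sub_frac unit_val_natr rT.
  have SF : S `<=` frac unit_val T by move=> _ /iotaS[x <-]; apply/TF/TS.
  have /iotaS[x ex] : S z by apply: maxS gF SF _ _ _ => //; apply: TF.
  by apply: na; exists x; rewrite ex -vbN opprB.
(* Polynomials over [k] have integral coefficients, so congruent arguments have congruent values. In
   this way goodness at [a] passes to the root [z] found later. *)
have cong z n (Q : {mpoly k[n]}) : vb true 0 (z - a) ->
    [/\ vb false 0 (ev der iota a Q), vb false 0 (ev der iota z Q) &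
      vb true 0 (ev der iota z Q - ev der iota a Q)].
  move=> za; have z0 : vb false 0 z by rewrite -(subrK a z) vbD // vbW.
  elim/mpoly_ring_ind: Q => [c|i|p q [p1 p2 p3] [q1 q2 q3]|p q [p1 p2 p3] [q1 q2 q3]].
  - by rewrite !evC subrr vb0.
  - by rewrite !evX; split; rewrite -?iter_derN -?iter_derD; apply: vb_iter.
  - by rewrite !rmorphD /= opprD addrACA; split; apply: vbD.
  rewrite !rmorphM /=; set pz := ev _ _ z p in p2 p3 *; set pa := ev _ _ a p in p1 p3 *.
  set qz := ev _ _ z q in q2 q3 *; set qa := ev _ _ a q in q1 q3 *.
  rewrite -[0]addr0; split; try by apply: (@vbM _ _ false false).
  have -> : pz * qz - pa * qa = (pz - pa) * qz + pa * (qz - qa).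
    by rewrite mulrBl mulrBr addrA subrK.
  by apply: vbD; [apply: (@vbM _ _ true false)|apply: (@vbM _ _ false true)].
have gcong z n (Q : {mpoly k[n]}) : vb true 0 (z - a) -> unit_val (ev der iota a Q) ->
    unit_val (ev der iota z Q).
  move=> za [q0 vq]; have [_ _] := cong z n Q za; rewrite -{1}vq => /(val_eq q0)[? vz].
  by split; rewrite ?vz.
pose good n (Q : {mpoly k[n]}) := unit_val (ev der iota a Q).
have [|nobad] := pselect (exists n (P : {mpoly k[n]}), P != 0 /\ ~ good n P); last first.
  apply: (new_elt a (\bigcup_n evs der iota a n)); rewrite ?subrr ?vb0 //.
  - by move=> x; exists 0%N => //; exists x%:MP => //; rewrite evC.
  - by exists 1%N => //; exists 'X_ord0; rewrite ?evX.
  - exact: evs_union_subring.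
  apply: generated_transcendental => //; try exact: derD; try exact: derM.
  - exact: unit_val_unit.
  - exact: unit_valM.
  - exact: unit_valV.
  - exact: unit_val_natr.
  move=> n Q; have [->|Q0] := eqVneq Q 0; first by left; rewrite rmorph0.
  by right; apply: contrapT => nQ; apply: nobad; exists n, Q.
move=> /minimal_polynomial[n c c0|n P gP|r [P [badP sP goodI goodQ goodD]]].
- by rewrite /good evC; apply: iota_unit.
- by rewrite /good ev_widen.
have dP0 : P^`M(ord_max) != 0 by rewrite -muni_eq0 muni_deriv_last deriv_neq0.
suff [z za Pz] : exists2 z, vb true 0 (z - a) & ev der iota z P = 0.
  have gF : good_subfield der unit_val (frac unit_val (evs der iota z r.+1)).
    apply: (generated_algebraic _ _ unit_val_unit _ _ _ _ Pz sP) => //.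
    - exact: derD.
    - exact: derM.
    - exact: unit_valM.
    - exact: unit_valV.
    - exact: unit_val_natr.
    - by move=> I0 /goodI; apply: gcong.
    by move=> Q Q0 /(goodQ _ Q0); apply: gcong.
  apply: (new_elt z _ za) gF; last exact: evs_subring.
  - by move=> x; exists x%:MP => //; rewrite evC.
  by exists 'X_ord0; rewrite ?evX.
have Pa0 : vb false 0 (ev der iota a P) by have [] := cong a _ P; rewrite ?subrr ?vb0.
have Pa1 : vb true 0 (ev der iota a P) by apply: contrapT => /negP/(unit_valP Pa0).
have [Pz|Pnz] := eqVneq (ev der iota a P) 0; first by exists a; rewrite ?subrr ?vb0.
have vP : 0 < v (ev der iota a P) by rewrite vb_neq0 in Pa1.
have nP : nb false 0 0 (map_mpoly iota P).
  by move=> m; rewrite mul0rn subr0 mcoeff_map_mpoly; apply: iota0.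
(* The scale is [P(a)], of positive value. All coefficients are integral and the separant at [a] is
   a unit, so the linear terms dominate on that ball with [b = 0]. *)
have [||z za Pz] := newton mono hensK (P := map_mpoly iota P) (x := a) (b := 0) Pnz.
- split=> [m m1|i|].
  + rewrite add0r; apply: (@vb_lt _ _ _ 0).
      by rewrite oag_lt_subl add0r -[X in X < _]mulr1n oag_ltMnr.
    have := nb_tau (h := jet a) nP (fun i => vb_iter mono i a0) m.
    by rewrite mul0rn subr0.
  + by have := nb_tau (h := jet a) nP (fun i => vb_iter mono i a0) U_(i)%MM; rewrite mul0rn subr0.
  exists ord_max; rewrite tau_coefU -map_mderiv -ev_meval.
  by have /unit_val_vb[] := goodD _ dP0.
- by rewrite add0r -ev_meval vb_val.
exists z; last by rewrite ev_meval.
by apply: vb_lt vP za.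
Qed.

End ResidueLift.

(** * Back and forth *)

(** A larger [g] is a smaller ball, and two balls that meet are nested. Countable families are
    enough for countable subfields, and they are within reach of an ultrapower over [nat]. *)
Definition ball_complete (G : oagType) (K : valuedFieldType G) : Prop :=
  forall (b : nat -> K) (g : nat -> G),
    (forall i j, g i <= g j -> vb false (g i) (b j - b i)) ->
    exists x, forall i, vb false (g i) (x - b i).

(* [iota] lifts the residue field [k] and [s] is a cross section of the valuation
   whose logarithmic derivative is [c]. *)
Record hahn_frame (k : diffFieldType) (H : oagType) (c : H -> k)
    (K : valuedDiffFieldType H) (iota : {rmorphism k -> K}) (s : H -> K) : Prop :=
  HahnFrame {
    hl_mono : monotone K;
    hl_der : forall x, iota (der x) = der (iota x);
    hl_unit : forall x, x != 0 -> valuation (iota x) = 0;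
    hl_residue : forall a, vb false 0 a -> exists x, vb true 0 (a - iota x);
    hl_neq0 : forall g, s g != 0;
    hl_val : forall g, valuation (s g) = g;
    hl_mul : forall g h, s (g + h) = s g * s h;
    hl_sder : forall g, der (s g) = iota (c g) * s g }.

(** Henselianity and completeness are separated from the frame because for the Hahn field
    henselianity is itself derived from the frame. *)
Record hahn_like (k : diffFieldType) (H : oagType) (c : H -> k)
    (K : valuedDiffFieldType H) (iota : {rmorphism k -> K}) (s : H -> K) : Prop :=
  HahnLike {
    hl_frame :> hahn_frame c iota s;
    hl_hens : hens K;
    hl_complete : ball_complete K }.

Lemma subV (F : fieldType) (x y : F) : x != 0 -> y != 0 ->
  x^-1 - y^-1 = (y - x) / (x * y).
Proof.
by move=> x0 y0; rewrite invfM mulrBl [y * _]mulrCA mulfV // mulr1 mulrA mulfV // mul1r.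
Qed.

Section LeadingTerm.
Variables (k : diffFieldType) (H : oagType) (c : H -> k) (K : valuedDiffFieldType H).
Variables (iota : {rmorphism k -> K}) (s : H -> K).
Hypothesis hl : hahn_frame c iota s.
Local Notation v := (@valuation H K).
Implicit Types (a b : k) (g h : H) (x y : K).

Definition lead a g x : Prop := a != 0 /\ vb true g (x - iota a * s g).

Lemma s0 : s 0 = 1.
Proof.
apply: (mulfI (hl_neq0 hl 0)); rewrite mulr1 -(hl_mul hl); congr s; exact: addr0.
Qed.

Lemma sN g : s (- g) = (s g)^-1.
Proof.
apply: (mulfI (hl_neq0 hl g)); rewrite -(hl_mul hl) subrr s0 mulfV //.
exact: (hl_neq0 hl).
Qed.

Lemma term_neq0 a g : a != 0 -> iota a * s g != 0.
Proof. by move=> a0; rewrite mulf_neq0 ?fmorph_eq0 ?(hl_neq0 hl). Qed.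

Lemma term_val a g : a != 0 -> v (iota a * s g) = g.
Proof.
move=> a0; rewrite Defs.valM ?fmorph_eq0 ?(hl_neq0 hl) //.
by rewrite (hl_unit hl) // (hl_val hl) add0r.
Qed.

Lemma vb_iota a : vb false 0 (iota a).
Proof.
by have [->|a0] := eqVneq a 0; rewrite ?rmorph0 ?vb0 // vb_neq0 ?fmorph_eq0 // (hl_unit hl).
Qed.

Lemma lead_val a g x : lead a g x -> x != 0 /\ v x = g.
Proof.
move=> [a0]; rewrite -{1}(term_val g a0) => /(val_eq (term_neq0 g a0))[? ->].
by rewrite term_val.
Qed.

Lemma leadP x : x != 0 -> exists a, lead a (v x) x.
Proof.
move=> x0; have sx := hl_neq0 hl (v x).
have [|a ha] := hl_residue hl (a := x / s (v x)).
  by rewrite vb_divr // (hl_val hl) add0r vb_val.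
have ha' : vb true (v x) (x - iota a * s (v x)).
  by have := vbM ha (vb_val (s (v x))); rewrite (hl_val hl) add0r mulrBl divfK.
exists a; split=> //; apply: contraTneq ha' => ->.
by rewrite rmorph0 mul0r subr0 vb_true_val.
Qed.

Lemma lead_inj a b g h x : lead a g x -> lead b h x -> a = b /\ g = h.
Proof.
move=> la lb; have [_ vg] := lead_val la; have [_ vh] := lead_val lb.
have e : g = h by rewrite -vg -vh.
split=> //; rewrite -{h vh}e in lb; case: la => _ la; case: lb => _ lb.
apply/eqP; rewrite -subr_eq0; apply/negPn/negP => ab0.
have : vb true g (iota (a - b) * s g).
  have -> : iota (a - b) * s g = (x - iota b * s g) - (x - iota a * s g).
    by rewrite rmorphB mulrBl opprB [RHS]addrC addrA subrK.
  exact: vbB.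
by rewrite -{1}(term_val g ab0) vb_true_val (negPf (term_neq0 g ab0)).
Qed.

Lemma lead_close a g x y : lead a g x -> vb true g (y - x) -> lead a g y.
Proof.
by move=> [a0 lx] yx; split=> //; rewrite -(subrK x y) -addrA vbD.
Qed.

Lemma leadM a b g h x y : lead a g x -> lead b h y -> lead (a * b) (g + h) (x * y).
Proof.
move=> lx ly; have [x0 vx] := lead_val lx; case: lx ly => a0 lx [b0 ly].
split; first by rewrite mulf_neq0.
rewrite rmorphM (hl_mul hl) mulrACA.
have -> : x * y - iota a * s g * (iota b * s h) =
    x * (y - iota b * s h) + (x - iota a * s g) * (iota b * s h).
  by rewrite mulrBl mulrBr addrA subrK.
apply: vbD.
  by have := vbM (vb_val x) ly; rewrite vx.
by have := vbM lx (vb_val (iota b * s h)); rewrite term_val.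
Qed.

Lemma lead_iota a : a != 0 -> lead a 0 (iota a).
Proof. by move=> a0; split=> //; rewrite s0 mulr1 subrr vb0. Qed.

Lemma lead_s g : lead 1 g (s g).
Proof. by split; rewrite ?oner_neq0 // rmorph1 mul1r subrr vb0. Qed.

Lemma leadV a g x : lead a g x -> lead a^-1 (- g) x^-1.
Proof.
move=> lx; have [x0 vx] := lead_val lx; have [a0 lx'] := lx; split; rewrite ?invr_eq0 //.
have t0 := term_neq0 g a0; set t := iota a * s g in lx' t0.
have -> : iota a^-1 * s (- g) = t^-1 by rewrite sN fmorphV invfM.
rewrite subV //.
have xt0 : x * t != 0 by exact: mulf_neq0.
rewrite (vb_divr _ _ _ xt0) (Defs.valM _ _ x0 t0) vx term_val // addKr.
by rewrite -vbN opprB.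
Qed.

Lemma leadN a g x : lead a g x -> lead (- a) g (- x).
Proof.
by move=> [a0 lx]; split; rewrite ?oppr_eq0 // rmorphN mulNr -opprD vbN.
Qed.

Lemma lead_natr n : (0 < n)%N -> lead n%:R 0 n%:R.
Proof. by move=> n0; rewrite -[X in lead _ _ X](rmorph_nat iota); apply/lead_iota/natr_neq0. Qed.

Lemma lead_sum n (a : 'I_n -> k) (f : 'I_n -> H) (t : 'I_n -> K) m :
  (forall i, lead (a i) (f i) (t i)) -> (forall i, m <= f i) ->
  \sum_(i | f i == m) a i != 0 -> lead (\sum_(i | f i == m) a i) m (\sum_i t i).
Proof.
move=> lt mf C0; split=> //; rewrite rmorph_sum mulr_suml [X in _ - X]big_mkcond -sumrB.
apply: vb_sum => i _; have [ti vt] := lead_val (lt i); have [_ hi] := lt i.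
case: eqVneq => [<-|fm]; first by [].
by rewrite subr0 vb_neq0 // vt lt_neqAle eq_sym fm mf.
Qed.

End LeadingTerm.

Lemma oag_argmin (H : oagType) n (f : 'I_n.+1 -> H) : exists i0, forall i, f i0 <= f i.
Proof.
elim: n f => [|n IH] f; first by exists ord0 => i; rewrite (ord1 i) lexx.
have [j hj] := IH (fun i => f (lift ord0 i)).
case/orP: (oag_total (f ord0) (f (lift ord0 j))) => h.
  exists ord0 => i; have [l ->|->] := unliftP ord0 i; last exact: lexx.
  exact: le_trans (hj l).
by exists (lift ord0 j) => i; have [l ->|->] := unliftP ord0 i.
Qed.

(** * Partial isomorphisms as subfields of a product *)

Section Pairs.
Variables (k : diffFieldType) (H : oagType) (c : H -> k).
Variables (K1 K2 : valuedDiffFieldType H).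
Variables (iota1 : {rmorphism k -> K1}) (s1 : H -> K1).
Variables (iota2 : {rmorphism k -> K2}) (s2 : H -> K2).
Hypotheses (hl1 : hahn_like c iota1 s1) (hl2 : hahn_like c iota2 s2).

Local Notation A := (K1 * K2)%type.
Implicit Types (p q : A) (S : set A).

Definition pder p : A := (der p.1, der p.2).
Definition piota (a : k) : A := (iota1 a, iota2 a).
Definition psec (g : H) : A := (s1 g, s2 g).
Definition plead a g p : Prop := lead iota1 s1 a g p.1 /\ lead iota2 s2 a g p.2.
Definition pgood : set A := [set p | exists a g, plead a g p].

Lemma pderD : {morph pder : p q / p + q}.
Proof. by move=> p q; rewrite /pder !derD. Qed.

Lemma pderM p q : pder (p * q) = pder p * q + p * pder q.
Proof. by rewrite /pder !derM. Qed.

Lemma iter_pder n p : iter n pder p = (iter n der p.1, iter n der p.2).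
Proof. by elim: n => [|n /= ->]; first case: p. Qed.

Lemma pgood_neq0 p : pgood p -> (p.1 != 0) * (p.2 != 0).
Proof. by move=> [a [g [/(lead_val hl1)[? _] /(lead_val hl2)[? _]]]]. Qed.

Lemma pgood_unit p : pgood p -> p \is a GRing.unit.
Proof. by move=> /pgood_neq0[p1 p2]; apply/andP; rewrite !unitfE. Qed.

Lemma pairV p : p.1 != 0 -> p.2 != 0 -> p^-1 = (p.1^-1, p.2^-1).
Proof.
move=> p1 p2; have up : p \is a GRing.unit by apply/andP; rewrite !unitfE.
apply: (mulrI up); rewrite divrr //; congr (_, _); rewrite /= mulfV //.
Qed.

Lemma pgoodM p q : pgood p -> pgood q -> pgood (p * q).
Proof.
move=> [a [g [p1 p2]]] [b [h [q1 q2]]]; exists (a * b), (g + h).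
by split; [apply: (leadM hl1)|apply: (leadM hl2)].
Qed.

Lemma pgoodV p : pgood p -> pgood p^-1.
Proof.
move=> gp; have [n1 n2] := pgood_neq0 gp; case: gp => a [g [p1 p2]].
rewrite pairV //; exists a^-1, (- g).
by split; [apply: (leadV hl1)|apply: (leadV hl2)].
Qed.

Lemma pgoodN p : pgood p -> pgood (- p).
Proof.
by move=> [a [g [p1 p2]]]; exists (- a), g; split; apply: leadN.
Qed.

Lemma pair_natr n : n%:R = (n%:R, n%:R) :> A.
Proof. by elim: n => // n IH; rewrite !mulrS IH. Qed.

Lemma pgood_natr n : (0 < n)%N -> pgood n%:R.
Proof.
move=> n0; exists n%:R, 0; rewrite pair_natr.
by split; [apply: (lead_natr hl1)|apply: (lead_natr hl2)].
Qed.

Lemma piotaD : {morph piota : a b / a + b}.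
Proof. by move=> a b; rewrite /piota !rmorphD. Qed.

Lemma piotaM : {morph piota : a b / a * b}.
Proof. by move=> a b; rewrite /piota !rmorphM. Qed.

Lemma piota0 : piota 0 = 0.
Proof. by rewrite /piota !rmorph0. Qed.

Lemma piota1 : piota 1 = 1.
Proof. by rewrite /piota !rmorph1. Qed.

Lemma piotaN a : piota (- a) = - piota a.
Proof. by rewrite /piota !rmorphN. Qed.

Lemma psecD g h : psec (g + h) = psec g * psec h.
Proof. by rewrite /psec (hl_mul hl1) (hl_mul hl2). Qed.

Lemma psec0 : psec 0 = 1.
Proof. by rewrite /psec (s0 hl1) (s0 hl2). Qed.

Lemma plead_iota a : a != 0 -> plead a 0 (piota a).
Proof. by move=> a0; split; [apply: (lead_iota hl1)|apply: (lead_iota hl2)]. Qed.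

Lemma plead_sec g : plead 1 g (psec g).
Proof. by split; apply: lead_s. Qed.

Lemma pleadM a b g h p q : plead a g p -> plead b h q -> plead (a * b) (g + h) (p * q).
Proof. by move=> [p1 p2] [q1 q2]; split; [apply: (leadM hl1)|apply: (leadM hl2)]. Qed.

Lemma piotaV a : a != 0 -> piota a^-1 = (piota a)^-1.
Proof. by move=> a0; rewrite pairV ?fmorph_eq0 // /piota !fmorphV. Qed.

Lemma psecN g : psec (- g) = (psec g)^-1.
Proof. by rewrite pairV ?(hl_neq0 hl1) ?(hl_neq0 hl2) // /psec (sN hl1) (sN hl2). Qed.

Lemma pair_sum (I : Type) (r : seq I) (F : I -> A) :
  \sum_(i <- r) F i = (\sum_(i <- r) (F i).1, \sum_(i <- r) (F i).2).
Proof.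
elim: r => [|i r IH]; first by rewrite !big_nil.
by rewrite !big_cons IH.
Qed.

(* A differential subfield of [K1 * K2] in which every nonzero pair has a common
   leading term is the graph of an isomorphism between subfields of [K1] and [K2]. *)
Definition partial_iso S : Prop := good_subfield pder pgood S /\
  forall p a g, S p -> plead a g p -> S (piota a) /\ S (psec g).

Section AdjoinAll.
Variable S : set A.
Hypothesis pS : partial_iso S.

Lemma S_subring : subring S. Proof. by case: pS => -[]. Qed.

(** If the terms of least value cancel, the sum is rewritten with one term fewer. The new
    coefficients remain in [S] because a partial isomorphism contains both factors of the leading
    term of each of its elements. *)
Lemma pgood_sum n (e : 'I_n -> A) (a : 'I_n -> k) (g : 'I_n -> H) :
  (forall i, S (e i)) -> zgood pgood (\sum_i e i * piota (a i) * psec (g i)).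
Proof.
elim: n e a g => [|n IH] e a g Se; first by left; rewrite big_ord0.
have drop i : e i * piota (a i) = 0 ->
    zgood pgood (\sum_i e i * piota (a i) * psec (g i)).
  move=> ei; rewrite (bigD1_ord i) //= ei mul0r add0r.
  exact: (IH _ (fun j => a (lift i j)) (fun j => g (lift i j))).
have [[i ei]|ne] := pselect (exists i, e i * piota (a i) = 0); first exact: drop ei.
have lt_e i : exists bd : k * H, plead bd.1 bd.2 (e i).
  have [_ Sg _ _] := pS.1; case: (Sg _ (Se i)) => [e0|[b [d l]]].
    by case: ne; exists i; rewrite e0 mul0r.
  by exists (b, d).
have {lt_e} [bd lbd] := choice lt_e.
have a0 i : a i != 0.
  by apply/eqP => ai; apply: ne; exists i; rewrite ai piota0 mulr0.
have b0 i : (bd i).1 != 0 by have [[]] := lbd i.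
pose f i := (bd i).2 + g i; have [i0 mini] := oag_argmin f.
pose C := \sum_(i | f i == f i0) (bd i).1 * a i.
have lt i : plead ((bd i).1 * a i) (f i) (e i * piota (a i) * psec (g i)).
  have := pleadM (pleadM (lbd i) (plead_iota (a0 i))) (plead_sec (g i)).
  by rewrite mulr1 addr0.
have [C0|C0] := eqVneq C 0; last first.
  right; exists C, (f i0); rewrite /plead pair_sum; split.
    by apply: (lead_sum hl1) => // i; have [] := lt i.
  by apply: (lead_sum hl2) => // i; have [] := lt i.
(* The cancelling leading terms, divided by the leading term of [e i0], give an exact relation
   between the products [piota (a i) * psec (g i)]. Its coefficients [mu i] lie in [S] and
   [mu i0 = 1], so subtracting [e i0] times the relation removes the index [i0]. *)
pose mu i := if f i == f i0 then
  piota ((bd i).1 / (bd i0).1) * psec ((bd i).2 - (bd i0).2) else 0.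
have mu0 : mu i0 = 1 by rewrite /mu eqxx mulfV // subrr piota1 psec0 mulr1.
have mu_sum : \sum_i mu i * piota (a i) * psec (g i) = 0.
  transitivity (piota (C / (bd i0).1) * psec (g i0)); last first.
    by rewrite C0 mul0r piota0 mul0r.
  rewrite /C mulr_suml (big_morph piota piotaD piota0) mulr_suml [RHS]big_mkcond /=.
  apply: eq_bigr => i _; rewrite /mu; case: eqP => [fi|_]; last by rewrite !mul0r.
  rewrite [LHS]mulrAC -(mulrA (piota _)) -psecD mulrAC -piotaM.
  rewrite [_ / _ * _]mulrAC; congr (_ * psec _).
  by rewrite addrAC; apply/eqP; rewrite subr_eq; apply/eqP; rewrite [RHS]addrC.
have -> : \sum_i e i * piota (a i) * psec (g i) =
    \sum_i (e i - e i0 * mu i) * piota (a i) * psec (g i).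
  under [RHS]eq_bigr do rewrite !mulrBl.
  rewrite sumrB -[LHS]subr0; congr (_ - _).
  transitivity (e i0 * \sum_i mu i * piota (a i) * psec (g i)).
    by rewrite mu_sum mulr0.
  by rewrite mulr_sumr; apply: eq_bigr => i _; rewrite !mulrA.
rewrite (bigD1_ord i0) //= mu0 mulr1 subrr !mul0r add0r.
apply: (IH (fun j => e (lift i0 j) - e i0 * mu (lift i0 j))) => j.
have [[rS _ SV _] Slead] := pS; have [_ SB SM] := rS.
have Sb i : S (piota (bd i).1) /\ S (psec (bd i).2) by apply: Slead (lbd i).
apply: (SB) => //; apply: (SM) => //; rewrite /mu; case: ifP => _; last exact: subring0.
rewrite piotaM psecD piotaV // psecN; apply: (SM); apply: (SM); try exact: (Sb _).1.
- apply: (SV); first exact: (Sb _).1.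
  by exists (bd i0).1, 0; apply: plead_iota.
- exact: (Sb _).2.
apply: (SV); first exact: (Sb _).2.
by exists 1, (bd i0).2; apply: plead_sec.
Qed.

Definition pterm (t : A * k * H) : A := t.1.1 * piota t.1.2 * psec t.2.

Definition pspan : set A :=
  [set x | exists2 l, {in l, forall t, S t.1.1} & x = \sum_(t <- l) pterm t].

Lemma pspan_term e a g : S e -> pspan (e * piota a * psec g).
Proof.
move=> Se; exists [:: (e, a, g)]; last by rewrite big_seq1.
by move=> t; rewrite inE => /eqP ->.
Qed.

Lemma pspanD x y : pspan x -> pspan y -> pspan (x + y).
Proof.
move=> [l Sl ->] [l' Sl' ->]; exists (l ++ l'); last by rewrite big_cat.
by move=> t; rewrite mem_cat => /orP[/Sl|/Sl'].
Qed.

Lemma pspan0 : pspan 0.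
Proof. by exists [::]; rewrite ?big_nil. Qed.

Lemma pspan_ind (P : A -> Prop) : P 0 -> (forall x y, P x -> P y -> P (x + y)) ->
  (forall e a g, S e -> P (e * piota a * psec g)) -> forall x, pspan x -> P x.
Proof.
move=> P0 PD Pt _ [l Sl ->]; rewrite big_seq; elim/big_ind: _ => // -[[e a] g] /Sl Se.
exact: Pt.
Qed.

Lemma pspanM x y : pspan x -> pspan y -> pspan (x * y).
Proof.
have [_ _ SM] := S_subring.
move=> + Sy; elim/pspan_ind: x / => [|x x' hx hx'|e a g Se].
- by rewrite mul0r; apply: pspan0.
- by rewrite mulrDl; apply: pspanD.
elim/pspan_ind: y / Sy => [|y y' hy hy'|e' a' g' Se'].
- by rewrite mulr0; apply: pspan0.
- by rewrite mulrDr; apply: pspanD.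
rewrite mulrACA -psecD [e * _ * _]mulrACA -piotaM; apply: pspan_term; exact: SM.
Qed.

Lemma pspan_subring : subring pspan.
Proof.
have [S1 SB SM] := S_subring.
have span1 : pspan 1.
  by have := pspan_term 1 0 S1; rewrite piota1 psec0 !mulr1.
split=> // [x y Sx Sy|x y]; last exact: pspanM.
apply: pspanD => //; elim/pspan_ind: y / Sy => [|y y' hy hy'|e a g Se].
- by rewrite oppr0; apply: pspan0.
- by rewrite opprD; apply: pspanD.
by rewrite -!mulNr; apply: pspan_term; apply: subringN.
Qed.

Lemma pder_sec g : pder (psec g) = piota (c g) * psec g.
Proof. by rewrite /pder /= (hl_sder hl1) (hl_sder hl2). Qed.

Lemma pder_iota a : pder (piota a) = piota (der a).
Proof. by rewrite /pder /= -(hl_der hl1) -(hl_der hl2). Qed.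

(** The span over [S] of the products [piota a * psec g] is a differential ring, since the section
    is multiplicative with logarithmic derivative in [k]; its nonzero elements are good by
    [pgood_sum]. The result may be uncountable and is meant to be intersected with a countable
    hull. *)
Lemma adjoin_all : exists S', [/\ good_subfield pder pgood S', S `<=` S',
  forall a, S' (piota a) & forall g, S' (psec g)].
Proof.
have [[S1 SB SM] _ _ SD] := pS.1.
have rT := pspan_subring; have TF := sub_frac pgood_natr rT.
exists (frac pgood pspan); split.
- apply: frac_good_subfield => //; try exact: pderD; try exact: pderM.
  + exact: pgood_unit.
  + exact: pgoodM.
  + exact: pgoodV.
  + exact: pgood_natr.
  + move=> _ [l Sl ->]; have [->|l0] := eqVneq l [::]; first by left; rewrite big_nil.
    have [t0 _] : exists t0, t0 \in l by case: l l0 {Sl} => // t l _; exists t; rewrite mem_head.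
    rewrite (big_nth t0) big_mkord; apply: pgood_sum => i; apply: Sl; exact: mem_nth.
  move=> x Tx; apply: TF; elim/pspan_ind: x / Tx => [|x y hx hy|e a g Se].
  + by rewrite (D0 pderD); apply: pspan0.
  + by rewrite pderD; apply: pspanD.
  rewrite !pderM pder_sec pder_iota mulrDl mulrA -[_ * piota (c g)]mulrA -piotaM.
  by do 2?apply: pspanD; apply: pspan_term => //; apply: SD.
- by move=> e Se; apply: TF; have := pspan_term 1 0 Se; rewrite piota1 psec0 !mulr1.
- by move=> a; apply: TF; have := pspan_term a 0 S1; rewrite psec0 mul1r mulr1.
by move=> g; apply: TF; have := pspan_term 1 g S1; rewrite piota1 !mul1r.
Qed.

End AdjoinAll.
End Pairs.

Lemma map_mwiden (R S : comNzRingType) (f : {rmorphism R -> S}) n (P : {mpoly R[n]}) :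
  map_mpoly f (mwiden P) = mwiden (map_mpoly f P).
Proof.
elim/mpoly_ring_ind: P => [c|i|p q hp hq|p q hp hq].
- by rewrite mwidenC !map_mpolyC mwidenC.
- by rewrite mwidenX !map_mpolyX mwidenX.
- by rewrite !rmorphD /= hp hq.
by rewrite !rmorphM /= hp hq.
Qed.

Lemma nb_widen (H : oagType) (K : valuedFieldType H) n s g e (P : {mpoly K[n]}) :
  nb s g e P -> nb s g e (mwiden P).
Proof.
move=> hP; have -> : mwiden P =
    P \mPo [tuple 'X_(widen_ord (leqnSn n) i) | i < n] :> {mpoly K[n.+1]}.
  rewrite /comp_mpoly /mwiden /mmap; apply: eq_bigr => m _; congr (_ * _).
  by apply: mmap1_eq => i; rewrite tnth_mktuple.
by apply: nb_comp hP _ => i; rewrite tnth_mktuple; apply: nb_var.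
Qed.

(** * Polynomials on nested balls *)

Section BallPoint.
Variables (H : oagType) (K : valuedDiffFieldType H) (E : diffFieldType).
Variable f : {rmorphism E -> K}.
Hypotheses (mono : monotone K) (f_der : forall x, f (der x) = der (f x)).
Local Notation v := (@valuation H K).

Lemma f_iter i x : f (iter i der x) = iter i der (f x).
Proof. by elim: i => //= i IH; rewrite f_der IH. Qed.

Lemma map_tau_jet n b (Q : {mpoly E[n]}) :
  map_mpoly f (tau (jet b) Q) = tau (jet (f b)) (map_mpoly f Q).
Proof. by rewrite map_tau; apply: tau_eq => i; apply: f_iter. Qed.

(* [Q] is constant up to smaller terms, with value [e], on the ball of radius [g]
   around [b]; this is a condition on coefficients, so it can be transported. *)
Definition steady n (Q : {mpoly E[n]}) b e g : Prop :=
  nb true g (v (f e)) (map_mpoly f (tau (jet b) Q - e%:MP)).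

Lemma steady_tau n (Q : {mpoly E[n]}) b e g w : steady Q b e g ->
  vb false g (w - f b) -> nb true g (v (f e)) (tau (jet w) (map_mpoly f Q) - (f e)%:MP).
Proof.
move=> hQ wb; have -> : tau (jet w) (map_mpoly f Q) - (f e)%:MP =
    tau (jet (w - f b)) (map_mpoly f (tau (jet b) Q - e%:MP)).
  rewrite (rmorphB (map_mpoly f)) /= map_mpolyC tauB tauC map_tau_jet tau_tau.
  have -> : tau (fun i => jet (w - f b) i + jet (f b) i) (map_mpoly f Q) =
      tau (jet w) (map_mpoly f Q).
    by apply: tau_eq => i; rewrite /jet -iter_derD subrK.
  by [].
by apply: nb_tau hQ _ => i; apply: vb_iter.
Qed.

Lemma steady_eval n (Q : {mpoly E[n]}) b e g w : steady Q b e g ->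
  vb false g (w - f b) -> vb true (v (f e)) ((map_mpoly f Q).@[jet w] - f e).
Proof.
move=> hQ wb; have := steady_tau hQ wb 0%MM.
by rewrite mcoeffB tau_coef0 mcoeffC eqxx mulr1 mdeg0 mulr0n subr0.
Qed.

Lemma steady_move n (Q : {mpoly E[n]}) b e g b' g' : steady Q b e g ->
  vb false g (f b' - f b) -> g <= g' -> steady Q b' e g'.
Proof.
move=> hQ bb gg; apply: nb_wt gg _.
by have := steady_tau hQ bb; rewrite /steady rmorphB /= map_mpolyC map_tau_jet.
Qed.

Lemma steady_widen n (Q : {mpoly E[n]}) b e g : steady Q b e g -> steady (mwiden Q) b e g.
Proof.
move=> /nb_widen; rewrite -map_mwiden rmorphB /= mwidenC.
suff -> : mwiden (tau (jet b) Q) = tau (jet b) (mwiden Q) by [].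
elim/mpoly_ring_ind: Q => [d|i|p q hp hq|p q hp hq].
- by rewrite !(tauC, mwidenC).
- by rewrite tauX rmorphD /= mwidenX mnmwiden1 tauX mwidenC.
- by rewrite tauD !rmorphD /= tauD hp hq.
by rewrite tauM !rmorphM /= tauM hp hq.
Qed.

Section MinimalUnsteady.
Variables (n : nat) (P : {mpoly E[n]}) (b : E) (g : H) (e : 'I_n -> E) (i0 : 'I_n).
Hypotheses (e0 : forall i, e i != 0) (min_e : forall i, v (f (e i0)) <= v (f (e i))).
Hypothesis di0 : P^`M(i0) != 0.
Hypothesis steady_deriv : forall i, P^`M(i) = 0 \/ steady P^`M(i) b (e i) g.
Local Notation beta := (v (f (e i0))).

(** A nonconstant coefficient of the shifted [P] is, up to a positive integer factor, a coefficient
    of one of its first derivatives, and these are controlled by steadiness. The integer has value 0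
    in residue characteristic 0. *)
Lemma steady_lin_dom w h : vb false g (w - f b) -> g <= h ->
  lin_dom h beta (tau (jet w) (map_mpoly f P)).
Proof.
move=> wb gh; have coefU i : (tau (jet w) (map_mpoly f P))@_(U_(i)) =
    (map_mpoly f P^`M(i)).@[jet w] by rewrite tau_coefU map_mderiv.
have ev i : P^`M(i) = 0 \/ vb true (v (f (e i))) ((map_mpoly f P^`M(i)).@[jet w] - f (e i)).
  case: (steady_deriv i) => [->|hi]; [by left|right].
  exact: steady_eval hi wb.
split=> [m m1|i|].
- have [i mi] : exists i, (0 < m i)%N.
    apply: contrapT => no; move: m1; rewrite mdegE big1 // => i _.
    by apply/eqP; rewrite -leqn0 leqNgt; apply/negP => mi; apply: no; exists i.
  have def_m : (m - U_(i) + U_(i) = m)%MM by rewrite submK // lep1mP -lt0n.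
  have dm : mdeg (m - U_(i))%MM = (mdeg m).-1 by rewrite -{2}def_m mdegD mdeg1 addn1.
  have : vb true (beta - g *+ (mdeg m).-1) ((tau (jet w) (map_mpoly f P))@_m *+ m i).
    have := mcoeff_deriv i (m - U_(i))%MM (tau (jet w) (map_mpoly f P)).
    rewrite def_m mnmBE mnm1E eqxx subn1 prednK // => <-; rewrite tau_deriv -map_mderiv.
    case: (steady_deriv i) => [->|hi]; first by rewrite (rmorph0 (map_mpoly f)) tau0 mcoeff0 vb0.
    have m0 : ((m - U_(i))%MM == 0%MM) = false.
      by rewrite -mdeg_eq0 dm; case: (mdeg m) m1 => [|[]].
    have := steady_tau hi wb (m - U_(i))%MM.
    rewrite mcoeffB mcoeffC m0 mulr0 subr0 dm; apply: vb_le.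
    by rewrite oag_lerD2rE.
  rewrite vb_natMr //; apply: vb_le.
  rewrite -addrA oag_leD2l; case: (mdeg m) m1 => // d _ /=.
  by rewrite mulrS opprD addrA subrr add0r oag_leN2 oag_leMn.
- rewrite coefU; case: (ev i) => [->|hi]; first by rewrite (rmorph0 (map_mpoly f)) meval0 vb0.
  rewrite -(subrK (f (e i)) (_).@[_]); apply: vbD.
    by apply/(vb_le (min_e i))/vbW.
  exact/(vb_le (min_e i))/vb_val.
exists i0; rewrite coefU; case: (ev i0) => [d0|hi]; first by move: di0; rewrite d0 eqxx.
have fe0 : f (e i0) != 0 by rewrite fmorph_eq0.
by have [n0 vn] := val_eq fe0 hi; rewrite -vn vb_true_val (negPf n0).
Qed.

(** All nonconstant terms of the shifted [P] have value at least [beta + h] on the ball. If [P(b')]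
    had smaller value, it would dominate them, and [P] would be steady with value [P(b')]. *)
Lemma unsteady_vb b' h : vb false g (f b' - f b) -> g <= h ->
  (forall e', e' != 0 -> ~ steady P b' e' h) ->
  vb false (beta + h) (map_mpoly f P).@[jet (f b')].
Proof.
move=> bb gh unst; have def_p : (map_mpoly f P).@[jet (f b')] = f P.@[jet b'].
  rewrite -tau_coef0 -map_tau_jet mcoeff_map_mpoly tau_coef0 //.
set p := P.@[jet b'] in def_p; rewrite def_p; apply: contrapT => /negP/vb_not[p0 vp].
have {}p0 : p != 0 by apply: contraNneq p0 => ->; rewrite rmorph0.
apply: (unst p p0) => m; have [hm lm _] := steady_lin_dom bb gh.
rewrite rmorphB /= map_mpolyC map_tau_jet mcoeffB mcoeffC.
have [m1|] := ltnP 1 (mdeg m).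
  have -> : (m == 0%MM) = false by rewrite -mdeg_eq0; case: (mdeg m) m1.
  rewrite mulr0 subr0; apply: vb_le (hm m m1).
  by rewrite oag_lerD2rE ltW.
rewrite leq_eqVlt ltnS leqn0 => /orP[/mdeg1P[i /eqP ->]|]; last first.
  rewrite mdeg_eq0 => /eqP ->; rewrite eqxx mulr1 tau_coef0 def_p subrr vb0 //.
have -> : (U_(i)%MM == 0%MM :> 'X_{1..n}) = false by rewrite -mdeg_eq0 mdeg1.
rewrite mulr0 subr0 mdeg1; apply: vb_lt (lm i).
by rewrite oag_lt_subl.
Qed.

Lemma limit_vb b' h w : vb false g (f b' - f b) -> g <= h ->
  (forall e', e' != 0 -> ~ steady P b' e' h) -> vb false h (w - f b') ->
  vb false (beta + h) (map_mpoly f P).@[jet w].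
Proof.
move=> bb gh unst wb; have p0 := unsteady_vb bb gh unst.
have [hm lm _] := steady_lin_dom bb gh.
have -> : (map_mpoly f P).@[jet w] =
    (tau (jet (f b')) (map_mpoly f P)).@[jet (w - f b')].
  by rewrite tau_eval; apply: meval_eq => i; rewrite /jet -iter_derD subrK.
apply: (@nb_eval _ _ _ _ h) => [m|i]; last exact: vb_iter.
have [m1|] := ltnP 1 (mdeg m); first exact/vbW/hm.
rewrite leq_eqVlt ltnS leqn0 => /orP[/mdeg1P[i /eqP ->]|].
  by rewrite mdeg1 mulr1n addrK.
by rewrite mdeg_eq0 => /eqP ->; rewrite mdeg0 mulr0n subr0 tau_coef0.
Qed.

(** The Newton correction at [w] has the size of [P(w) / f (e i0)]. This being within the radius of
    every ball, the corrected point stays in all of them. *)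
Lemma limit_far w (hy : E -> H) : g <= hy b ->
  (forall b', vb false (hy b') (w - f b')) ->
  (forall b' e', e' != 0 -> ~ steady P b' e' (hy b')) ->
  (map_mpoly f P).@[jet w] != 0 ->
  forall b', hy b' <= v ((map_mpoly f P).@[jet w] / f (e i0)).
Proof.
move=> gb wb unst pw b'; have fe0 : f (e i0) != 0 by rewrite fmorph_eq0.
rewrite Defs.valM ?invr_eq0 // valV // oag_le_subr addrC.
have far b2 : hy b <= hy b2 -> beta + hy b2 <= v ((map_mpoly f P).@[jet w]).
  move=> b_b2; suff : vb false (beta + hy b2) (map_mpoly f P).@[jet w] by rewrite vb_neq0.
  apply: limit_vb (wb b2); [|exact: le_trans b_b2|exact: unst].
  apply: vb_le gb _; have := vbB (wb b) (vb_le b_b2 (wb b2)).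
  by rewrite opprB addrC addrA subrK.
case/orP: (oag_total (hy b) (hy b')) => [/far//|le_b].
by apply: le_trans (far b (lexx _)); rewrite oag_leD2l.
Qed.

Lemma limit_root w : hens K -> vb false g (w - f b) ->
  (map_mpoly f P).@[jet w] != 0 ->
  g <= v ((map_mpoly f P).@[jet w] / f (e i0)) ->
  exists2 z, vb false (v ((map_mpoly f P).@[jet w] / f (e i0))) (z - w) &
    (map_mpoly f P).@[jet z] = 0.
Proof.
move=> hensK wb pw; have fe0 : f (e i0) != 0 by rewrite fmorph_eq0.
set a := _ / _ => ga; have a0 : a != 0 by rewrite mulf_neq0 ?invr_eq0.
apply: (newton mono hensK (b := beta) a0); first exact: steady_lin_dom.
rewrite /a Defs.valM ?invr_eq0 // valV // addrC subrK; exact: vb_val.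
Qed.

End MinimalUnsteady.

End BallPoint.

(** * Countable hulls *)

Lemma countable_closure (X : Type) (I : countType) (f : I -> seq X -> X) (e0 : nat -> X) :
  exists e : nat -> X, (forall n, exists m, e m = e0 n) /\
    forall i (l : seq nat), exists m, e m = f i (map e l).
Proof.
(* Besides applying the operations, a stage copies the previous one through the index [None], so
   finitely many elements of the union always occur together at some stage. Codes that decode to
   nothing yield the junk value [e 0]. *)
pose step (e : nat -> X) (m : nat) : X :=
  match unpickle m : option (option I * seq nat) with
  | Some (Some i, l) => f i (map e l)
  | Some (None, l) => e (head 0%N l)
  | None => e 0%N
  end.
pose E j := iter j step e0.
pose e m := if unpickle m : option (nat * nat) is Some (j, n) then E j n else e0 0%N.
have eE j n : exists m, e m = E j n.
  by exists (pickle (j, n)); rewrite /e pickleK.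
have up j d n : exists m, E (j + d)%N m = E j n.
  elim: d => [|d [m <-]]; first by exists n; rewrite addn0.
  by exists (pickle (None : option I, [:: m])); rewrite addnS /E iterS /step pickleK.
exists e; split=> [n|i l]; first by have [m em] := eE 0%N n; exists m; exact: em.
have [j [l' el']] : exists j l', map e l = map (E j) l'.
  elim: l => [|n l [j [l' IH]]]; first by exists 0%N, [::].
  have [j' [n' en]] : exists j' n', e n = E j' n'.
    by rewrite /e; case: unpickle => [[j' n']|]; [exists j', n'|exists 0%N, 0%N].
  have [m em] := up j' j n'.
  have [l2 el2] : exists l2, map (E j) l' = map (E (j' + j)%N) l2.
    elim: l' {IH} => [|a l' [l2 IH2]]; first by exists [::].
    have [a' ea'] := up j j' a; exists (a' :: l2).
    by rewrite /= IH2 -ea' addnC.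
  by exists (j' + j)%N, (m :: l2); rewrite /= IH el2 en em.
have [m em] := eE j.+1 (pickle (Some i, l')).
by exists m; rewrite em el' /E iterS /step pickleK.
Qed.

Section CountableHull.
Variables (k : diffFieldType) (H : oagType) (c : H -> k) (K : valuedDiffFieldType H).
Variables (iota : {rmorphism k -> K}) (s : H -> K).
Local Notation v := (@valuation H K).

(* A countable subfield closed under all the choices needed to extend a
   partial isomorphism inside it. *)
Record closed_hull (M : set K) : Prop := ClosedHull {
  ch_subring : subring M;
  ch_inv : forall x, M x -> M x^-1;
  ch_der : forall x, M x -> M (der x);
  ch_lead : forall a g x, M x -> lead iota s a g x -> M (iota a) /\ M (s g);
  ch_root : forall n (P : {mpoly K[n]}) x a, (forall m, M P@_m) -> M x -> M a ->
    (exists2 z, vb false (v a) (z - x) & P.@[jet z] = 0) ->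
    exists2 z, M z & vb false (v a) (z - x) /\ P.@[jet z] = 0 }.

Definition hull_root n (P : {mpoly K[n]}) x a : K :=
  xget 0 [set z | vb false (v a) (z - x) /\ P.@[jet z] = 0].

Definition hull_lead (x : K) : k * H :=
  xget (0, 0) [set ag | lead iota s ag.1 ag.2 x].

(** Operations must be indexed by a countable type, so a polynomial enters through its number of
    variables and its list of monomials only. The argument list of the root operation starts with
    [x] and [a]; the coefficients follow from position 2. *)
Definition hull_op (i : 'I_7 + {n : nat & seq 'X_{1..n}}) (l : seq K) : K :=
  match i with
  | inl j => match val j with
    | 0%N => 1
    | 1%N => nth 0 l 0 - nth 0 l 1
    | 2%N => nth 0 l 0 * nth 0 l 1
    | 3%N => (nth 0 l 0)^-1
    | 4%N => der (nth 0 l 0)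
    | 5%N => iota (hull_lead (nth 0 l 0)).1
    | _ => s (hull_lead (nth 0 l 0)).2
    end
  | inr (existT n ms) =>
      hull_root (\sum_(i < size ms) nth 0 l i.+2 *: 'X_[nth 0%MM ms i] : {mpoly K[n]})
        (nth 0 l 0) (nth 0 l 1)
  end.

Hypothesis hl : hahn_frame c iota s.

Lemma countable_hull (e0 : nat -> K) : exists e : nat -> K,
  (forall n, exists m, e m = e0 n) /\ closed_hull (range e).
Proof.
have [e [e0e clos]] := countable_closure hull_op e0; exists e; split=> //.
have op1 j x : range e x -> range e (hull_op (inl j) [:: x]).
  by move=> [n _ <-]; have [m em] := clos (inl j) [:: n]; exists m.
have op2 j x y : range e x -> range e y -> range e (hull_op (inl j) [:: x; y]).
  by move=> [n _ <-] [n' _ <-]; have [m em] := clos (inl j) [:: n; n']; exists m.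
split.
- split=> [|x y|x y].
  + by have [m em] := clos (inl ord0) [::]; exists m.
  + exact: (@op2 (@Ordinal 7 1 isT)).
  + exact: (@op2 (@Ordinal 7 2 isT)).
- exact: (@op1 (@Ordinal 7 3 isT)).
- exact: (@op1 (@Ordinal 7 4 isT)).
- move=> a g x Mx lx; have hx : hull_lead x = (a, g).
    have := xgetI (0, 0) (P := [set ag | lead iota s ag.1 ag.2 x]) (x := (a, g)) lx.
    rewrite -/(hull_lead x) => /= /(lead_inj hl lx).
    by case: (hull_lead x) => a' g' /= [-> ->].
  split; first by have := @op1 (@Ordinal 7 5 isT) _ Mx; rewrite /= hx.
  by have := @op1 (@Ordinal 7 6 isT) _ Mx; rewrite /= hx.
move=> n P x a MP Mx Ma [z zx Pz].
pose ms : seq 'X_{1..n} := msupp P.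
have [l el] : exists l, map e l = [seq P@_m | m <- ms].
  elim: ms => [|m ms [l IH]]; first by exists [::].
  by have [j _ ej] := MP m; exists (j :: l); rewrite /= IH ej.
case: Mx Ma => [nx _ ex] [na _ ea].
have [m em] := clos (inr (existT _ n ms)) [:: nx, na & l].
have defP : \sum_(i < size ms) nth 0 [seq P@_m | m <- ms] i *: 'X_[nth 0%MM ms i] = P.
  rewrite [RHS]mpolyE (big_nth 0%MM) big_mkord; apply: eq_bigr => i _.
  by rewrite (nth_map 0%MM).
exists (e m); first by exists m.
rewrite em /= el ex ea defP.
by have := xgetI 0 (P := [set z | vb false (v a) (z - x) /\ P.@[jet z] = 0]) (x := z) (conj zx Pz).
Qed.

End CountableHull.

(** * Adjoining an element inside a countable hull *)

Section ExtendInside.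
Variables (k : diffFieldType) (H : oagType) (c : H -> k).
Variables (K1 K2 : valuedDiffFieldType H).
Variables (iota1 : {rmorphism k -> K1}) (s1 : H -> K1).
Variables (iota2 : {rmorphism k -> K2}) (s2 : H -> K2).
Hypotheses (hl1 : hahn_like c iota1 s1) (hl2 : hahn_like c iota2 s2).
Local Notation A := (K1 * K2)%type.
Local Notation good := (pgood iota1 s1 iota2 s2).
Local Notation pD := (@pder H K1 K2).
Local Notation v1 := (@valuation H K1).
Local Notation v2 := (@valuation H K2).

Variables (S : set A) (M : set K1) (y : K1).
Hypotheses (gS : good_subfield pD good S) (hM : closed_hull iota1 s1 M).
Hypotheses (S_M : forall p, S p -> M p.1)
  (S_iota : forall a, M (iota1 a) -> S (piota iota1 iota2 a))
  (S_sec : forall g, M (s1 g) -> S (psec s1 s2 g)).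
Hypotheses (My : M y) (Sy : forall p, S p -> p.1 != y).
Variable q : nat -> A.
Hypotheses (Sq : forall n, S (q n)) (q_onto : forall p, S p -> exists n, q n = p).

Lemma vb_pair p st g : S p -> vb st g p.1 = vb st g p.2.
Proof.
have [_ Sg _ _] := gS => /Sg[->|[a [h [/(lead_val hl1)[n1 v1p] /(lead_val hl2)[n2 v2p]]]]].
  by rewrite !vb0.
by rewrite !vb_neq0 // v1p v2p.
Qed.

Lemma y_neq p : S p -> y - p.1 != 0.
Proof. by move=> /Sy; rewrite subr_eq0 eq_sym. Qed.

(** No element of [S] is a best approximation of [y]: the leading term of [y - p.1] lies in the
    hull, hence comes from [S], and adding it to [p] improves the approximation. *)
Lemma closer p : S p -> exists2 p', S p' & v1 (y - p.1) < v1 (y - p'.1).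
Proof.
move=> Sp; have yp := y_neq Sp; have [a la] := leadP hl1 yp.
have [rS _ _ _] := gS; have [_ SB SM] := rS; have [_ MB _] := ch_subring hM.
have [Ma Ms] := ch_lead hM (MB _ _ My (S_M Sp)) la.
have St := SM _ _ (S_iota Ma) (S_sec Ms).
exists (p + piota iota1 iota2 a * psec s1 s2 (v1 (y - p.1))); first exact: subringD.
have := y_neq (subringD rS Sp St); case: la => _ /=.
by rewrite opprD addrA /vb => /orP[/eqP->|//]; rewrite eqxx.
Qed.

(** Both components satisfy the same approximations by [S] as [y] does, with the radii measured in
    [K1]. By [closer] such a pair is never in [S]. *)
Definition in_balls (z : A) : Prop := forall p, S p ->
  vb false (v1 (y - p.1)) (z.1 - p.1) /\ vb false (v1 (y - p.1)) (z.2 - p.2).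

Lemma in_balls_notin z : in_balls z -> ~ S z.
Proof.
move=> bz Sz; have [p Sp lt] := closer Sz; have [hz _] := bz p Sp.
have := vb_dist (vb_val (y - p.1)) hz.
by rewrite vb_neq0 ?y_neq // oag_leNgt lt.
Qed.

Variables (E : diffFieldType) (f : {rmorphism E -> A}).
Hypotheses (f_der : forall x, f (der x) = pD (f x))
  (f_onto : forall a, S a <-> exists x, f x = a).

Let f1 : {rmorphism E -> K1} := fst \o f.
Let f2 : {rmorphism E -> K2} := snd \o f.

Lemma Sf x : S (f x). Proof. by apply/f_onto; exists x. Qed.

Lemma f1_der x : f1 (der x) = der (f1 x). Proof. by rewrite /f1 /= f_der. Qed.

Lemma f2_der x : f2 (der x) = der (f2 x). Proof. by rewrite /f2 /= f_der. Qed.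

Lemma vb_f x st g : vb st g (f1 x) = vb st g (f2 x).
Proof. exact: vb_pair (Sf x). Qed.

Lemma f_good x : x != 0 -> good (f x).
Proof.
move=> x0; have [_ Sg _ _] := gS; case: (Sg _ (Sf x)) => // fx.
have : f1 x = 0 by rewrite /f1 /= fx.
by move/eqP; rewrite fmorph_eq0 (negPf x0).
Qed.

Lemma val_f x : x != 0 -> v1 (f1 x) = v2 (f2 x).
Proof.
by move=> /f_good[a [g [/(lead_val hl1)[_ e1] /(lead_val hl2)[_ e2]]]]; rewrite /f1 /f2 /= e1 e2.
Qed.

Lemma ev_pair z n (Q : {mpoly E[n]}) :
  ev pD f z Q = ((map_mpoly f1 Q).@[jet z.1], (map_mpoly f2 Q).@[jet z.2]).
Proof.
elim/mpoly_ring_ind: Q => [d|i|p p' hp hp'|p p' hp hp'].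
- by rewrite evC !map_mpolyC !mevalC /f1 /f2 /=; case: (f d).
- by rewrite evX !map_mpolyX !mevalXU iter_pder.
- by rewrite !rmorphD /= hp hp'.
by rewrite !rmorphM /= hp hp'.
Qed.

Lemma steady_f n (Q : {mpoly E[n]}) b e g : e != 0 ->
  steady f1 Q b e g <-> steady f2 Q b e g.
Proof.
by move=> e0; split=> hQ m; have := hQ m; rewrite !mcoeff_map_mpoly vb_f (val_f e0).
Qed.

(** At every pair in the balls, both values of such a [Q] share the leading term of [f e]. This is
    how goodness is obtained without knowing the pair. *)
Definition ok n (Q : {mpoly E[n]}) : Prop := exists b e g,
  [/\ e != 0, vb false g (y - f1 b) & steady f1 Q b e g].

Lemma in_ballsP z b g : in_balls z -> vb false g (y - f1 b) ->
  vb false g (z.1 - f1 b) /\ vb false g (z.2 - f2 b).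
Proof.
move=> bz; have [h1 h2] := bz _ (Sf b); rewrite vb_neq0 ?(y_neq (Sf b)) // => le_g.
by split; [apply: vb_le h1|apply: vb_le h2].
Qed.

Lemma ok_good n (Q : {mpoly E[n]}) z : ok Q -> in_balls z -> good (ev pD f z Q).
Proof.
move=> [b [e [g [e0 yb hQ]]]] bz; have [zb1 zb2] := in_ballsP bz yb.
have [a [h [l1 l2]]] := f_good e0; exists a, h; rewrite ev_pair; split.
  have := steady_eval (hl_mono hl1) f1_der hQ zb1; have [_ ve] := lead_val hl1 l1.
  by rewrite /f1 /= ve; apply: lead_close.
have := steady_eval (hl_mono hl2) f2_der ((steady_f _ _ _ e0).1 hQ) zb2.
by have [_ ve] := lead_val hl2 l2; rewrite /f2 /= ve; apply: lead_close.
Qed.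

Lemma okC n d : d != 0 -> ok (d%:MP : {mpoly E[n]}).
Proof.
move=> d0; exists 0, d, (v1 (y - f1 0)); split; rewrite ?vb_val //.
by rewrite /steady tauC subrr (rmorph0 (map_mpoly f1)); apply: nb0.
Qed.

Lemma ok_widen n (Q : {mpoly E[n]}) : ok Q -> ok (mwiden Q).
Proof.
by move=> [b [e [g [e0 yb hQ]]]]; exists b, e, g; split=> //; apply: steady_widen.
Qed.

Lemma common_ball n (Q : 'I_n.+1 -> {mpoly E[n.+1]}) :
  (forall i, Q i != 0 -> ok (Q i)) -> exists b g e, [/\ vb false g (y - f1 b),
    forall i, e i != 0 & forall i, Q i = 0 \/ steady f1 (Q i) b (e i) g].
Proof.
move=> okQ; have ex i : exists t : E * E * H, [/\ t.1.2 != 0,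
    vb false t.2 (y - f1 t.1.1) & Q i = 0 \/ steady f1 (Q i) t.1.1 t.1.2 t.2].
  have [Q0|/okQ[b [e [g [? ? ?]]]]] := eqVneq (Q i) 0; last first.
    by exists (b, e, g); split=> //; right.
  exists (0, 1, v1 (y - f1 0)); split; [exact: oner_neq0|exact: vb_val|by left].
have {ex} [t ht] := choice ex; have [i0 mini] := oag_argmin (fun i => - (t i).2).
have gi i : (t i).2 <= (t i0).2 by rewrite -oag_leN2.
have [_ b0 _] := ht i0.
exists (t i0).1.1, (t i0).2, (fun i => (t i).1.2); split; first exact: b0.
  by move=> i; have [ei _ _] := ht i; exact: ei.
move=> i; have [_ bi hi] := ht i; case: hi => [Q0|hi]; [by left|right].
apply: (steady_move (hl_mono hl1) f1_der hi _ (gi i)).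
by have := vbB bi (vb_le (gi i) b0); rewrite opprB addrC addrA subrK.
Qed.

Lemma M_ev z n (Q : {mpoly E[n]}) : M z -> M (map_mpoly f1 Q).@[jet z].
Proof.
move=> Mz; have rM := ch_subring hM; have [M1 _ MM] := rM.
elim/mpoly_ring_ind: Q => [d|i|p p' hp hp'|p p' hp hp'].
- by rewrite map_mpolyC mevalC; apply: S_M (Sf d).
- by rewrite map_mpolyX mevalXU /jet; elim: (nat_of_ord i) => //= j; apply: (ch_der hM).
- by rewrite !rmorphD; apply: subringD.
by rewrite !rmorphM; apply: MM.
Qed.


(** The balls around [y] centered in [S] are transported to [K2]. They form a countable family
    because [q] enumerates [S]. *)
Lemma limit_point : exists x', in_balls (y, x').
Proof.
have [|x' hx] := @hl_complete _ _ _ _ _ _ hl2 (fun n => (q n).2) (fun n => v1 (y - (q n).1)).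
  move=> i j le_ij; have [rS _ _ _] := gS; have [_ SB _] := rS.
  have := vb_pair false (v1 (y - (q i).1)) (SB _ _ (Sq j) (Sq i)).
  rewrite [(q j - q i).2]/(_ - _) /= => <-.
  have -> : (q j).1 - (q i).1 = (y - (q i).1) - (y - (q j).1).
    by rewrite [- (y - _)]opprB [RHS]addrC addrA subrK.
  exact: vbB (vb_val _) (vb_le le_ij (vb_val _)).
exists x' => p /q_onto[n <-]; split=> //=; exact: vb_val.
Qed.

Lemma adjoin_point z (T : set A) : in_balls z -> subring T -> (forall x, T (f x)) -> T z ->
  good_subfield pD good (frac good T) -> (forall p, T p -> M p.1) ->
  exists S', [/\ good_subfield pD good S', S `<=` S', forall p, S' p -> M p.1 &
    exists2 p, S' p & ~ S p].
Proof.
move=> bz rT Tf Tz gF TM; have TF := sub_frac (pgood_natr hl1 hl2) rT.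
exists (frac good T); split=> //.
- by move=> _ /f_onto[x <-]; apply/TF/Tf.
- move=> _ [a [b [Ta Tb gb ->]]]; have [b1 b2] := pgood_neq0 hl1 hl2 gb.
  have [_ _ MM] := ch_subring hM.
  by rewrite pairV //=; apply: MM; [apply: TM|apply: (ch_inv hM); apply: TM].
by exists z; [apply: TF|apply: in_balls_notin].
Qed.

Let hy (b : E) := v1 (y - f1 b).

Lemma hy_neq b : y - f1 b != 0. Proof. exact: y_neq (Sf b). Qed.

Lemma limit_bad_root x' r (P : {mpoly E[r.+1]}) :
  in_balls (y, x') -> ~ ok P -> P^`M(ord_max) != 0 ->
  (forall i, P^`M(i) != 0 -> ok P^`M(i)) ->
  exists2 z : A, in_balls z & M z.1 /\ ev pD f z P = 0.
Proof.
move=> bx badP dP okD; have [b [g [e [yb e0 hQ]]]] := common_ball okD.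
(* A vanishing derivative is given the value attached to the separant, so that the least value is
   attained at some nonvanishing derivative. *)
pose e' i := if P^`M(i) == 0 then e ord_max else e i.
have e'0 i : e' i != 0 by rewrite /e'; case: ifP.
have hQ' i : P^`M(i) = 0 \/ steady f1 P^`M(i) b (e' i) g.
  by rewrite /e'; case: eqP => [|_]; [left|exact: hQ].
have [j minj] := oag_argmin (fun i => v1 (f1 (e' i))).
have [i0 di0 mini] : exists2 i0, P^`M(i0) != 0 & forall i, v1 (f1 (e' i0)) <= v1 (f1 (e' i)).
  have [dj|dj] := eqVneq P^`M(j) 0; last by exists j.
  exists ord_max => // i; apply: le_trans (minj i).
  by rewrite {2}/e' dj eqxx /e' (negPf dP).
have unst b' d : d != 0 -> ~ steady f1 P b' d (hy b').
  by move=> d0 st; apply: badP; exists b', d, (hy b'); split=> //; apply: vb_val.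
have gb : g <= hy b by move: yb; rewrite vb_neq0 ?hy_neq.
have bp b' : vb false (hy b') (x' - f2 b') by have [] := bx _ (Sf b').
have hQ2 i : P^`M(i) = 0 \/ steady f2 P^`M(i) b (e' i) g.
  by case: (hQ' i) => [->|/steady_f-/(_ (e'0 i))]; [left|right].
have min2 i : v2 (f2 (e' i0)) <= v2 (f2 (e' i)) by rewrite -!val_f.
have unst2 b' d : d != 0 -> ~ steady f2 P b' d (hy b').
  by move=> d0 /steady_f-/(_ d0); apply: unst.
(* If [y] is not a root itself, Newton approximation finds one in all the balls, and closure of the
   hull under roots lets it be taken in [M]. *)
have [z1 Mz1 [z1b z1P]] : exists2 z1, M z1 &
    (forall b', vb false (hy b') (z1 - f1 b')) /\ (map_mpoly f1 P).@[jet z1] = 0.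
  have [yP|yP] := eqVneq (map_mpoly f1 P).@[jet y] 0.
    by exists y => //; split=> // b'; apply: vb_val.
  have far := limit_far (hl_mono hl1) f1_der e'0 mini di0 hQ' gb (fun b' => vb_val _) unst yP.
  have rt := limit_root (hl_mono hl1) f1_der e'0 mini di0 hQ' (hl_hens hl1) yb yP
    (le_trans gb (far b)).
  have [MS1 _ MM] := ch_subring hM.
  have Ma : M ((map_mpoly f1 P).@[jet y] / f1 (e' i0)).
    by apply: MM; [apply: M_ev|apply: (ch_inv hM); apply: S_M (Sf _)].
  have MP m : M (map_mpoly f1 P)@_m by rewrite mcoeff_map_mpoly; apply: S_M (Sf _).
  have [z Mz [zy Pz]] := ch_root hM MP My Ma rt.
  exists z => //; split=> // b'; rewrite -(subrK y z) -addrA; apply: vbD; last exact: vb_val.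
  exact: vb_le (far b') zy.
have [z2 z2b z2P] : exists2 z2, (forall b', vb false (hy b') (z2 - f2 b')) &
    (map_mpoly f2 P).@[jet z2] = 0.
  have [yP|yP] := eqVneq (map_mpoly f2 P).@[jet x'] 0; first by exists x'.
  have far := limit_far (hl_mono hl2) f2_der e'0 min2 di0 hQ2 gb bp unst2 yP.
  have xb : vb false g (x' - f2 b) by apply: vb_le gb (bp b).
  have [z zx Pz] := limit_root (hl_mono hl2) f2_der e'0 min2 di0 hQ2 (hl_hens hl2) xb yP
    (le_trans gb (far b)).
  exists z => // b'; rewrite -(subrK x' z) -addrA; apply: vbD; last exact: bp.
  exact: vb_le (far b') zx.
exists (z1, z2); last by split=> //; rewrite ev_pair z1P z2P.
by move=> p /f_onto[b' <-]; split; [apply: z1b|apply: z2b].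
Qed.

(** If every nonzero polynomial is [ok], the pair [(y, x')] generates the extension. Otherwise a
    pair of roots of a minimal exception does. The latter may avoid [y], but a pair in all the balls
    lies outside [S], and a proper extension is all that is claimed. *)
Lemma extend_inside : exists S', [/\ good_subfield pD good S', S `<=` S',
  forall p, S' p -> M p.1 & exists2 p, S' p & ~ S p].
Proof.
have [x' bx] := limit_point.
have gu := pgood_unit hl1 hl2; have gM := pgoodM hl1 hl2; have gV := pgoodV hl1 hl2.
have gn := pgood_natr hl1 hl2.
have [|nobad] := pselect (exists n (P : {mpoly E[n]}), P != 0 /\ ~ ok P); last first.
  apply: (adjoin_point (T := \bigcup_n evs pD f (y, x') n) bx).
  - exact: evs_union_subring.
  - by move=> x; exists 0%N => //; exists x%:MP => //; rewrite evC.
  - by exists 1%N => //; exists 'X_ord0; rewrite ?evX.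
  - apply: (generated_transcendental (@pderD _ _ _) (@pderM _ _ _) gu gM gV gn f_der).
    move=> n Q; have [->|Q0] := eqVneq Q 0; first by left; rewrite rmorph0.
    right; apply: ok_good bx; apply: contrapT => nQ; apply: nobad; exists n, Q.
    by split.
  by move=> _ [n _ [Q _ <-]]; rewrite ev_pair; apply: M_ev.
move=> /minimal_polynomial[n d|n P|r [P [badP sP okI okQ okD]]].
- exact: okC.
- exact: ok_widen.
have dP0 : P^`M(ord_max) != 0 by rewrite -muni_eq0 muni_deriv_last deriv_neq0.
have [z bz [Mz zP]] := limit_bad_root bx badP dP0 okD.
apply: (adjoin_point (T := evs pD f z r.+1) bz).
- exact: evs_subring.
- by move=> x; exists x%:MP => //; rewrite evC.
- by exists 'X_ord0; rewrite ?evX.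
- apply: (generated_algebraic (@pderD _ _ _) (@pderM _ _ _) gu gM gV gn f_der zP sP).
    by move=> I0 /okI oI; apply: ok_good bz.
  by move=> Q Q0 /(okQ _ Q0) oQ; apply: ok_good bz.
by move=> _ [Q _ <-]; rewrite ev_pair; apply: M_ev.
Qed.

End ExtendInside.

(** * Extension steps and transfer of formulas *)

Section ForthStep.
Variables (k : diffFieldType) (H : oagType) (c : H -> k).
Variables (K1 K2 : valuedDiffFieldType H).
Variables (iota1 : {rmorphism k -> K1}) (s1 : H -> K1).
Variables (iota2 : {rmorphism k -> K2}) (s2 : H -> K2).
Hypotheses (hl1 : hahn_like c iota1 s1) (hl2 : hahn_like c iota2 s2).
Local Notation A := (K1 * K2)%type.
Local Notation good := (pgood iota1 s1 iota2 s2).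
Local Notation pD := (@pder H K1 K2).

Definition countable_iso (S : set A) : Prop :=
  partial_iso iota1 s1 iota2 s2 S /\ exists e : nat -> A, S `<=` range e.

Lemma forth S y : countable_iso S ->
  exists S', [/\ countable_iso S', S `<=` S' & exists2 p, S' p & p.1 = y].
Proof.
move=> [pS [e Se]].
have [e1 [e1e hM]] := countable_hull hl1 (fun n => if n is n'.+1 then (e n').1 else y).
set M := range e1 in hM; have rM := ch_subring hM; have [M1 MB MM] := rM.
have My : M y by have [m em] := e1e 0%N; exists m.
have SM p : S p -> M p.1.
  by move=> /Se[n _ <-]; have [m em] := e1e n.+1; exists m.
have [S1 [gS1 SS1 S1i S1s]] := adjoin_all hl1 hl2 pS.
have [[T1 TB TM] Tg TV TD] := gS1.
(* [S1] contains every [piota a] and [psec g]. Restricting to [M] keeps those whose first component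
   lies in the hull, which by [ch_lead] covers the leading terms that can occur. *)
pose S2 := S1 `&` [set p | M p.1].
have gS2 : good_subfield pD good S2.
  split; first split.
  - by [].
  - by move=> p q [Sp Mp] [Sq Mq]; split; [apply: TB|apply: MB].
  - by move=> p q [Sp Mp] [Sq Mq]; split; [apply: TM|apply: MM].
  - by move=> p [Sp _]; apply: Tg.
  - move=> p [Sp Mp] gp; split; first exact: TV.
    by have [n1 n2] := pgood_neq0 hl1 hl2 gp; rewrite /= pairV //=; apply: (ch_inv hM).
  by move=> p [Sp Mp]; split; [apply: TD|apply: (ch_der hM)].
have [S3 [gS3 S23 S3M maxS]] := max_good_subfield (W := [set p | M p.1]) gS2 (@subIsetr _ _ _).
have S3i a : M (iota1 a) -> S3 (piota iota1 iota2 a) by move=> Ma; apply: S23.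
have S3s g : M (s1 g) -> S3 (psec s1 s2 g) by move=> Ma; apply: S23.
have [[U1 UB UM] Ug _ _] := gS3.
have inj p q : S3 p -> S3 q -> p.1 = q.1 -> p = q.
  move=> Sp Sq pq; apply/eqP; rewrite -subr_eq0; apply/eqP.
  case: (Ug _ (UB _ _ Sp Sq)) => // /(pgood_neq0 hl1 hl2)[/eqP[]].
  by rewrite /= pq subrr.
(* A pair in [S3] is determined by its first component, so the enumeration of the hull enumerates
   [S3]. Where [e1 n] is not a first component, [q n] is 0. *)
pose q n := xget 0 [set p | S3 p /\ p.1 = e1 n].
have qP p n : S3 p -> p.1 = e1 n -> q n = p.
  move=> Sp en; have [Sq qn] : S3 (q n) /\ (q n).1 = e1 n.
    exact: (xgetI 0 (P := [set p | S3 p /\ p.1 = e1 n]) (x := p)).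
  by apply: inj => //; rewrite qn.
have Sq n : S3 (q n).
  rewrite /q; case: xgetP => [p -> []//|_]; exact: subring0 (And3 U1 UB UM).
have qS p : S3 p -> exists n, q n = p.
  by move=> Sp; have [n _ en] := S3M _ Sp; exists n; apply: qP.
exists S3; split.
- split; last by exists q => p /qS[n <-]; exists n.
  split=> // p a g Sp [l1 _]; have [Ma Mg] := ch_lead hM (S3M _ Sp) l1.
  by split; [apply: S3i|apply: S3s].
- by move=> p Sp; apply: S23; split; [apply: SS1|apply: SM].
apply: contrapT => no.
have S3y p : S3 p -> p.1 != y by move=> Sp; apply/eqP => py; apply: no; exists p.
have [E [f [f_der _ f_onto]]] := good_subfield_type (@pderD _ _ _) (@pderM _ _ _)
  (pgood_unit hl1 hl2) (pgood_natr hl1 hl2) gS3.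
have [S' [gS' SS' S'M [p S'p nSp]]] := extend_inside hl1 hl2 gS3 hM S3M S3i S3s My S3y Sq qS
  f_der f_onto.
by apply: nSp; apply: maxS gS' SS' S'M _ S'p.
Qed.

(** By minimality the prime field lies in the image of [piota]. The leading term of [piota b] is [b]
    at value 0, so closure under leading terms is automatic. *)
Lemma prime_iso : exists S, countable_iso S.
Proof.
have gu := pgood_unit hl1 hl2; have gM := pgoodM hl1 hl2; have gV := pgoodV hl1 hl2.
have gN := @pgoodN k H K1 K2 iota1 s1 iota2 s2; have gn := pgood_natr hl1 hl2.
have [S0 [gS0 minS eS]] := prime_good_subfield (@pderD _ _ _) (@pderM _ _ _) gu gM gV gN gn.
exists S0; split=> //; split=> // p a g Sp lp.
have /(_ p Sp)[b _ eb] : S0 `<=` range (piota iota1 iota2).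
  apply: minS; split; first split.
  - by exists 1; rewrite ?piota1.
  - by move=> _ _ [b _ <-] [d _ <-]; exists (b - d); rewrite // piotaD piotaN.
  - by move=> _ _ [b _ <-] [d _ <-]; exists (b * d); rewrite // piotaM.
  - move=> _ [b _ <-]; have [->|b0] := eqVneq b 0; first by left; rewrite piota0.
    by right; exists b, 0; apply: (plead_iota hl1 hl2).
  - move=> _ [b _ <-] /(pgood_neq0 hl1 hl2)[+ _]; rewrite /= fmorph_eq0 => b0.
    by exists b^-1 => //; rewrite piotaV.
  by move=> _ [b _ <-]; exists (der b) => //; rewrite (pder_iota hl1 hl2).
case: lp => lp _; have b0 : b != 0.
  by have [+ _] := lead_val hl1 lp; rewrite -eb /= fmorph_eq0.
have [-> ->] : a = b /\ g = 0.
  by apply: (lead_inj hl1 lp); rewrite -eb; apply: (lead_iota hl1).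
by rewrite eb (psec0 hl1 hl2); split=> //; have [[]] := gS0.
Qed.

End ForthStep.

Section SwapIso.
Variables (k : diffFieldType) (H : oagType) (c : H -> k).
Variables (K1 K2 : valuedDiffFieldType H).
Variables (iota1 : {rmorphism k -> K1}) (s1 : H -> K1).
Variables (iota2 : {rmorphism k -> K2}) (s2 : H -> K2).
Hypotheses (hl1 : hahn_like c iota1 s1) (hl2 : hahn_like c iota2 s2).
Local Notation A := (K1 * K2)%type.

Lemma countable_iso_swap S : countable_iso iota1 s1 iota2 s2 S ->
  countable_iso iota2 s2 iota1 s1 [set p : K2 * K1 | S (p.2, p.1)].
Proof.
move=> [[[[T1 TB TM] Tg TV TD] Tl] [e Se]].
have gswap p : pgood iota2 s2 iota1 s1 p <-> pgood iota1 s1 iota2 s2 (p.2, p.1).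
  by split=> -[a [g [l1 l2]]]; exists a, g.
split; last first.
  by exists (fun n => ((e n).2, (e n).1)) => -[p1 p2] /Se[n _ en]; exists n => //; rewrite en.
split; first split; first split.
- by [].
- by move=> p q Sp Sq; apply: TB Sp Sq.
- by move=> p q Sp Sq; apply: TM Sp Sq.
- move=> [p1 p2] /Tg[[-> ->]|gp]; [by left|right].
  by apply/gswap.
- move=> [p1 p2] Sp gp /=; have [n2 n1] := pgood_neq0 hl2 hl1 gp.
  by rewrite pairV //=; move/gswap/(TV _ Sp): gp; rewrite pairV.
- by move=> p /TD.
move=> p a g Sp [l2 l1].
by apply: (Tl (p.2, p.1) a g Sp); split.
Qed.

End SwapIso.

Section BackAndForth.
Variables (k : diffFieldType) (H : oagType) (c : H -> k).
Variables (K1 K2 : valuedDiffFieldType H).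
Variables (iota1 : {rmorphism k -> K1}) (s1 : H -> K1).
Variables (iota2 : {rmorphism k -> K2}) (s2 : H -> K2).
Hypotheses (hl1 : hahn_like c iota1 s1) (hl2 : hahn_like c iota2 s2).
Local Notation A := (K1 * K2)%type.

Lemma back S x : countable_iso iota1 s1 iota2 s2 S -> exists S',
  [/\ countable_iso iota1 s1 iota2 s2 S', S `<=` S' & exists2 p, S' p & p.2 = x].
Proof.
move=> /(countable_iso_swap hl1 hl2)/(forth hl2 hl1 x)[S' [cS' SS' [p Sp px]]].
exists [set p | S' (p.2, p.1)]; split.
- exact: (countable_iso_swap hl2 hl1 cS').
- by move=> -[p1 p2] Sp'; apply: SS'.
by exists (p.2, p.1) => //=; case: p Sp px.
Qed.

Lemma eval_iso S n (t : term n) (e : 'I_n -> A) : partial_iso iota1 s1 iota2 s2 S ->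
  (forall i, S (e i)) -> S (eval (fun i => (e i).1) t, eval (fun i => (e i).2) t).
Proof.
move=> [[[T1 TB TM] Tg TV TD] _] Se; have rT : subring S by [].
elim: t => [i|||t IHt u IHu|t IHt|t IHt u IHu|t IHt] /=.
- by have := Se i; case: (e i).
- exact: (subring0 rT).
- exact: T1.
- exact: (subringD rT IHt IHu).
- exact: (subringN rT IHt).
- exact: (TM _ _ IHt IHu).
exact: (TD _ IHt).
Qed.

Lemma holds_iso n (phi : formula n) (S : set A) (e : 'I_n -> A) :
  countable_iso iota1 s1 iota2 s2 S -> (forall i, S (e i)) ->
  holds phi (fun i => (e i).1) <-> holds phi (fun i => (e i).2).
Proof.
elim: n / phi S e => [n t u|n t|n|n phi IH psi IH'|n phi IH] S e cS Se /=.
- have [[rT Tg _ _] _] := cS.1; have [_ TB _] := rT.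
  have := TB _ _ (eval_iso t cS.1 Se) (eval_iso u cS.1 Se).
  move=> /Tg[[/eqP + /eqP]|/(pgood_neq0 hl1 hl2)[]] /=; rewrite !subr_eq0.
    by move=> /eqP -> /eqP ->.
  by move=> /eqP h1 /eqP h2.
- have [[rT Tg _ _] _] := cS.1.
  have := eval_iso t cS.1 Se; set p := (_, _) => Sp.
  rewrite -[eval _ t in X in X <-> _]/(p.1) -[eval _ t in X in _ <-> X]/(p.2).
  case: (Tg _ Sp) => [->|[a [g [/(lead_val hl1)[n1 e1] /(lead_val hl2)[n2 e2]]]]].
    by rewrite !inE !eqxx.
  by rewrite !inE e1 e2 (negPf n1) (negPf n2).
- by [].
- by split=> h /(IH _ _ cS Se)/h/(IH' _ _ cS Se).
have env p : (fun i => (oapp e p (unlift ord0 i)).1) = env_cons p.1 (fun i => (e i).1) /\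
    (fun i => (oapp e p (unlift ord0 i)).2) = env_cons p.2 (fun i => (e i).2).
  by split; apply: funext => i; rewrite /env_cons; case: unlift.
have ext S' p : S `<=` S' -> S' p -> forall i, S' (oapp e p (unlift ord0 i)).
  by move=> SS' Sp i; case: unliftP => [j _|_] //=; apply: SS'.
split=> h x.
  have [S' [cS' SS' [p Sp <-]]] := back x cS.
  have := IH S' _ cS' (ext S' p SS' Sp); have [-> ->] := env p.
  by move=> [hp _]; exact: hp (h _).
have [S' [cS' SS' [p Sp <-]]] := forth hl1 hl2 x cS.
have := IH S' _ cS' (ext S' p SS' Sp); have [-> ->] := env p.
by move=> [_ hp]; exact: hp (h _).
Qed.

Lemma hahn_like_equiv : elem_equiv K1 K2.
Proof.
move=> phi; have [S cS] := prime_iso hl1 hl2.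
pose e (i : 'I_0) : A := 0.
have h := holds_iso phi (e := e) cS (fun i => match notF (ltn_ord i) with end).
by split=> m e'; [have := h.1 (m _)|have := h.2 (m _)];
  congr holds; apply: funext => -[].
Qed.

End BackAndForth.

(** * Hahn fields *)

Definition sph_complete (G : oagType) (K : valuedFieldType G) : Prop :=
  forall C : set (K * G),
    (forall p q, C p -> C q -> p.2 <= q.2 -> vb false p.2 (q.1 - p.1)) ->
    exists x, forall p, C p -> vb false p.2 (x - p.1).

Lemma sph_ball_complete (G : oagType) (K : valuedFieldType G) :
  sph_complete K -> ball_complete K.
Proof.
move=> sph b g bg; have [|x hx] := sph (range (fun n => (b n, g n))).
  by move=> _ _ [i _ <-] [j _ <-]; apply: bg.
by exists x => i; apply: (hx (b i, g i)); exists i.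
Qed.

Section Twist.
Variables (k : diffFieldType) (g : k).

(* The coefficients of the operator [(der + g)^i]. *)
Fixpoint twist (i l : nat) : k :=
  if i is i'.+1 then
    der (twist i' l) + g * twist i' l + (if l is l'.+1 then twist i' l' else 0)
  else (l == 0%N)%:R.

Lemma twist_gt i l : (i < l)%N -> twist i l = 0.
Proof.
elim: i l => [|i IH] [|l] //= il; rewrite (IH l) // IH; last exact: leqW.
by rewrite der0 mulr0 !addr0.
Qed.

Lemma twist_diag i : twist i i = 1.
Proof. by elim: i => //= i IH; rewrite twist_gt // der0 mulr0 !add0r. Qed.

Lemma twistE i n u : (i < n)%N ->
  iter i (fun w => der w + g * w) u = \sum_(l < n) twist i l * iter l der u.
Proof.
elim: i => [|i IH] i_n /=.
  case: n i_n => // n _; rewrite big_ord_recl /= mul1r big1 ?addr0 // => l _.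
  by rewrite mul0r.
rewrite IH; last exact: ltnW.
rewrite der_sum mulr_sumr -big_split /=.
under [LHS]eq_bigr do rewrite derM mulrA addrAC -mulrDl.
under [RHS]eq_bigr do rewrite mulrDl.
rewrite big_split [RHS]big_split; congr (_ + _).
case: n i_n {IH} => // n i_n; rewrite big_ord_recr [RHS]big_ord_recl /= mul0r add0r.
by rewrite twist_gt // mul0r addr0.
Qed.

(** The power [i] of [der + g] has order [i] and leading coefficient 1. A nonzero combination of
    these powers is therefore a nonzero operator in [der], to which linear surjectivity applies. *)
Lemma twist_solve : linearly_surjective k -> forall n (q : 'I_n -> k) r,
  (exists i, q i != 0) -> exists u,
  \sum_i q i * iter i (fun w => der w + g * w) u = r.
Proof.
move=> lin n q r [i0]; case: n q i0 => [|n] q i0 qi0; first by case: i0 {qi0}.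
pose a (l : 'I_n.+1) := \sum_i q i * twist i l.
have [|u hu] := lin n a _ r.
  case: (@arg_maxnP _ i0 (fun i => q i != 0) (fun i => i) qi0) => j qj maxj.
  exists j; rewrite /a (bigD1 j) //= twist_diag mulr1 big1 ?addr0 // => i ij.
  have [ji|le_ij] := ltnP j i; last by rewrite twist_gt ?mulr0 // ltn_neqAle ij.
  have [->|qi] := eqVneq (q i) 0; first by rewrite mul0r.
  by have := maxj i qi; rewrite /= leqNgt ji.
exists u; rewrite -hu; under eq_bigr => i _ do rewrite (twistE u (ltn_ord i)) mulr_sumr.
rewrite exchange_big; apply: eq_bigr => l _; rewrite /a mulr_suml.
by apply: eq_bigr => i _; rewrite mulrA.
Qed.

End Twist.

Section SphericalHensel.
Variables (k : diffFieldType) (H : oagType) (c : H -> k) (K : valuedDiffFieldType H).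
Variables (iota : {rmorphism k -> K}) (s : H -> K).
Hypotheses (fr : hahn_frame c iota s) (sph : sph_complete K) (lin : linearly_surjective k).
Local Notation v := (@valuation H K).

Lemma iter_der_term u g i :
  iter i der (iota u * s g) = iota (iter i (fun w => der w + c g * w) u) * s g.
Proof.
elim: i => //= i ->; rewrite derM -(hl_der fr) (hl_sder fr) rmorphD rmorphM mulrDl.
by congr (_ + _); rewrite mulrA [_ * iota (c g)]mulrC.
Qed.

Lemma tau_lin_part (R : comNzRingType) n (P : {mpoly R[n]}) h :
  tau h (lin_part P) = lin_part P + ((lin_part P).@[h])%:MP.
Proof.
rewrite /lin_part (big_morph _ (tauD h) (tau0 h)) (raddf_sum (meval h)).
rewrite (raddf_sum (@mpolyC n R)) -big_split; apply: eq_bigr => i _ /=.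
by rewrite -!mul_mpolyC tauM tauC tauX mulrDr mevalM mevalC mevalXU mpolyCM.
Qed.

Lemma lin_dom_tau n (P : {mpoly K[n]}) y : lin_dom 0 0 P -> vb false 0 y ->
  lin_dom 0 0 (tau (jet y) P).
Proof.
move=> dom y0; have [N defP nN] := lin_dom_split dom; rewrite addr0 in nN.
have nN' : nb true 0 0 (tau (jet y) N).
  by apply: nb_tau nN _ => i; apply: (vb_iter (hl_mono fr)).
have cN m : vb true 0 (tau (jet y) N)@_m by have := nN' m; rewrite mul0rn subr0.
have coef m : m != 0%MM -> (tau (jet y) P)@_m = (lin_part P)@_m + (tau (jet y) N)@_m.
  move=> m0; rewrite {1}defP !tauD tauC tau_lin_part !mcoeffD !mcoeffC.
  by rewrite (negPf m0) !mulr0 add0r addr0.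
have U0 i : U_(i)%MM != 0%MM :> 'X_{1..n} by rewrite -mdeg_eq0 mdeg1.
case: dom => _ lQ [i0 hi0]; split=> [m m1|i|].
- have m0 : m != 0%MM by rewrite -mdeg_eq0; case: (mdeg m) m1.
  rewrite addr0 mul0rn subr0 coef // lin_part_coef; case: eqP m1 => [->//|_ _].
  by rewrite add0r.
- by rewrite coef // lin_part_coef mdeg1 eqxx; apply: vbD => //; apply: vbW.
exists i0; apply: contra hi0; rewrite coef // lin_part_coef mdeg1 eqxx => h.
by rewrite -[X in vb _ _ X](addrK (tau (jet y) N)@_(U_(i0))) vbB.
Qed.

Lemma lin_dom_nb n (P : {mpoly K[n]}) : lin_dom 0 0 P -> vb false 0 P@_0 -> nb false 0 0 P.
Proof.
move=> [hm lm _] P0 m; rewrite mul0rn subr0.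
have [m1|] := ltnP 1 (mdeg m).
  by have := hm m m1; rewrite addr0 mul0rn subr0; apply: vbW.
by rewrite leq_eqVlt ltnS leqn0 => /orP[/mdeg1P[i /eqP ->]//|]; rewrite mdeg_eq0 => /eqP ->.
Qed.

Lemma eval_near n (P : {mpoly K[n]}) g y z : nb false 0 0 P -> vb false 0 y -> 0 <= g ->
  vb false g (z - y) -> vb false g (P.@[jet z] - P.@[jet y]).
Proof.
move=> nP y0 g0 zy; have -> : P.@[jet z] - P.@[jet y] =
    (tau (jet y) P - (P.@[jet y])%:MP).@[jet (z - y)].
  rewrite mevalB mevalC tau_eval; congr (_ - _).
  by apply: meval_eq => i; rewrite /jet -iter_derD subrK.
apply: (@nb_eval _ _ _ _ g) => [m|i]; last exact: (vb_iter (hl_mono fr)).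
have := nb_tau nP (fun i : 'I_n => vb_iter (hl_mono fr) i y0) m.
rewrite mul0rn subr0 mcoeffB mcoeffC; have [->|m0] := eqVneq m 0%MM.
  by rewrite tau_coef0 mulr1 subrr vb0.
rewrite mulr0 subr0; apply: vb_le.
have : (0 < mdeg m)%N by rewrite lt0n mdeg_eq0.
by case: (mdeg m) => // d _; rewrite mulrS opprD addrA subrr add0r -oppr0 oag_leN2 -(mul0rn _ d) oag_leMn.
Qed.

Lemma lin_dom_wt n g h b (P : {mpoly K[n]}) : g <= h -> lin_dom g b P -> lin_dom h b P.
Proof.
move=> gh [hm lm um]; split=> // m m1; apply: vb_le (hm m m1).
rewrite -!addrA oag_leD2l; case: (mdeg m) m1 => // d _.
by rewrite !mulrS !opprD !addrA !subrr !add0r oag_leN2 oag_leMn.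
Qed.

(** With [g] the value of [P(y)], the correction is [iota u * s g]. On such terms the linear part of
    [P] at [y] acts, up to smaller terms, as a nonzero operator in [der + c g] on [u], and [u] is
    chosen so that its value cancels the leading coefficient of [P(y)]. *)
Lemma improve_root n (P : {mpoly K[n]}) y : lin_dom 0 0 P -> vb false 0 P@_0 ->
  vb false 0 y -> P.@[jet y] != 0 ->
  exists2 z, vb false (v P.@[jet y]) (z - y) & vb true (v P.@[jet y]) P.@[jet z].
Proof.
move=> dom P0 y0 r0; set r := P.@[jet y] in r0 *; set g := v r.
have nP := lin_dom_nb dom P0.
have g0 : 0 <= g.
  have : vb false 0 r by apply: nb_eval nP _ => i; apply: (vb_iter (hl_mono fr)).
  by rewrite vb_neq0.
have dom0 := lin_dom_tau dom y0; have domg := lin_dom_wt g0 dom0.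
have Q0 : (tau (jet y) P)@_0 = r by rewrite tau_coef0.
have QE h : P.@[jet (y + h)] = (tau (jet y) P).@[jet h].
  by rewrite tau_eval; apply: meval_eq => i; rewrite /jet -iter_derD addrC.
move: (tau (jet y) P) QE Q0 dom0 domg => Q QE Q0 dom0 domg.
have [N defQ nN] := lin_dom_split domg; rewrite add0r in nN.
have [a la] := leadP fr r0; case: la => _ la.
have ex i : exists a, vb true 0 (Q@_(U_(i)) - iota a).
  by case: dom0 => _ lm _; apply: (hl_residue fr).
have {ex} [q hq] := choice ex.
have [|u hu] := twist_solve (c g) lin (q := q) (- a).
  case: dom0 => _ _ [i0 hi0]; exists i0; apply: contraNneq hi0 => qi.
  by have := hq i0; rewrite qi rmorph0 subr0.
have vh : vb false g (iota u * s g).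
  have := vbM (vb_iota fr u) (vb_val (s g)).
  by rewrite add0r (hl_val fr).
exists (y + iota u * s g); first by rewrite addrC addKr.
set h := _ * _ in vh *; rewrite QE defQ !mevalD mevalC Q0 /lin_part (raddf_sum (meval _)) /=.
apply: vbD; last by apply: nb_eval nN _ => i; apply: (vb_iter (hl_mono fr)).
have -> : r + \sum_i (Q@_(U_(i)) *: 'X_i).@[jet h] = (r - iota a * s g) +
    \sum_i (Q@_(U_(i)) - iota (q i)) * iter i der h.
  have -> : \sum_i (Q@_(U_(i)) - iota (q i)) * iter i der h =
      \sum_i (Q@_(U_(i)) *: 'X_i).@[jet h] - \sum_i iota (q i) * iter i der h.
    by rewrite -sumrB; apply: eq_bigr => i _; rewrite mevalZ mevalXU mulrBl.
  have -> : \sum_i iota (q i) * iter i der h = - (iota a * s g).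
    rewrite -mulNr -rmorphN -hu rmorph_sum mulr_suml; apply: eq_bigr => i _.
    by rewrite iter_der_term rmorphM mulrA.
  by rewrite opprK addrACA addNr addr0.
apply: vbD => //; apply: vb_sum => i _.
by have := vbM (hq i) (vb_iter (hl_mono fr) i vh); rewrite add0r.
Qed.

(** Zorn's lemma is applied to integral approximate roots ordered by the value of [P]. The order
    also asks that [z] be within [d y] of [y], so a chain gives nested balls, and a common point
    bounds it. A maximal element contradicts [improve_root]. *)
Lemma sph_hens : hens K.
Proof.
move=> n P dom P0; apply: contrapT => noroot.
have nz y : vb false 0 y -> P.@[jet y] != 0.
  by move=> y0; apply/eqP => Py; apply: noroot; exists y.
have nP := lin_dom_nb dom P0.
pose T := {y : K | vb false 0 y}.
pose d (y : T) := v P.@[jet (val y)].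
have d0 y : 0 <= d y.
  have : vb false 0 P.@[jet (val y)].
    by apply: nb_eval nP _ => i; apply: (vb_iter (hl_mono fr)); apply: (valP y).
  by rewrite vb_neq0 // nz // (valP y).
pose le (y z : T) := y = z \/ (d y < d z /\ vb false (d y) (val z - val y)).
have [||||t maxt] := @Zorn T (fun y z => `[< le y z >]).
- by move=> y; apply/asboolP; left.
- move=> x y z /asboolP[->//|[dxy xy]] /asboolP[<-|[dyz yz]]; apply/asboolP; right=> //.
  split; first exact: lt_trans dyz.
  rewrite -(subrK (val y) (val z)) -addrA; apply: vbD => //.
  exact: vb_le (ltW dxy) yz.
- move=> x y /asboolP[//|[dxy _]] /asboolP[//|[dyx _]].
  by have := lt_trans dxy dyx; rewrite ltxx.
- move=> C totC.
  have [[t Ct tC]|nmax] := pselect (exists2 t, C t & forall y, C y -> le y t).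
    by exists t => y Cy; apply/asboolP/tC.
  have next y : C y -> exists2 z, C z & d y < d z.
    move=> Cy; apply: contrapT => nz'; apply: nmax; exists y => // z Cz.
    case: (totC y z Cy Cz) => /asboolP // -[->|[lt _]]; first by left.
    by case: nz'; exists z.
  have [[y0 Cy0]|C0] := pselect (exists y, C y); last first.
    have t0 : T by exists 0; exact: vb0.
    by exists t0 => y Cy; case: C0; exists y.
  have [|x hx] := sph (C := [set (val y, d y) | y in C]).
    move=> _ _ [y Cy <-] [z Cz <-] /= le_yz.
    case: (totC y z Cy Cz) => /asboolP[->|[lt h]]; rewrite ?subrr ?vb0 //.
    by move: le_yz; rewrite oag_leNgt lt.
  have {}hx y : C y -> vb false (d y) (x - val y) by move=> Cy; apply: (hx (val y, d y)); exists y.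
  have x0 : vb false 0 x.
    rewrite -(subrK (val y0) x); apply: vbD; last exact: (valP y0).
    exact: vb_le (d0 y0) (hx _ Cy0).
  pose x' : T := exist _ x x0.
  have dx y : C y -> d y <= d x'.
    move=> Cy; have : vb false (d y) P.@[jet x].
      rewrite -(subrK P.@[jet (val y)] P.@[jet x]); apply: vbD; last exact: vb_val.
      by apply: eval_near; rewrite ?(valP y) ?hx.
    by rewrite vb_neq0 // nz.
  exists x' => y Cy; apply/asboolP; right; split; last exact: hx.
  by have [z Cz lt] := next y Cy; apply: lt_le_trans (dx z Cz).
have [z zt Pz] := improve_root dom P0 (valP t) (nz _ (valP t)).
have z0 : vb false 0 z.
  rewrite -(subrK (val t) z); apply: vbD; last exact: (valP t).
  exact: vb_le (d0 t) zt.
pose z' : T := exist _ z z0.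
have lt : d t < d z' by move: Pz; rewrite vb_neq0 ?nz.
have /maxt e : `[< le t z' >] by apply/asboolP; right.
by move: lt; rewrite e ltxx.
Qed.

End SphericalHensel.

Section HahnFrame.
Variables (k : diffFieldType) (H : oagType) (c : {additive H -> k}).
Local Notation K := (hahn_c c).
Implicit Types (f : K) (a : k) (g : H).

Lemma vb_hahnP s g f : reflect
  (forall x, (if s then x <= g else x < g) -> (f : hahn k H) x = 0) (vb s g f).
Proof.
rewrite /vb; have [->|f0] /= := eqVneq f 0; first by apply: ReflectT.
have [fv minv] := hvalP f0; rewrite -[valuation f]/(hval f).
apply: (iffP idP) => [|h].
  case: s => lt x xg; apply/eqP; apply: contraT => /minv; rewrite oag_leNgt.
    by rewrite (le_lt_trans xg lt).
  by rewrite (lt_le_trans xg lt).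
by case: s h => h; [rewrite oag_ltNge|rewrite oag_leNgt]; apply/negP => /h /eqP;
  rewrite (negPf fv).
Qed.

Definition hahn_const a : K := hmonom a (0 : H).

Definition hahn_mon g : K := hmonom (1 : k) g.

Lemma hahn_constE a f x : ((hahn_const a * f : K) : hahn k H) x = a * (f : hahn k H) x.
Proof. by rewrite -[LHS]/(hmul (hmonom a (0 : H)) f x) hmonomE subr0. Qed.

Lemma hahn_const_zmod : zmod_morphism hahn_const.
Proof.
move=> a b; apply/hahnP => x.
rewrite -[RHS]/(hahn_const a x - hahn_const b x) /=.
by case: eqP; rewrite ?subr0.
Qed.

Lemma hahn_const_monoid : monoid_morphism hahn_const.
Proof.
split=> [|a b]; first by [].
apply/hahnP => x; rewrite hahn_constE /=; case: eqP => //; by rewrite mulr0.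
Qed.

HB.instance Definition _ := GRing.isZmodMorphism.Build k K hahn_const hahn_const_zmod.
HB.instance Definition _ := GRing.isMonoidMorphism.Build k K hahn_const hahn_const_monoid.

Lemma hahn_is_frame : hahn_frame c hahn_const hahn_mon.
Proof.
have valmon a g : a != 0 -> valuation (hmonom a g : K) = g.
  move=> a0; apply: hval_eq; first by rewrite /= eqxx.
  by move=> x /=; case: (x =P g) => [->|_]; rewrite ?lexx ?eqxx.
split.
- move=> f f0 df0; apply: hval_ge => // x; have [_ minv] := hvalP f0 => dx.
  apply: minv; apply: contraNneq dx => fx /=.
  by rewrite fx der0 mulr0 addr0.
- move=> a; apply/hahnP => x; rewrite -[RHS]/(der (hahn_const a x) + c x * hahn_const a x) /=.
  case: (x =P 0) => [->|_]; last by rewrite der0 mulr0 addr0.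
  by rewrite raddf0 mul0r addr0.
- by move=> a a0; apply: valmon.
- move=> f /vb_hahnP f0; exists ((f : hahn k H) 0); apply/vb_hahnP => x.
  rewrite le_eqVlt => lx.
  rewrite -[LHS]/((f : hahn k H) x - hahn_const ((f : hahn k H) 0) x) /=.
  case/orP: lx => [/eqP ->|x0]; first by rewrite eqxx subrr.
  by rewrite f0 // (lt_eqF x0) subr0.
- move=> g; apply/eqP => /hahnP/(_ g)/eqP; rewrite /= eqxx.
  by rewrite (negPf (oner_neq0 _)).
- by move=> g; apply: valmon; apply: oner_neq0.
- move=> g h; apply/hahnP => x; rewrite -[RHS]/(hmul (hmonom (1 : k) g) (hmonom (1 : k) h) x).
  by rewrite hmonomE mul1r /= subr_eq [h + g]addrC.
move=> g; apply/hahnP => x; rewrite hahn_constE.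
rewrite -[LHS]/(der (hahn_mon g x) + c x * hahn_mon g x) /=.
case: (x =P g) => [->|_]; last by rewrite der0 !mulr0 addr0.
by rewrite der1 add0r.
Qed.

(** The coefficient at [x] is read off any center whose ball fixes it. Up to a given point of its
    support, the series agrees with a single center, so its support is well ordered. *)
Lemma hahn_sph_complete : sph_complete K.
Proof.
move=> C coh.
pose u x := xget 0 [set y | exists2 p, C p & x < p.2 /\ (p.1 : hahn k H) x = y].
have uE p x : C p -> x < p.2 -> u x = (p.1 : hahn k H) x.
  move=> Cp xp; rewrite /u; case: xgetP => [y _ [q Cq [xq <-]]|/(_ ((p.1 : hahn k H) x))[]].
    have agree (p' q' : K * H) : C p' -> C q' -> p'.2 <= q'.2 -> x < p'.2 ->
        (q'.1 : hahn k H) x = (p'.1 : hahn k H) x.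
      move=> Cp' Cq' le xp'; have /vb_hahnP/(_ x xp') := coh _ _ Cp' Cq' le.
      by move=> /eqP; rewrite -[(q'.1 - p'.1 : K) x]/((q'.1 : hahn k H) x - (p'.1 : hahn k H) x) subr_eq0 => /eqP.
    by case/orP: (oag_total p.2 q.2) => le; [apply: agree|symmetry; apply: agree].
  by exists p.
have u0 x : u x != 0 -> exists2 p, C p & x < p.2.
  by rewrite /u; case: xgetP => [y _ [p Cp [xp _]]|]; [exists p|rewrite eqxx].
have wu : well_ordered (supp u).
  move=> B Bu [x Bx]; have [p Cp xp] := u0 x (Bu x Bx).
  have [||y [By yx] ym] := hahn_wo (f := p.1 : hahn k H) (B := B `&` [set y | y <= x]).
  - move=> y [By yx]; rewrite /supp /= -(uE p) //; first exact: Bu.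
    exact: le_lt_trans xp.
  - by exists x; split=> //=.
  exists y => // z Bz; case/orP: (oag_total z x) => zx; first by apply: ym.
  exact: le_trans zx.
exists (mkhahn wu : K) => p Cp; apply/vb_hahnP => x xp.
rewrite -[LHS]/(u x - (p.1 : hahn k H) x) (uE p) // subrr //.
Qed.

Lemma hahn_is_like : linearly_surjective k -> hahn_like c hahn_const hahn_mon.
Proof.
move=> lin; split; first exact: hahn_is_frame.
  exact: sph_hens hahn_is_frame hahn_sph_complete lin.
exact: sph_ball_complete hahn_sph_complete.
Qed.

End HahnFrame.

(** * Ultrapowers *)

(** [fu_tail] excludes principal ultrafilters. It permits diagonal constructions in which the
    component [j] takes care of the first [j] conditions only. *)
Record free_ultra (U : set (set nat)) : Prop := FreeUltra {
  fu_tail : forall n, U [set m | (n <= m)%N];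
  fu_I : forall A B, U A -> U B -> U (A `&` B);
  fu_S : forall A B, A `<=` B -> U A -> U B;
  fu_C : forall A, U A \/ U (~` A);
  fu_0 : ~ U set0 }.

Lemma exists_free_ultra : exists U, free_ultra U.
Proof.
have [U [UU sU]] := @ultraFilterLemma nat _ eventually_filter.
exists U; split.
- by move=> n; apply: sU; exists n.
- by move=> A B; apply: filterI.
- by move=> A B; apply: filterS.
- by move=> A; apply: in_ultra_setVsetC.
exact: filter_not_empty.
Qed.

Section UltraGroup.
Variables (U : set (set nat)) (fu : free_ultra U) (G : oagType).
Local Notation R := (nat -> G).
Implicit Types f g h : R.

Definition unull : {pred R} := fun f => `[< U [set n | f n = 0] >].

Lemma unull_zmod : zmod_closed unull.
Proof.
split=> [|f g]; rewrite /in_mem /=.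
  by apply/asboolP; apply: (fu_S fu) (fu_tail fu 0) => n _.
move=> /asboolP uf /asboolP ug; apply/asboolP; apply: (fu_S fu) (fu_I fu uf ug).
by move=> n [/= fn gn]; rewrite -[LHS]/(f n - g n) fn gn subr0.
Qed.

HB.instance Definition _ := GRing.isZmodClosed.Build R unull unull_zmod.

Definition ugroup := {ideal_quot unull}.

HB.instance Definition _ := GRing.Zmodule.on ugroup.

Definition ucl (f : R) : ugroup := (\pi_(ugroup) f)%qT.

Lemma ucl_eq f g : ucl f = ucl g <-> U [set n | f n = g n].
Proof.
have e : (ucl f == ucl g) = (f - g \in unull) by rewrite /ucl -Quotient.idealrBE.
split=> [/eqP|h].
  rewrite e => /asboolP; apply: (fu_S fu) => n /eqP.
  by rewrite -[(f - g) n]/(f n - g n) subr_eq0 => /eqP.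
apply/eqP; rewrite e; apply/asboolP; apply: (fu_S fu) h => n /= fg.
by rewrite -[LHS]/(f n - g n) fg subrr.
Qed.

Lemma uclD f g : ucl (f + g) = ucl f + ucl g.
Proof. exact: raddfD. Qed.

Lemma ucl0 : ucl (fun=> 0) = 0.
Proof. exact: raddf0. Qed.

Lemma ucl_repr (x : ugroup) : ucl (repr x) = x. Proof. exact: reprK. Qed.

Definition ule (x y : ugroup) : bool := `[< U [set n | repr x n <= repr y n] >].

Lemma ule_cl f g : ule (ucl f) (ucl g) = `[< U [set n | f n <= g n] >].
Proof.
have ef : U [set n | repr (ucl f) n = f n] by apply/ucl_eq; rewrite ucl_repr.
have eg : U [set n | repr (ucl g) n = g n] by apply/ucl_eq; rewrite ucl_repr.
apply/asboolP/asboolP => h; apply: (fu_S fu) (fu_I fu h (fu_I fu ef eg)) => n [/= hn [/= e1 e2]].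
  by rewrite -e1 -e2.
by rewrite e1 e2.
Qed.

Lemma ule_refl : reflexive ule.
Proof.
by move=> x; rewrite -(ucl_repr x) ule_cl; apply/asboolP; apply: (fu_S fu) (fu_tail fu 0) => n _ /=.
Qed.

Lemma ule_anti : antisymmetric ule.
Proof.
move=> x y; rewrite -(ucl_repr x) -(ucl_repr y) !ule_cl => /andP[/asboolP h /asboolP h'].
apply/ucl_eq; apply: (fu_S fu) (fu_I fu h h') => n [/= le1 le2].
by apply/eqP; rewrite eq_le le1.
Qed.

Lemma ule_trans : transitive ule.
Proof.
move=> y x z; rewrite -(ucl_repr x) -(ucl_repr y) -(ucl_repr z) !ule_cl.
move=> /asboolP h /asboolP h'; apply/asboolP; apply: (fu_S fu) (fu_I fu h h') => n [/=].
exact: le_trans.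
Qed.

HB.instance Definition _ := Order.Le_isPOrder.Build ring_display ugroup
  ule_refl ule_anti ule_trans.

Lemma ucl_le f g : (ucl f <= ucl g) <-> U [set n | f n <= g n].
Proof. by rewrite -[_ <= _]/(ule _ _) ule_cl; split=> /asboolP. Qed.

Lemma ugroup_total : total (<=%R : rel ugroup).
Proof.
move=> x y; rewrite -(ucl_repr x) -(ucl_repr y).
have [h|h] := fu_C fu [set n | repr x n <= repr y n].
  by apply/orP; left; apply/ucl_le.
apply/orP; right; apply/ucl_le; apply: (fu_S fu) h => n /= /negP h.
by case/orP: (oag_total (repr x n) (repr y n)) => // e; rewrite e in h.
Qed.

Lemma ugroup_lerD2r (z x y : ugroup) : x <= y -> x + z <= y + z.
Proof.
rewrite -(ucl_repr x) -(ucl_repr y) -(ucl_repr z) -!uclD => /ucl_le h.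
by apply/ucl_le; apply: (fu_S fu) h => n /=; apply: oag_lerD2r.
Qed.

HB.instance Definition _ := isOrderedAbGroup.Build ugroup ugroup_total ugroup_lerD2r.

End UltraGroup.

Lemma residue_pchar0_natr (G : oagType) (K : valuedFieldType G) :
  (forall n, (0 < n)%N -> n%:R != 0 :> K /\ valuation (n%:R : K) = 0) ->
  [pchar (@residue G K)] =i pred0.
Proof.
move=> h p; rewrite !inE; apply/negP => /andP[/prime_gt0/h[p0 vp]].
rewrite -(rmorph_nat (@reduction G K)) reduction_eq0 inE rmorph_nat.
by rewrite (negPf p0) vp ltxx.
Qed.

Section UltraField.
Variables (U : set (set nat)) (fu : free_ultra U).
Variables (G : oagType) (F : valuedDiffFieldType G).
Local Notation R := (nat -> F).
Local Notation v := (@valuation G F).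
Implicit Types f g h : R.

Definition fnull : {pred R} := fun f => `[< U [set n | f n = 0] >].

Lemma fnull_ideal : idealr_closed fnull.
Proof.
split=> [||h f g]; rewrite /in_mem /=.
- by apply/asboolP; apply: (fu_S fu) (fu_tail fu 0) => n _.
- apply/asboolP => h; apply: (fu_0 fu); apply: (fu_S fu) h => n /= /eqP.
  by rewrite -[(1 : R) n]/(1 : F) oner_eq0.
move=> /asboolP uf /asboolP ug; apply/asboolP; apply: (fu_S fu) (fu_I fu uf ug).
by move=> n [/= fn gn]; rewrite -[LHS]/(h n * f n + g n) fn gn mulr0 addr0.
Qed.

HB.instance Definition _ := isIdealr.Build R fnull fnull_ideal.

Definition ufield := {ideal_quot fnull}.

HB.instance Definition _ := GRing.ComNzRing.on ufield.

Definition fcl (f : R) : ufield := (\pi_(ufield) f)%qT.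

HB.instance Definition _ := GRing.RMorphism.copy fcl (\pi_(ufield))%qT.

Lemma fcl_eq f g : fcl f = fcl g <-> U [set n | f n = g n].
Proof.
have e : (fcl f == fcl g) = (f - g \in fnull) by rewrite /fcl -Quotient.idealrBE.
split=> [/eqP|h].
  rewrite e => /asboolP; apply: (fu_S fu) => n /eqP.
  by rewrite -[(f - g) n]/(f n - g n) subr_eq0 => /eqP.
apply/eqP; rewrite e; apply/asboolP; apply: (fu_S fu) h => n /= fg.
by rewrite -[LHS]/(f n - g n) fg subrr.
Qed.

Lemma fcl_repr (x : ufield) : fcl (repr x) = x. Proof. exact: reprK. Qed.

Lemma repr_fcl f : U [set n | repr (fcl f) n = f n].
Proof. by apply/fcl_eq; rewrite fcl_repr. Qed.

Lemma fcl_neq0 f : fcl f != 0 <-> U [set n | f n != 0].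
Proof.
have e : fcl f = 0 <-> U [set n | f n = 0] by rewrite -(rmorph0 fcl); exact: fcl_eq.
split=> [/eqP f0|h]; last first.
  apply/eqP => /e h0; apply: (fu_0 fu); apply: (fu_S fu) (fu_I fu h h0) => n [/= /eqP].
  by [].
have [/e//|] := fu_C fu [set n | f n = 0].
by apply: (fu_S fu) => n /= /eqP.
Qed.

Definition uinv (x : ufield) : ufield := fcl (fun n => (repr x n)^-1).

Lemma uinv_cl f : uinv (fcl f) = fcl (fun n => (f n)^-1).
Proof. by apply/fcl_eq; apply: (fu_S fu) (repr_fcl f) => n /= ->. Qed.

Lemma uinv_mulVf x : x != 0 -> uinv x * x = 1.
Proof.
rewrite -(fcl_repr x) uinv_cl => /fcl_neq0 h; rewrite -rmorphM -(rmorph1 fcl).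
by apply/fcl_eq; apply: (fu_S fu) h => n /= fn; rewrite -[LHS]/(_^-1 * _) mulVf.
Qed.

Lemma uinv_0 : uinv 0 = 0.
Proof.
rewrite -(rmorph0 fcl) uinv_cl; apply/fcl_eq; apply: (fu_S fu) (fu_tail fu 0) => n _ /=.
by rewrite -[X in X^-1 = _]/(0 : F) invr0.
Qed.

HB.instance Definition _ := GRing.ComNzRing_isField.Build ufield uinv_mulVf uinv_0.

Definition uder (x : ufield) : ufield := fcl (fun n => der (repr x n)).

Lemma uder_cl f : uder (fcl f) = fcl (fun n => der (f n)).
Proof. by apply/fcl_eq; apply: (fu_S fu) (repr_fcl f) => n /= ->. Qed.

Lemma uderD : {morph uder : x y / x + y}.
Proof.
move=> x y; rewrite -(fcl_repr x) -(fcl_repr y) -rmorphD !uder_cl -rmorphD.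
by congr fcl; apply: funext => n; rewrite -[RHS]/(der _ + der _) -derD.
Qed.

Lemma uderM x y : uder (x * y) = uder x * y + x * uder y.
Proof.
rewrite -(fcl_repr x) -(fcl_repr y) -rmorphM !uder_cl -!rmorphM -rmorphD.
by congr fcl; apply: funext => n; rewrite -[RHS]/(der _ * _ + _ * der _) -derM.
Qed.

Lemma ufield_natr n : n%:R = fcl (fun=> n%:R).
Proof.
rewrite -(rmorph_nat fcl); congr fcl; apply: funext => m.
by elim: n => // n IH; rewrite !mulrS -IH.
Qed.

Lemma ufield_natr_neq0 n : (0 < n)%N -> n%:R != 0 :> ufield.
Proof.
move=> n0; rewrite ufield_natr; apply/fcl_neq0; apply: (fu_S fu) (fu_tail fu 0) => m _ /=.
exact: natr_neq0.
Qed.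

Lemma ufield_pchar0 : [pchar ufield] =i pred0.
Proof.
apply/pcharf0P => -[|n]; first exact: eqxx.
by apply/negbTE; apply: ufield_natr_neq0.
Qed.

HB.instance Definition _ := isDifferential.Build ufield uderD uderM ufield_pchar0.

Definition uval (x : ufield) : ugroup fu G := ucl fu (fun n => v (repr x n)).

Lemma uval_cl f : uval (fcl f) = ucl fu (fun n => v (f n)).
Proof. by apply/(ucl_eq fu); apply: (fu_S fu) (repr_fcl f) => n /= ->. Qed.

Lemma uvalM x y : x != 0 -> y != 0 -> uval (x * y) = uval x + uval y.
Proof.
rewrite -(fcl_repr x) -(fcl_repr y) => /fcl_neq0 x0 /fcl_neq0 y0.
rewrite -rmorphM !uval_cl -uclD; apply/ucl_eq; apply: (fu_S fu) (fu_I fu x0 y0).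
by move=> n [/= xn yn]; rewrite -[LHS]/(v (_ * _)) Defs.valM.
Qed.

Lemma uvalD x y : x != 0 -> y != 0 -> x + y != 0 ->
  Order.min (uval x) (uval y) <= uval (x + y).
Proof.
rewrite -(fcl_repr x) -(fcl_repr y) => x0 y0; rewrite -rmorphD => xy0.
rewrite comparable_ge_min ?oag_cmp // !uval_cl.
move: x0 y0 xy0 => /fcl_neq0 x0 /fcl_neq0 y0 /fcl_neq0 xy0.
pose A := [set n | v (repr x n) <= v (repr y n)].
have h := fu_I fu x0 (fu_I fu y0 xy0); apply/orP.
have [hA|hA] := fu_C fu A; [left|right]; apply/ucl_le; apply: (fu_S fu) (fu_I fu hA h).
  move=> n [/= le [xn [yn xyn]]]; apply: le_trans (valD _ _ xn yn xyn).
  by rewrite comparable_le_min ?oag_cmp // lexx.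
move=> n [/= /negP le [xn [yn xyn]]]; apply: le_trans (valD _ _ xn yn xyn).
by rewrite comparable_le_min ?oag_cmp // lexx andbT ltW // oag_ltNge.
Qed.

HB.instance Definition _ := isValued.Build (ugroup fu G) ufield uvalM uvalD.

Lemma ufield_val f : valuation (fcl f : ufield) = ucl fu (fun n => v (f n)).
Proof. exact: uval_cl. Qed.

Lemma ufield_residue_pchar0 : [pchar (@residue (ugroup fu G) ufield)] =i pred0.
Proof.
apply: residue_pchar0_natr => n n0; split; first exact: ufield_natr_neq0.
rewrite ufield_natr ufield_val -[RHS](ucl0 fu G).
by congr ucl; apply: funext => m; rewrite val_natr.
Qed.

HB.instance Definition _ := hasResidueChar0.Build (ugroup fu G) ufield ufield_residue_pchar0.

Lemma ufield_der f : der (fcl f : ufield) = fcl (fun n => der (f n)).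
Proof. exact: uder_cl. Qed.

Lemma ufield_vb s (g : nat -> G) f : vb s (ucl fu g) (fcl f : ufield) <-> U [set n | vb s (g n) (f n)].
Proof.
have lt_cl a b : (ucl fu a < ucl fu b) <-> U [set n | a n < b n].
  rewrite oag_ltNge; split=> [/negP h|h].
    have [/(ucl_le fu)//|] := fu_C fu [set n | b n <= a n].
    by apply: (fu_S fu) => n /= /negP; rewrite -oag_ltNge.
  apply/negP => /ucl_le h'; apply: (fu_0 fu); apply: (fu_S fu) (fu_I fu h h') => n [/= lt le].
  by move: lt; rewrite oag_ltNge le.
rewrite /vb; have [/eqP f0|f0] := boolP (fcl f == 0).
  split=> // _; move: f0; rewrite -(rmorph0 fcl) => /fcl_eq; apply: (fu_S fu) => n /= ->.
  by rewrite eqxx.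
move: f0 => /fcl_neq0 f0; rewrite /= ufield_val.
transitivity (U [set n | if s then g n < v (f n) else g n <= v (f n)]).
  by case: s; [apply: lt_cl|apply: ucl_le].
split=> h; [apply: (fu_S fu) h => n /= ->|apply: (fu_S fu) (fu_I fu f0 h) => n [/= fn]].
  by rewrite orbT.
by rewrite (negPf fn).
Qed.

Lemma ufield_valring f : (fcl f \in @in_valring _ ufield) <->
  U [set n | f n \in @in_valring _ F].
Proof.
by have := ufield_vb false (fun=> 0) f; rewrite (ucl0 fu G).
Qed.

Lemma eval_cl n (t : term n) (e : 'I_n -> R) :
  eval (fun i => fcl (e i) : ufield) t = fcl (fun m => eval (fun i => e i m) t).
Proof.
elim: t => [i|||t IHt u IHu|t IHt|t IHt u IHu|t IHt] /=; rewrite ?IHt ?IHu //.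
- by rewrite -(rmorph0 fcl).
- by rewrite -(rmorph1 fcl).
- by rewrite -rmorphD.
- by rewrite -rmorphN.
- by rewrite -rmorphM.
exact: ufield_der.
Qed.

(** An implication uses that a set or its complement is in [U]. For a quantifier, a counterexample
    is chosen in each component that has one, and the class of this sequence is the instance
    used. *)
Lemma los n (phi : formula n) (e : 'I_n -> R) :
  holds phi (fun i => fcl (e i) : ufield) <-> U [set m | holds phi (fun i => e i m)].
Proof.
elim: n / phi e => [n t u|n t|n|n phi IH psi IH'|n phi IH] e /=.
- by rewrite !eval_cl; apply: fcl_eq.
- by rewrite eval_cl; apply: ufield_valring.
- by split=> // /(fu_0 fu).
- rewrite IH IH'; split=> [h|h h'].
    have [hp|] := fu_C fu [set m | holds phi (fun i => e i m)].
      by apply: (fu_S fu) (h hp) => m /=.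
    by apply: (fu_S fu) => m /=.
  by apply: (fu_S fu) (fu_I fu h h') => m [/= a b]; apply: a.
have env x : env_cons (fcl x : ufield) (fun i => fcl (e i)) =
    fun i => fcl (oapp e x (unlift ord0 i)).
  by apply: funext => i; rewrite /env_cons; case: unlift.
have env' (x : R) m : (fun i => oapp e x (unlift ord0 i) m) = env_cons (x m) (fun i => e i m).
  by apply: funext => i; rewrite /env_cons; case: unlift.
split=> [h|h x].
  pose bad m y := ~ holds phi (env_cons y (fun i => e i m)).
  pose x m := xget 0 [set y | bad m y].
  have := h (fcl x); rewrite env IH; apply: (fu_S fu) => m /=; rewrite env' => hx y.
  apply: contrapT => ny; have : bad m (x m) by apply: (xgetI 0 (P := [set y | bad m y]) (x := y)).
  by [].
rewrite -(fcl_repr x) env; apply/IH; apply: (fu_S fu) h => m /= h.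
by rewrite env'.
Qed.

Lemma ufield_equiv : elem_equiv F ufield.
Proof.
move=> phi; have e0 : 'I_0 -> R by case.
have eE K' (e1 e2 : 'I_0 -> K') : e1 = e2 by apply: funext => -[].
split=> h e.
  rewrite (eE _ e (fun i => fcl (e0 i))); apply/los; apply: (fu_S fu) (fu_tail fu 0) => m _ /=.
  exact: h.
have /los h' := h (fun i => fcl (e0 i)).
apply: contrapT => nh; apply: (fu_0 fu); apply: (fu_S fu) h' => m /= hm.
by apply: nh; rewrite (eE _ e (fun i => e0 i m)).
Qed.

End UltraField.

(** * Differential-henselian fields and value groups *)

(** [f] need not be a morphism, since it will choose representatives. [f 0 = 0] makes the
    coefficients off the support of [P] come out right. *)
Lemma mpoly_lift (R S : comNzRingType) n (f : R -> S) (P : {mpoly R[n]}) :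
  f 0 = 0 -> exists Q : {mpoly S[n]}, forall m, Q@_m = f P@_m.
Proof.
move=> f0; exists (\sum_(m <- msupp P) f P@_m *: 'X_[m]) => m.
rewrite raddf_sum /=; under eq_bigr do rewrite mcoeffZ mcoeffX.
have [mP|mP] := boolP (m \in msupp P); last first.
  rewrite (memN_msupp_eq0 mP) f0 big1_seq // => m' /andP[_ m'P].
  by case: eqVneq => [e|]; [rewrite -e m'P in mP|rewrite mulr0].
rewrite (bigD1_seq m) ?msupp_uniq //= eqxx mulr1 big1 ?addr0 // => m' /negPf ->.
by rewrite mulr0.
Qed.

Lemma map_meval (R S : comNzRingType) (f : {rmorphism R -> S}) n (P : {mpoly R[n]})
    (x : 'I_n -> R) : (map_mpoly f P).@[f \o x] = f P.@[x].
Proof.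
elim/mpoly_ring_ind: P => [c|i|p q hp hq|p q hp hq].
- by rewrite map_mpolyC !mevalC.
- by rewrite map_mpolyX !mevalXU.
- by rewrite rmorphD !mevalD rmorphD hp hq.
by rewrite rmorphM !mevalM rmorphM hp hq.
Qed.

Lemma diff_henselian_hens (G : oagType) (F : valuedDiffFieldType G) :
  diff_henselian F -> hens F.
Proof.
move=> [_ dh] [|r] P dom P0; first by case: dom => _ _ [[]].
have inO x : vb false 0 x -> val (insubd (0 : valring F) x) = x.
  by move=> x0; rewrite insubdK.
have nbP m : vb false 0 P@_m.
  by have := lin_dom_nb dom P0 m; rewrite mul0rn subr0.
have l0 : insubd (0 : valring F) 0 = 0 by apply: val_inj; rewrite inO ?vb0.
have [Q hQ] := mpoly_lift P l0.
have PQ : map_mpoly val Q = P.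
  by apply/mpolyP => m; rewrite mcoeff_map_mpoly /= hQ inO.
have red m : ((map_mpoly (@reduction G F) Q)@_m == 0) = vb true 0 P@_m.
  by rewrite mcoeff_map_mpoly /= reduction_eq0 inE hQ inO.
case: dom => hm lm [i ui]; have [|y hy] := dh r Q; last first.
  by exists (val y); [exact: (valP y)|rewrite -PQ].
apply/eqP; rewrite eqn_leq; apply/andP; split.
  rewrite msizeE; apply/bigmax_leqP_seq => m; rewrite mcoeff_msupp red => um _.
  rewrite ltnNge; apply: contra um => /hm.
  by rewrite mul0rn subr0 addr0.
have : U_(i)%MM \in msupp (map_mpoly (@reduction G F) Q) by rewrite mcoeff_msupp red.
by move=> /msize_mdeg_lt; rewrite mdeg1.
Qed.

(** * Valuing a field in its value group *)

Section ValueGroup.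
Variables (G : oagType) (F : valuedDiffFieldType G).
Local Notation v := (@valuation G F).

Definition in_vgroup : {pred G} := fun g => `[< value_group F g >].

Lemma in_vgroupP g : reflect (exists2 f : F, f != 0 & v f = g) (g \in in_vgroup).
Proof. by rewrite /in_mem /=; apply: (iffP (asboolP _)). Qed.

Lemma in_vgroup_zmod : zmod_closed in_vgroup.
Proof.
split=> [|g h]; first by apply/in_vgroupP; exists 1; rewrite ?oner_neq0 // Defs.val1.
move=> /in_vgroupP[x x0 <-] /in_vgroupP[y y0 <-]; apply/in_vgroupP.
by exists (x / y); rewrite ?mulf_neq0 ?invr_eq0 // Defs.valM ?invr_eq0 // valV.
Qed.

HB.instance Definition _ := GRing.isZmodClosed.Build G in_vgroup in_vgroup_zmod.

Record vgroup := Vgroup { vgroup_val : G; _ : vgroup_val \in in_vgroup }.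

HB.instance Definition _ := [isSub for vgroup_val].
HB.instance Definition _ := [Choice of vgroup by <:].
HB.instance Definition _ := [SubChoice_isSubZmodule of vgroup by <:].

Definition vle (x y : vgroup) : bool := val x <= val y.

Lemma vle_refl : reflexive vle. Proof. by move=> x; apply: lexx. Qed.

Lemma vle_anti : antisymmetric vle.
Proof. by move=> x y h; apply/val_inj/le_anti. Qed.

Lemma vle_trans : transitive vle.
Proof. by move=> y x z; apply: le_trans. Qed.

HB.instance Definition _ := Order.Le_isPOrder.Build ring_display vgroup
  vle_refl vle_anti vle_trans.

Lemma vgroup_total : total (<=%R : rel vgroup).
Proof. by move=> x y; apply: oag_total. Qed.

Lemma vgroup_lerD2r (z x y : vgroup) : x <= y -> x + z <= y + z.
Proof. exact: (@oag_lerD2r _ (val z) (val x) (val y)). Qed.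

HB.instance Definition _ := isOrderedAbGroup.Build vgroup vgroup_total vgroup_lerD2r.

(** A valuation into [G] need not be onto, while a cross section is to be defined on the whole
    group. The copy of [F] carries the valuation into [vgroup], next to the original one. *)
Definition vfield : Type := F.
HB.instance Definition _ := DiffField.on vfield.

Definition vgval (x : vfield) : vgroup := insubd (0 : vgroup) (v (x : F)).

Lemma vgvalE (x : F) : x != 0 -> val (vgval x) = v x.
Proof. by move=> x0; rewrite insubdK //; apply/in_vgroupP; exists x. Qed.

Lemma vgvalM (x y : vfield) : x != 0 -> y != 0 -> vgval (x * y) = vgval x + vgval y.
Proof.
move=> x0 y0; apply: val_inj; rewrite [RHS]/= !vgvalE //; last exact: mulf_neq0.
exact: Defs.valM.
Qed.

Lemma vgvalD (x y : vfield) : x != 0 -> y != 0 -> x + y != 0 ->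
  Order.min (vgval x) (vgval y) <= vgval (x + y).
Proof.
move=> x0 y0 xy0; rewrite comparable_ge_min ?oag_cmp //.
rewrite -![_ <= vgval _]/(_ <= val _)%R -![X in _ <= X]/(val (vgval (x + y))) !vgvalE //.
by have := valD _ _ x0 y0 xy0; rewrite comparable_ge_min ?oag_cmp.
Qed.

HB.instance Definition _ := isValued.Build vgroup vfield vgvalM vgvalD.

Lemma vfield_vb s (g : vgroup) (x : F) : vb s g (x : vfield) = vb s (val g) x.
Proof.
rewrite /vb; have [//|x0 /=] := eqVneq x 0.
rewrite -(vgvalE x0); case: s => //.
by rewrite oag_ltNge [RHS]oag_ltNge.
Qed.

Lemma vfield_residue_pchar0 : [pchar (@residue vgroup vfield)] =i pred0.
Proof.
apply: residue_pchar0_natr => n n0; split; first exact: natr_neq0.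
by apply: val_inj; rewrite [LHS](vgvalE (natr_neq0 F n0)) val_natr.
Qed.

HB.instance Definition _ := hasResidueChar0.Build vgroup vfield vfield_residue_pchar0.

Lemma vfield_eval n (t : term n) (e : 'I_n -> F) : eval (e : 'I_n -> vfield) t = eval e t.
Proof. by elim: t => [i|||t IHt u IHu|t IHt|t IHt u IHu|t IHt] //=; rewrite ?IHt ?IHu. Qed.

Lemma vfield_holds n (phi : formula n) (e : 'I_n -> F) :
  holds phi (e : 'I_n -> vfield) <-> holds phi e.
Proof.
elim: n / phi e => [n t u|n t|n|n phi IH psi IH'|n phi IH] e /=.
- by rewrite !vfield_eval.
- by rewrite vfield_eval; have := vfield_vb false 0 (eval e t); rewrite /vb => h; rewrite !inE h.
- by [].
- by split=> h /IH/h/IH'.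
by split=> h x; [apply: (iffLR (IH (env_cons (x : F) e)))|apply: (iffRL (IH (env_cons (x : F) e)))]; apply: h.
Qed.

Lemma vfield_equiv : elem_equiv F vfield.
Proof. by move=> phi; split=> h e; apply/vfield_holds. Qed.

Lemma vfield_surj (g : vgroup) : exists2 x : vfield, x != 0 & valuation x = g.
Proof.
have /in_vgroupP[x x0 vx] := valP g; exists x => //.
by apply: val_inj; rewrite [LHS]vgvalE.
Qed.

Lemma vfield_mono : monotone F -> monotone vfield.
Proof.
move=> mono f f0 df0; have := mono f f0 df0.
by rewrite -(vgvalE f0) -(vgvalE df0).
Qed.

Lemma vfield_hens : hens F -> hens vfield.
Proof.
move=> h n P [hm lm [i ui]] P0.
have [||y y0 Py] := h n P; last by exists y; rewrite // vfield_vb.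
  split=> [m|j|]; last by exists i; rewrite -(vfield_vb true 0).
    by move=> /hm; rewrite !mul0rn !subr0 !addr0 vfield_vb.
  exact: (etrans (esym (vfield_vb false 0 P@_(U_(j)))) (lm j)).
exact: (etrans (esym (vfield_vb false 0 P@_0)) P0).
Qed.

Lemma vfield_pure : pure_subgroup (constant_value_group F) (value_group F) ->
  forall n (g : vgroup), (0 < n)%N -> constant_value_group vfield (g *+ n) ->
  constant_value_group vfield g.
Proof.
move=> [_ pureF] n g n0 [f [df f0]] vf.
have [||_ [h [dh h0] <-]] := pureF n (val g) n0.
- by have /in_vgroupP[x x0 vx] := valP g; exists x.
- by exists f => //; rewrite -(vgvalE f0) -raddfMn -vf.
move=> e; exists h => //; apply: val_inj; rewrite [LHS]vgvalE //.
exact: (oag_mulIn n0 e).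
Qed.

End ValueGroup.

(** * Root systems and cross sections *)

(** A countable compactness property of the multiplicative group [A]: it supplies compatible roots
    along an infinite chain where single roots may fail to exist. *)
Definition root_system (K : fieldType) (A : set K) : Prop :=
  forall (w : nat -> K) (n : nat -> nat), (forall i, A (w i)) -> (forall i, (0 < n i)%N) ->
  exists2 a : nat -> K, forall i, A (a i) & forall i, a i = w i * a i.+1 ^+ n i.

Lemma max_index (G : oagType) (g : nat -> G) N : (0 < N)%N ->
  exists2 i0, (i0 < N)%N & forall i, (i < N)%N -> g i <= g i0.
Proof.
elim: N => // -[|N] IH _; first by exists 0%N => // -[|//].
have [//|i0 i0N hi] := IH; have [le|] := boolP (g i0 <= g N.+1).
  exists N.+1 => // i; rewrite ltnS leq_eqVlt => /orP[/eqP -> //|/hi].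
  by move=> /le_trans; apply.
rewrite -oag_ltNge => lt; exists i0 => [|i]; first exact: ltnW.
by rewrite ltnS leq_eqVlt => /orP[/eqP ->|/hi //]; apply: ltW.
Qed.

Section AtIndex.
Variables (F : comNzRingType) (j : nat).

Definition at_index (f : nat -> F) : F := f j.

Lemma at_index_zmod : zmod_morphism at_index. Proof. by []. Qed.

Lemma at_index_monoid : monoid_morphism at_index. Proof. by []. Qed.

HB.instance Definition _ := GRing.isZmodMorphism.Build (nat -> F) F at_index at_index_zmod.
HB.instance Definition _ := GRing.isMonoidMorphism.Build (nat -> F) F at_index at_index_monoid.

End AtIndex.

Section UltraFacts.
Variables (U : set (set nat)) (fu : free_ultra U).
Variables (G : oagType) (F : valuedDiffFieldType G).
Local Notation R := (nat -> F).
Local Notation K := (ufield fu F).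
Local Notation v := (@valuation G F).
Local Notation fcl := (@fcl U fu G F).

Lemma fu_bounded N (A : nat -> set nat) : (forall i, (i < N)%N -> U (A i)) ->
  U [set j | forall i, (i < N)%N -> A i j].
Proof.
elim: N => [|N IH] h; first by apply: (fu_S fu) (fu_tail fu 0) => j _ i.
apply: (fu_S fu) (fu_I fu (h N (ltnSn N)) (IH (fun i iN => h i (ltnW iN)))).
by move=> j [aN hj] i; rewrite ltnS leq_eqVlt => /orP[/eqP ->|/hj].
Qed.

Lemma fu_all (T : eqType) (r : seq T) (A : T -> set nat) : (forall x, x \in r -> U (A x)) ->
  U [set j | forall x, x \in r -> A x j].
Proof.
elim: r => [|x r IH] h; first by apply: (fu_S fu) (fu_tail fu 0) => j _ i.
have h' y : y \in r -> U (A y) by move=> yr; apply: h; rewrite inE yr orbT.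
apply: (fu_S fu) (fu_I fu (h x (mem_head _ _)) (IH h')).
by move=> j [ax hj] y; rewrite inE => /orP[/eqP ->|/hj].
Qed.

Lemma ucl_mulrn (g : nat -> G) n : ucl fu g *+ n = ucl fu (fun j => g j *+ n).
Proof.
elim: n => [|n IH]; first by rewrite -[LHS](ucl0 fu G).
by rewrite mulrS IH -uclD; congr ucl; apply: funext => j; rewrite mulrS.
Qed.

Lemma ufield_surj : (forall g : G, exists2 f : F, f != 0 & v f = g) ->
  forall g : ugroup fu G, exists2 x : K, x != 0 & valuation x = g.
Proof.
move=> surj g; have ex j : exists f : F, f != 0 /\ v f = repr g j.
  by have [f f0 vf] := surj (repr g j); exists f.
have [f hf] := choice ex; exists (fcl f).
  by apply/fcl_neq0; apply: (fu_S fu) (fu_tail fu 0) => j _; case: (hf j).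
rewrite ufield_val -[RHS]ucl_repr; congr ucl.
by apply: funext => j; case: (hf j).
Qed.

Lemma ufield_mono : monotone F -> monotone K.
Proof.
move=> mono x; rewrite -(fcl_repr x) ufield_der => /fcl_neq0 x0 /fcl_neq0 dx0.
rewrite !ufield_val; apply/ucl_le; apply: (fu_S fu) (fu_I fu x0 dx0) => j [/=].
exact: mono.
Qed.

Lemma ufield_pure :
  (forall n (g : G), (0 < n)%N -> constant_value_group F (g *+ n) ->
    constant_value_group F g) ->
  forall n (g : ugroup fu G), (0 < n)%N -> constant_value_group K (g *+ n) ->
    constant_value_group K g.
Proof.
move=> pureF n g n0 [x []]; rewrite -(fcl_repr x) -(ucl_repr g) ucl_mulrn /constants /=.
rewrite ufield_der ufield_val => dx /fcl_neq0 x0 /ucl_eq vx.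
move: dx; rewrite -(rmorph0 fcl) => /fcl_eq dx.
pose y j := xget 0 [set y | [/\ der y = 0, y != 0 & v y = repr g j]].
have hy : U [set j | [/\ der (y j) = 0, y j != 0 & v (y j) = repr g j]].
  apply: (fu_S fu) (fu_I fu dx (fu_I fu x0 vx)) => j [/= dj [xj vj]].
  have [|z [dz z0] vz] := pureF n (repr g j) n0.
    by exists (repr x j) => //; split.
  exact: (xgetI 0 (P := [set y | [/\ der y = 0, y != 0 & v y = repr g j]]) (x := z)).
exists (fcl y); first split.
- rewrite /constants /= ufield_der -(rmorph0 fcl); apply/fcl_eq.
  by apply: (fu_S fu) hy => j [].
- by apply/fcl_neq0; apply: (fu_S fu) hy => j [].
by rewrite ufield_val; apply/ucl_eq; apply: (fu_S fu) hy => j [].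
Qed.

(* The [j]-th component of the system solves its first [j] equations, downwards from
   the value 1 at the index [j]. *)
Lemma ufield_root_system (A : set F) (B : set K) : A 1 ->
  (forall x y, A x -> A y -> A (x * y)) ->
  (forall f, B (fcl f) <-> U [set j | A (f j)]) -> root_system B.
Proof.
move=> A1 AM BE w n hw _.
pose r i j := if `[< A (repr (w i) j) >] then repr (w i) j else 1.
have rA i j : A (r i j) by rewrite /r; case: asboolP.
have rw i : fcl (r i) = w i.
  rewrite -(fcl_repr (w i)); apply/fcl_eq; have := hw i; rewrite -{1}(fcl_repr (w i)).
  by move=> /BE; apply: (fu_S fu) => j; rewrite /r /=; case: asboolP.
pose fix t j i l : F := if l is l'.+1 then r i j * t j i.+1 l' ^+ n i else 1.
have tA j i l : A (t j i l).
  elim: l i => [|l IH] i //=; apply: (AM) => //.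
  by elim: (n i) => [|m IHm]; rewrite ?expr0 // exprS; apply: AM.
exists (fun i => fcl (fun j => t j i (j - i)%N)) => i.
  by apply/BE; apply: (fu_S fu) (fu_tail fu 0) => j _ /=.
rewrite -rw -rmorphXn -rmorphM; apply/fcl_eq; apply: (fu_S fu) (fu_tail fu i.+1) => j /= ij.
rewrite -[RHS]/(r i j * ((fun j => t j i.+1 (j - i.+1)%N) ^+ n i) j).
have -> m (f : R) : (f ^+ m) j = f j ^+ m.
  by elim: m => // m IH; rewrite !exprS -IH.
by rewrite -[(j - i)%N]prednK ?subn_gt0 //= -subnS.
Qed.

Lemma ufield_complete : ball_complete K.
Proof.
move=> b g bg; pose br i := repr (b i); pose gr i := repr (g i).
pose inball x i j := vb false (gr i j) (x - br i j : F).
pose ok N j := exists x : F, forall i, (i < N)%N -> inball x i j.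
have vbE x i : vb false (g i) (fcl x - b i) <-> U [set j | inball (x j) i j].
  by rewrite -(fcl_repr (b i)) -(ucl_repr (g i)) -rmorphB; apply: ufield_vb.
have pair i i' : U [set j | gr i j <= gr i' j -> inball (br i' j) i j].
  have [h|h] := fu_C fu [set j | gr i j <= gr i' j]; last first.
    by apply: (fu_S fu) h => j nle le; case: nle.
  have : g i <= g i' by rewrite -(ucl_repr (g i)) -(ucl_repr (g i')); apply/ucl_le.
  move=> /bg; rewrite -{1}(fcl_repr (b i')) => /vbE.
  by apply: (fu_S fu) => j h' _.
(* Among finitely many balls, the smallest one has its center in all the others. *)
have okU N : U [set j | ok N j].
  case: N => [|N]; first by apply: (fu_S fu) (fu_tail fu 0) => j _; exists 0.
  have := fu_bounded (N := N.+1) (fun i _ => fu_bounded (N := N.+1) (fun i' _ => pair i i')).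
  apply: (fu_S fu) => j.
  have [i0 i0N hi] := max_index (fun i => gr i j) (ltn0Sn N).
  by move=> h; exists (br i0 j) => i iN; apply: h => //; apply: hi.
(* For [M = j] this is the diagonal choice: the component [j] lies in as many of the first [j] balls
   as can be satisfied together there. *)
have ex j M : exists x, forall N, (N <= M)%N -> ok N j -> forall i, (i < N)%N -> inball x i j.
  elim: M => [|M [x hx]]; first by exists 0 => N; rewrite leqn0 => /eqP -> _ i.
  have [[y hy]|nok] := pselect (ok M.+1 j).
    by exists y => N NM _ i iN; apply: hy; apply: leq_trans NM.
  exists x => N; rewrite leq_eqVlt => /orP[/eqP ->|/hx//].
  by move=> /nok.
have [x hx] := choice (fun j => ex j j); exists (fcl x) => i; apply/vbE.
apply: (fu_S fu) (fu_I fu (okU i.+1) (fu_tail fu i.+1)) => j [/= okj ij].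
exact: (hx j i.+1 ij okj i (ltnSn i)).
Qed.

(** A polynomial has finitely many coefficients, so almost every component satisfies the hypotheses
    of [hens], and the roots found there represent a root. *)
Lemma ufield_hens : hens F -> hens K.
Proof.
move=> hensF n P [hm lm [i ui]] P0.
pose f (x : K) : R := if x == 0 then 0 else repr x.
have fK x : fcl (f x) = x.
  by rewrite /f; case: eqP => [->|_]; [apply: rmorph0|apply: fcl_repr].
have [|Q hQ] := mpoly_lift P (f := f); first by rewrite /f eqxx.
have QP : map_mpoly fcl Q = P by apply/mpolyP => m; rewrite mcoeff_map_mpoly hQ [LHS]fK.
have vbE s m : vb s 0 P@_m <-> U [set j | vb s 0 (Q@_m j)].
  by rewrite -QP mcoeff_map_mpoly -(ucl0 fu G); apply: ufield_vb.
have hPj s j m : vb s 0 (map_mpoly (at_index j) Q)@_m = vb s 0 (Q@_m j).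
  by rewrite mcoeff_map_mpoly.
pose good j := [/\ forall m, m \in msupp Q -> (1 < mdeg m)%N -> vb true 0 (Q@_m j),
  forall i, vb false 0 (Q@_(U_(i)) j), ~~ vb true 0 (Q@_(U_(i)) j) & vb false 0 (Q@_0 j)].
have goodU : U good.
  have h1 : U [set j | forall m, m \in msupp Q -> (1 < mdeg m)%N -> vb true 0 (Q@_m j)].
    apply: fu_all => m _; have [m1|_] := boolP (1 < mdeg m)%N; last first.
      by apply: (fu_S fu) (fu_tail fu 0) => j _.
    have /vbE : vb true 0 P@_m by have := hm m m1; rewrite mul0rn subr0 addr0.
    by apply: (fu_S fu) => j.
  have h2 := fu_all (r := enum 'I_n) (A := fun l => [set j | vb false 0 (Q@_(U_(l)) j)])
    (fun l _ => iffLR (vbE false U_(l)%MM) (lm l)).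
  have h3 : U [set j | ~~ vb true 0 (Q@_(U_(i)) j)].
    have [/vbE h|] := fu_C fu [set j | vb true 0 (Q@_(U_(i)) j)]; first by rewrite h in ui.
    by apply: (fu_S fu) => j /= /negP.
  move/vbE : P0 => h4.
  apply: (fu_S fu) (fu_I fu h1 (fu_I fu h2 (fu_I fu h3 h4))) => j [a1 [a2 [a3 a4]]].
  exact: (And4 a1 (fun l => a2 l (mem_enum _ l)) a3 a4).
pose sol j y := vb false 0 y /\ (map_mpoly (at_index j) Q).@[jet y] = 0.
have ex j : exists y : F, good j -> sol j y.
  have [[k1 k2 k3 k4]|?] := pselect (good j); last by exists 0.
  have [||y y0 Qy] := hensF n (map_mpoly (at_index j) Q); last by exists y.
    split=> [m m1|l|].
    - have -> : 0 + 0 - 0 *+ mdeg m = 0 :> G by rewrite mul0rn subr0 addr0.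
      rewrite (hPj true j m); have [mQ|mQ] := boolP (m \in msupp Q); first exact: k1.
      by rewrite (memN_msupp_eq0 mQ) vb0.
    - exact: (etrans (hPj false j U_(l)%MM) (k2 l)).
    by exists i; rewrite (hPj true j U_(i)%MM).
  exact: (etrans (hPj false j 0%MM) k4).
have [y hy] := choice ex; exists (fcl y).
  rewrite -(ucl0 fu G); apply/(ufield_vb fu); apply: (fu_S fu) goodU => j /hy[].
  by [].
pose e (i : 'I_n) : R := fun j => iter i der (y j).
have -> : P.@[jet (fcl y)] = fcl Q.@[e].
  transitivity ((map_mpoly fcl Q).@[fcl \o e]); last exact: map_meval.
  rewrite QP; apply: meval_eq => l; rewrite /jet /e /=.
  by elim: (nat_of_ord l) => //= m ->; rewrite ufield_der.
rewrite -(rmorph0 fcl); apply/fcl_eq; apply: (fu_S fu) goodU => j /hy[_ e0].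
exact: (etrans (esym (map_meval (at_index j) Q e)) e0).
Qed.

End UltraFacts.

(** * Extending partial sections of the valuation *)

Section Splitting.
Variables (H : oagType) (K : valuedDiffFieldType H) (X : set K).
Local Notation v := (@valuation H K).
Hypotheses (Xn0 : forall x, X x -> x != 0) (X1 : X 1).
Hypotheses (XM : forall x y, X x -> X y -> X (x * y)) (XV : forall x, X x -> X x^-1).
Hypothesis Xroots : root_system (X `&` @unit_val H K).
Implicit Types (g h b : H) (x y : K) (S T : set (H * K)).

Definition vals : set H := [set v x | x in X].

Definition sec_dom S g : Prop := exists x, S (g, x).

(* [S] is the graph of a partial multiplicative section of the valuation on [X]
   whose domain is a pure subgroup. *)
Record partial_section S : Prop := PartialSection {
  ps0 : S (0, 1);
  psM : forall g h x y, S (g, x) -> S (h, y) -> S (g + h, x * y);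
  psV : forall g x, S (g, x) -> S (- g, x^-1);
  ps1 : forall x, S (0, x) -> x = 1;
  psX : forall g x, S (g, x) -> X x /\ v x = g;
  ps_pure : forall n g, (0 < n)%N -> vals g -> sec_dom S (g *+ n) -> sec_dom S g }.

Lemma valsD g h : vals g -> vals h -> vals (g + h).
Proof.
by move=> [x Xx <-] [y Xy <-]; exists (x * y); [apply: XM|rewrite Defs.valM ?Xn0].
Qed.

Lemma valsN g : vals g -> vals (- g).
Proof. by move=> [x Xx <-]; exists x^-1; [apply: XV|rewrite valV ?Xn0]. Qed.

Lemma XX x z : X x -> X (x ^ z).
Proof.
move=> Xx; have Xn n : X (x ^+ n) by elim: n => [|n IH]; rewrite ?expr0 // exprS; apply: XM.
by case: z => n; [apply: Xn|apply: XV; apply: Xn].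
Qed.

Lemma valXz x z : x != 0 -> v (x ^ z) = v x *~ z.
Proof.
by move=> x0; case: z => n; rewrite /exprz /intmul ?valX // valV ?expf_neq0 // valX.
Qed.

Lemma valsz g z : vals g -> vals (g *~ z).
Proof. by move=> [x Xx <-]; exists (x ^ z); [apply: XX|rewrite valXz ?Xn0]. Qed.

Section Extension.
Variables (S : set (H * K)) (b : H).
Hypotheses (pS : partial_section S) (vb_ : vals b) (nb_ : ~ sec_dom S b).

Lemma psz g x z : S (g, x) -> S (g *~ z, x ^ z).
Proof.
move=> Sx; have Sn n : S (g *+ n, x ^+ n).
  elim: n => [|n IH]; first by rewrite mulr0n expr0; apply: (ps0 pS).
  by rewrite mulrS exprS; apply: (psM pS).
by case: z => n; [apply: Sn|apply: (psV pS); apply: Sn].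
Qed.

Lemma domD g h : sec_dom S g -> sec_dom S h -> sec_dom S (g + h).
Proof. by move=> [x Sx] [y Sy]; exists (x * y); apply: (psM pS). Qed.

Lemma domN g : sec_dom S g -> sec_dom S (- g).
Proof. by move=> [x Sx]; exists x^-1; apply: (psV pS). Qed.

Lemma domz g z : sec_dom S g -> sec_dom S (g *~ z).
Proof. by move=> [x Sx]; exists (x ^ z); apply: psz. Qed.

(** Factorials are cofinal for divisibility, so one sequence of stages exhausts the pure hull. *)
Let E i (m : int) g := vals g /\ sec_dom S (g *+ i`! - b *~ m).

Lemma exE i : exists m : nat, (0 < m)%N && `[< exists g, E i m g >].
Proof.
exists i`!; rewrite fact_gt0; apply/asboolP; exists b; split=> //.
by rewrite pmulrn subrr; exists 1; apply: (ps0 pS).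
Qed.

(* The hull of [dom S + Zb] modulo [dom S] is the union of the cyclic groups generated
   by the [b_ i], where [i`! * b_ i = m_ i * b] with [m_ i] minimal. *)
Let m_ i := ex_minn (exE i).

Lemma m_gt0 i : (0 < m_ i)%N.
Proof. by rewrite /m_; case: ex_minnP => m /andP[]. Qed.

Lemma m_min i (m : nat) g : (0 < m)%N -> E i m g -> (m_ i <= m)%N.
Proof.
move=> m0 Eg; rewrite /m_; case: ex_minnP => m' _; apply; rewrite m0 /=.
by apply/asboolP; exists g.
Qed.

Lemma exb : exists b_ : nat -> H, forall i, E i (m_ i) (b_ i).
Proof.
suff ex i : exists g, E i (m_ i) g by have [b_] := choice ex; exists b_.
by rewrite /m_; case: ex_minnP => m /andP[_ /asboolP].
Qed.

(** Divide [z] by [m_ i]: a nonzero remainder would contradict the minimality of [m_ i]. With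
    remainder 0, the difference has a positive multiple in the domain and lies there by purity. *)
Lemma extension_generates (b_ : nat -> H) i z g : (forall i, E i (m_ i) (b_ i)) -> E i z g ->
  exists2 q : int, z = q * (m_ i) & sec_dom S (g - b_ i *~ q).
Proof.
move=> hb [vg dg]; pose q := (z %/ m_ i)%Z; pose r := (z %% m_ i)%Z.
have zqr : z = q * m_ i + r := divz_eq z (m_ i).
have [vbi dbi] := hb i.
have vq : vals (g - b_ i *~ q) by apply: valsD => //; apply: valsN; apply: valsz.
have dq : sec_dom S ((g - b_ i *~ q) *+ i`! - b *~ r).
  have -> : (g - b_ i *~ q) *+ i`! - b *~ r =
      (g *+ i`! - b *~ z) - (b_ i *+ i`! - b *~ m_ i) *~ q.
    have -> : r = z - q * m_ i by rewrite zqr [_ + r]addrC addrK.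
    rewrite !pmulrn !mulrzBl mulrzBr -!mulrzA [q * _ in LHS]mulrC [q * m_ i]mulrC.
    by rewrite !opprB addrACA [RHS]addrACA [- _ + - _]addrC.
  by apply: domD => //; apply: domN; apply: domz.
have m0 : (m_ i : int) != 0 by rewrite -lt0n m_gt0.
case: (r =P 0) => [r0|/eqP r0].
  exists q; first by rewrite {1}zqr r0 addr0.
  by apply: (ps_pure pS (fact_gt0 i)); rewrite // -[X in sec_dom _ X]subr0 -(mulr0z b) -r0.
have r_ge0 : (0 <= r)%R by apply: modz_ge0.
have r_lt : (r < m_ i)%R by have := ltz_pmod z (d := m_ i); apply; rewrite ltz_nat m_gt0.
case: r r_ge0 r_lt r0 dq {zqr} => // r _; rewrite ltz_nat => r_lt r0 dq.
have r0' : (0 < r)%N by rewrite lt0n.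
by have := m_min r0' (conj vq dq); rewrite leqNgt r_lt.
Qed.

(** The hull is an increasing union of direct sums of the domain of [S] and a copy of the integers
    generated by [b_ i], where [b_ i] is [n i] times [b_ i.+1] modulo the domain. The last clause
    gives purity of the union. *)
Lemma extension_chain : exists (b_ : nat -> H) (n y : nat -> _),
  [/\ forall i, [/\ vals (b_ i), (0 < n i)%N & S (b_ i.+1 *+ n i - b_ i, y i)],
      forall i (q : int), sec_dom S (b_ i *~ q) -> q = 0,
      exists q : int, sec_dom S (b - b_ 0%N *~ q)
    & forall i (p : nat) q g, (0 < p)%N -> vals g -> sec_dom S (g *+ p - b_ i *~ q) ->
      exists j q', sec_dom S (g - b_ j *~ q')].
Proof.
have [b_ hb] := exb; have gen := extension_generates hb.
have nexts i : exists n, (0 < n)%N /\ sec_dom S (b_ i.+1 *+ n - b_ i).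
  have [vbi dbi] := hb i.
  have [|q zq dq] := gen i.+1 (i.+1 * m_ i)%N (b_ i).
    split=> //; have -> : b_ i *+ i.+1`! - b *~ (i.+1 * m_ i)%N =
        (b_ i *+ i`! - b *~ m_ i) *~ i.+1.
      by rewrite mulrzBl !pmulrn -!mulrzA factS !PoszM ![Posz i.+1 * _]mulrC.
    exact: domz.
  have q0 : (0 < q)%R.
    have : (0 < q * m_ i.+1)%R by rewrite -zq ltz_nat muln_gt0 m_gt0.
    by rewrite Num.Theory.pmulr_lgt0 // ltz_nat m_gt0.
  case: q q0 zq dq => // n n0 _ dq; exists n; split=> //.
  by rewrite -opprB; apply: domN.
have [n hn] := choice nexts.
have [y hy] := choice (fun i => (hn i).2).
exists b_, n, y; split=> [i|i q dq||i p q g p0 vg dg].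
- by case: (hb i) => vbi _; case: (hn i).
- apply: contrapT => /eqP q0; apply: nb_; have [vbi dbi] := hb i.
  have {dq} [l l0 dl] : exists2 l, (0 < l)%N & sec_dom S (b_ i *+ l).
    case: q q0 dq => l l0 dl; first by exists l; rewrite // lt0n.
    by exists l.+1 => //; rewrite -[X in sec_dom _ X]opprK; apply: domN.
  have {l l0 dl} di : sec_dom S (b_ i) by apply: (ps_pure pS l0).
  apply: (ps_pure pS (m_gt0 i)) => //.
  rewrite pmulrn -[X in sec_dom _ X](subKr (b_ i *+ i`!)).
  by apply: domD; [rewrite pmulrn; apply: domz|apply: domN].
- have [|q _ dq] := gen 0%N 1 b; last by exists q.
  by split=> //; rewrite subrr; exists 1; apply: (ps0 pS).
(* With this [j], the factorial of [j] is a multiple of [p] times that of [i]. Modulo the domain,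
   that factorial times [g] is then a multiple of [b], and [gen] applies at stage [j]. *)
have [vbi dbi] := hb i; pose j := (p * i`!)%N; pose l := (j.-1)`!.
have j0 : (0 < j)%N by rewrite muln_gt0 p0 fact_gt0.
have jE : j`! = (p * i`! * l)%N by rewrite -[in LHS](prednK j0) factS prednK.
have [|q' _ dq] := gen j (q * (m_ i)%:Z * l%:Z) g; last by exists j, q'.
split=> //; have -> : g *+ j`! - b *~ (q * (m_ i)%:Z * l%:Z) =
    ((g *+ p - b_ i *~ q) *~ i`! + (b_ i *+ i`! - b *~ m_ i) *~ q) *~ l.
  rewrite !mulrzBl !pmulrn -!mulrzA addrA [q * Posz i`!]mulrC subrK mulrzBl -!mulrzA.
  by rewrite jE !PoszM [Posz (m_ i) * q]mulrC.
by apply: domz; apply: domD; apply: domz.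
Qed.

Lemma extend_section : exists T, [/\ partial_section T, S `<=` T & sec_dom T b].
Proof.
have [b_ [n [y [hb indep [q0 dq0] hull]]]] := extension_chain.
have exbeta i : exists x, X x /\ v x = b_ i.
  by have [[x Xx <-] _ _] := hb i; exists x.
have [beta hbeta] := choice exbeta.
have beta0 i : beta i != 0 by apply: Xn0; case: (hbeta i).
have hy i : X (y i) /\ v (y i) = b_ i.+1 *+ n i - b_ i.
  by case: (hb i) => _ _ /(psX pS).
have y0 i : y i != 0 by apply: Xn0; case: (hy i).
have n0 i : (0 < n i)%N by case: (hb i).
(* [beta i] has the value [b_ i] wanted but may violate [t i * y i = t i.+1 ^+ n i]. The defect has
   value 0, and the root system supplies units [a i] such that [t i = beta i * a i] satisfies these
   equations. *)
have [i|a ha aE] := @Xroots (fun i => beta i.+1 ^+ n i / (y i * beta i)) n _ n0.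
  have yb0 : y i * beta i != 0 by rewrite mulf_neq0.
  split; first by apply: XM; [apply: (@XX _ (n i)); case: (hbeta i.+1)|apply/XV/XM;
    [case: (hy i)|case: (hbeta i)]].
  split; first by rewrite mulf_neq0 ?invr_eq0 ?expf_neq0.
  rewrite Defs.valM ?invr_eq0 ?expf_neq0 // valV // valX // Defs.valM //.
  by rewrite (hbeta i.+1).2 (hbeta i).2 (hy i).2 subrK subrr.
pose t i := beta i * a i.
have Xt i : X (t i) by apply: XM; [case: (hbeta i)|case: (ha i)].
have t0 i := Xn0 (Xt i).
have vt i : v (t i) = b_ i.
  by case: (ha i) => _ [a0 va]; rewrite Defs.valM // va addr0 (hbeta i).2.
have tE i : t i = t i.+1 ^+ n i / y i.
  rewrite /t [in LHS]aE exprMn invfM [beta i * _]mulrC -!mulrA [_ * beta i]mulrC.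
  by rewrite mulKf // [(y i)^-1 * _]mulrC.
pose Gr i (p : H * K) := exists (q : int) d z,
  [/\ S (d, z), p.1 = d + b_ i *~ q & p.2 = z * t i ^ q].
have GrS i j p : (i <= j)%N -> Gr i p -> Gr j p.
  move=> /subnK <-; elim: (j - i)%N p => // l IH p /IH[q [d [z [Sz e1 e2]]]].
  rewrite addSn; move: (l + i)%N e1 e2 => j0 e1 e2; have [_ _ Sy] := hb j0.
  exists (q * n j0), (d - (b_ j0.+1 *+ n j0 - b_ j0) *~ q), (z * (y j0)^-1 ^ q).
  split; first by rewrite -mulNrz; apply: (psM pS) => //; apply: psz; apply: (psV pS).
    rewrite e1 -addrA; congr (_ + _); rewrite mulrC mulrzA -pmulrn -mulNrz -mulrzDl.
    by rewrite opprB subrK.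
  by rewrite e2 tE expfzMl exprnP exprz_exp [Posz _ * q]mulrC mulrA mulrAC.
pose T p := exists i, Gr i p.
exists T; split.
- split.
  + by exists 0%N, 0, 0, 1; rewrite mulr0z addr0 mul1r; split=> //; apply: (ps0 pS).
  + move=> g h x x' [i /(GrS i (maxn i _) _ (leq_maxl _ _)) hi] [j Gj].
    have [q [d [z [Sz /= -> ->]]]] := hi j.
    have [q' [d' [z' [Sz' /= -> ->]]]] := GrS j (maxn i j) _ (leq_maxr _ _) Gj.
    exists (maxn i j), (q + q'), (d + d'), (z * z'); split; first exact: (psM pS).
      by rewrite mulrzDr addrACA.
    by rewrite /= expfzDr // mulrACA.
  + move=> g x [i [q [d [z [Sz /= -> ->]]]]]; exists i, (- q), (- d), z^-1.
    split; first exact: (psV pS).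
      by rewrite /= opprD mulrNz.
    by rewrite /= invfM invr_expz.
  + move=> x [i [q [d [z [Sz /= e ->]]]]].
    have q00 : q = 0.
      apply: (indep i); rewrite (_ : b_ i *~ q = - d); last first.
        by apply/eqP; rewrite -addr_eq0 addrC -e.
      by apply: domN; exists z.
    move: e Sz; rewrite q00 mulr0z addr0 expr0z mulr1 => <-; exact: (ps1 pS).
  + move=> g x [i [q [d [z [Sz /= -> ->]]]]]; have [Xz vz] := psX pS Sz.
    split; first by apply: XM => //; apply: XX.
    have z0 := Xn0 Xz; have tq0 : t i ^ q != 0 by apply: expfz_neq0.
    by rewrite Defs.valM // -vz valXz // vt.
  move=> p g p0 vg [x [i [q [d [z [Sz /= gE _]]]]]].
  have [|j [q' [z' Sz']]] := hull i p q g p0 vg.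
    by exists z; rewrite gE addrK.
  by exists (z' * t j ^ q'), j, q', (g - b_ j *~ q'), z'; rewrite /= subrK.
- move=> [d z] Sz; exists 0%N, 0, d, z; split=> //=.
    by rewrite mulr0z addr0.
  by rewrite expr0z mulr1.
have [z Sz] := dq0.
by exists (z * t 0%N ^ q0), 0%N, q0, (b - b_ 0%N *~ q0), z; rewrite /= subrK.
Qed.

End Extension.

Theorem splitting S0 : partial_section S0 ->
  exists T, [/\ partial_section T, S0 `<=` T & forall g, vals g -> sec_dom T g].
Proof.
move=> pS0; have [|A [pA maxA]] := @Zorn_bigcup (H * K) [set S | partial_section (S0 `|` S)].
  move=> C CP totC; have [->|/set0P[A0 CA0]] := eqVneq C set0.
    by rewrite bigcup_set0 /= setU0.
  have up p : (S0 `|` \bigcup_(A in C) A) p <-> exists2 A, C A & (S0 `|` A) p.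
    split=> [[Sp|[A CA Ap]]|[A CA [Sp|Ap]]]; first by exists A0 => //; left.
    - by exists A => //; right.
    - by left.
    by right; exists A.
  split.
  - by left; apply: (ps0 pS0).
  - move=> g h x y /up[A CA Ax] /up[B CB By]; apply/up.
    have [AB|BA] := totC A B CA CB.
      by exists B => //; apply: (psM (CP B CB)) => //; apply: setUS Ax.
    by exists A => //; apply: (psM (CP A CA)) => //; apply: setUS By.
  - by move=> g x /up[A CA Ax]; apply/up; exists A => //; apply: (psV (CP A CA)).
  - by move=> x /up[A CA]; apply: (ps1 (CP A CA)).
  - by move=> g x /up[A CA]; apply: (psX (CP A CA)).
  move=> n g n0 vg [x /up[A CA Ax]].
  have [|y Ay] := ps_pure (CP A CA) n0 vg; first by exists x.
  by exists y; apply/up; exists A.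
exists (S0 `|` A); split=> // b vb_.
apply: contrapT => nb; have [T [pT ST [x Tx]]] := extend_section pA vb_ nb.
apply: (maxA T); last first.
  by rewrite /= (setUidr _) // => p Sp; apply: ST; left.
split=> [p Ap|/(_ _ Tx) Ax]; first by apply: ST; right.
by apply: nb; exists x; right.
Qed.

End Splitting.

(** * Cross sections with logarithmic derivatives in the lifted residue field *)

Section CrossSection.
Variables (H : oagType) (K : valuedDiffFieldType H).
Local Notation v := (@valuation H K).
Hypotheses (mono : monotone K) (hensK : hens K).

Lemma hens_linear n (a : 'I_n -> K) c : (forall i, vb false 0 (a i)) ->
  (exists i, ~~ vb true 0 (a i)) -> vb false 0 c ->
  exists2 y, vb false 0 y & \sum_i a i * iter i der y = c.
Proof.
move=> a0 [i0 ai0] c0; pose P := \sum_i a i *: 'X_i - c%:MP : {mpoly K[n]}.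
have Pm m : P@_m = \sum_i a i * (U_(i)%MM == m)%:R - c * (m == 0%MM)%:R.
  rewrite mcoeffB mcoeffC; congr (_ - _).
  by rewrite raddf_sum /=; apply: eq_bigr => i _; rewrite mcoeffZ mcoeffX.
have P1 m : mdeg m != 1%N -> P@_m = - (c * (m == 0%MM)%:R).
  move=> m1; rewrite (Pm m) big1 ?sub0r // => i _.
  by rewrite (_ : _ == m = false) ?mulr0 //; apply: contraNF m1 => /eqP <-; rewrite mdeg1.
have PU l : P@_(U_(l)) = a l.
  rewrite (Pm U_(l)%MM) mnm1_eq0 mulr0 subr0 (bigD1 l) //= eqxx mulr1 big1 ?addr0 // => i il.
  case: eqVneq => [/mnmP/(_ i)|]; last by rewrite mulr0.
  by rewrite !mnm1E eqxx eq_sym (negPf il).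
have [||y y0 Py] := hensK (P := P).
- split=> [m m1|i|]; [|by rewrite (PU i)|by exists i0; rewrite (PU i0)].
  rewrite (P1 m); last by rewrite neq_ltn m1 orbT.
  by rewrite -mdeg_eq0; case: (mdeg m) m1 => // d _; rewrite mulr0 oppr0 vb0.
- by rewrite (P1 0%MM) ?mdeg0 // eqxx mulr1 vbN.
exists y => //; move: Py; rewrite /P mevalB mevalC raddf_sum /= => /eqP.
rewrite subr_eq0 => /eqP <-; apply: eq_bigr => i _.
by rewrite mevalZ mevalXU.
Qed.

(** Put [x = 1 + e] and seek the root as [1 + e * Y]. After division by [e] the equation is the sum
    over [j < n] of [binomial(n, j+1) * e^j * Y^(j+1)], minus 1. Its linear coefficient [n] is a
    unit in residue characteristic 0. *)
Lemma one_plus_root n (x : K) : (0 < n)%N -> vb true 0 (x - 1) ->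
  exists2 y, vb true 0 (y - 1) & y ^+ n = x.
Proof.
move=> n0; set e := x - 1 => e0.
pose P := \sum_(j < n) (e ^+ j *+ 'C(n, j.+1)) *: 'X_[U_(ord0) *+ j.+1] - 1%:MP
  : {mpoly K[1]}.
have tm (j : 'I_n) (m : 'X_{1..1}) : m != U_(ord0)%MM ->
    vb true 0 ((e ^+ j *+ 'C(n, j.+1)) * ((U_(ord0) *+ j.+1)%MM == m)%:R).
  move=> m1; case: eqP => [em|_]; last by rewrite mulr0 vb0.
  rewrite mulr1; apply: vbMn; case: j em => -[|j] jn /= em.
    by case/eqP: m1; rewrite -em mulm1n.
  by have := vbM e0 (vbX j (vbW false e0)); rewrite mul0rn addr0 -exprS.
have Pm m : P@_m = \sum_(j < n) (e ^+ j *+ 'C(n, j.+1)) *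
    ((U_(ord0) *+ j.+1)%MM == m)%:R - (m == 0%MM)%:R.
  rewrite mcoeffB mcoeffC mul1r; congr (_ - _).
  by rewrite raddf_sum /=; apply: eq_bigr => i _; rewrite mcoeffZ mcoeffX.
have PU : P@_(U_(ord0)) = n%:R.
  rewrite (Pm U_(ord0)%MM) mnm1_eq0 subr0; case: (n) n0 => // n' _.
  rewrite big_ord_recl /= mulm1n eqxx mulr1 expr0 bin1 big1 ?addr0 // => j _.
  rewrite (_ : (_ == _) = false) ?mulr0 //; apply/eqP => /(congr1 mdeg).
  by rewrite mdegMn mdeg1 mul1n.
have [||y y0 Py] := hensK (P := P).
- split=> [m m1|i|].
  + rewrite mul0rn subr0 addr0 (Pm m); apply: vbB; last first.
      by rewrite -mdeg_eq0; case: (mdeg m) m1 => // d _; apply: vb0.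
    by apply: vb_sum => j _; apply: tm; apply: contraTneq m1 => ->; rewrite mdeg1.
  + by rewrite (ord1 i) PU vb_natr.
  by exists ord0; rewrite PU; apply: (unit_val_vb (unit_val_natr K n0)).2.
- rewrite (Pm 0%MM) eqxx; apply: vbB; last exact: vb1.
  apply: vbW; apply: vb_sum => j _; apply: tm.
  by rewrite eq_sym mnm1_eq0.
exists (1 + e * y); first by rewrite addrC addKr; by have := vbM e0 y0; rewrite addr0.
move: Py; rewrite /P mevalB mevalC raddf_sum /= => /eqP.
rewrite subr_eq0 => /eqP Py.
rewrite exprDn big_ord_recl expr1n mul1r bin0 expr0 mulr1n -[RHS](subrK 1) addrC.
congr (_ + _); transitivity (e * 1); last exact: mulr1.
rewrite -[in RHS]Py big_distrr /=; apply: eq_bigr => j _.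
rewrite expr1n mul1r mevalZ mevalX big_ord1 mulmnE mnm1E eqxx mul1n /bump /= add1n.
by rewrite mulrnAl mulrnAr mulrA -exprS -exprMn.
Qed.

Variables (k : diffFieldType) (iota : {rmorphism k -> K}).
Hypotheses (iota_der : forall x, iota (der x) = der (iota x))
  (iota_residue : forall a, vb false 0 a -> exists x, vb true 0 (a - iota x)).

Definition log_in : set K := [set x | x != 0 /\ exists a, der x = iota a * x].

Lemma log_in_neq0 x : log_in x -> x != 0. Proof. by case. Qed.

Lemma log_in1 : log_in 1.
Proof. by split; [exact: oner_neq0|exists 0; rewrite rmorph0 mul0r der1]. Qed.

Lemma log_inM x y : log_in x -> log_in y -> log_in (x * y).
Proof.
move=> [x0 [a xa]] [y0 [b yb]]; split; first exact: mulf_neq0.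
by exists (a + b); rewrite derM xa yb rmorphD mulrDl -mulrA [x * (_ * _)]mulrCA.
Qed.

Lemma log_inV x : log_in x -> log_in x^-1.
Proof.
move=> [x0 [a xa]]; split; first by rewrite invr_eq0.
exists (- a); rewrite derV // xa rmorphN -mulNr expr2 invfM mulrA mulfK //.
Qed.

Lemma derXn (x : K) n : der (x ^+ n.+1) = x ^+ n * der x *+ n.+1.
Proof.
elim: n => [|n IH]; first by rewrite expr0 mul1r.
by rewrite exprS derM IH mulrnAr mulrA -exprS mulrC -mulrS.
Qed.

Lemma log_in_root x n : (0 < n)%N -> x != 0 -> log_in (x ^+ n) -> log_in x.
Proof.
case: n => // n _ x0 [_ [a xa]]; split=> //; exists (a / n.+1%:R).
have nx : x ^+ n *+ n.+1 != 0 :> K by rewrite -mulr_natl mulf_neq0 ?natr_neq0 ?expf_neq0.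
apply: (mulfI nx); rewrite mulrnAl -derXn xa [RHS]mulrCA mulrnAl -exprSr.
rewrite -[x ^+ _ *+ _]mulr_natl mulrA -(rmorph_nat iota) -rmorphM divfK //.
exact: natr_neq0.
Qed.

Lemma one_plus_unit (x : K) : vb true 0 (x - 1) -> x != 0 /\ v x = 0.
Proof.
move=> h; have := @val_eq _ K 1 x (oner_neq0 _).
by rewrite Defs.val1 => /(_ h)[-> ->].
Qed.

(** Let [a] represent the residue of [f' / f], with error [e]. The factor [u = 1 + e * z] has
    logarithmic derivative [- e] as soon as [z' + (e' / e + e) * z = -1]. By monotonicity this
    equation has integral coefficients, so it has an integral solution. *)
Lemma log_in_shift (f : K) : f != 0 -> exists2 u, vb true 0 (u - 1) & log_in (f * u).
Proof.
move=> f0; have [|a] := iota_residue (a := der f / f).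
  by rewrite vb_divr // add0r; apply: (vb_der mono); apply: vb_val.
set e := _ - _ => he.
have fE : der f = f * (iota a + e) by rewrite addrC subrK mulrC divfK.
have [e0|e0] := eqVneq e 0.
  exists 1; first by rewrite subrr vb0.
  by rewrite mulr1; split=> //; exists a; rewrite fE e0 addr0 mulrC.
have [|||z z0 zE] := @hens_linear 2 (fun i => if i == ord0 then der e / e + e else 1) (-1).
- move=> i; case: ifP => _; last exact: vb1.
  apply: vbD; last exact: vbW.
  by rewrite vb_divr // add0r; apply: (vb_der mono); apply: vb_val.
- by exists ord_max; have := (unit_val_vb (unit_val_natr K (ltn0Sn 0))).2.
- by rewrite vbN vb1.
rewrite big_ord_recl big_ord1 /= mul1r in zE.
have dz : der z = - 1 - (der e / e + e) * z by rewrite -zE addrC addKr.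
have ez : vb true 0 (e * z) by have := vbM he z0; rewrite addr0.
have uz : vb true 0 (1 + e * z - 1) by rewrite addrC addKr.
exists (1 + e * z) => //; split; first by rewrite mulf_neq0 // (one_plus_unit uz).1.
exists a; have du : der (1 + e * z) = - (e * (1 + e * z)).
  rewrite derD der1 add0r derM dz mulrBr mulrN1 [e * (_ * z)]mulrA mulrDr.
  rewrite [e * (_ / _)]mulrC divfK // mulrDl.
  by rewrite [in RHS]mulrDr mulr1 mulrA !opprD addrCA addNKr.
by rewrite derM fE du [RHS]mulrCA -[f * _ * _]mulrA -mulrDr mulrDl addrK.
Qed.

Hypothesis unit_roots : root_system (@unit_val H K).

(** A solution in units is corrected by a factor congruent to 1 that brings its first term into
    [log_in]. Successive roots of that factor, again congruent to 1, correct the other terms,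
    because [log_in] is closed under roots. *)
Lemma log_in_root_system : root_system (log_in `&` @unit_val H K).
Proof.
move=> w n hw n0; have [a ha aE] := unit_roots (fun i => (hw i).2) n0.
have [u0 hu0 Xu0] := log_in_shift (ha 0%N).1.
have ex (i : nat) (x : K) : exists y, vb true 0 (x - 1) -> vb true 0 (y - 1) /\ y ^+ n i = x.
  have [hx|hx] := boolP (vb true 0 (x - 1)); last by exists 1.
  by have [y y1 yx] := one_plus_root (n0 i) hx; exists y.
pose rt i (x : K) := xget 0 [set y | vb true 0 (x - 1) -> vb true 0 (y - 1) /\ y ^+ n i = x].
have hrt i (x : K) : vb true 0 (x - 1) -> vb true 0 (rt i x - 1) /\ rt i x ^+ n i = x.
  have [y hy] := ex i x; exact: (xgetI 0 (P := [set y | vb true 0 (x - 1) ->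
    vb true 0 (y - 1) /\ y ^+ n i = x]) (x := y) hy).
pose fix u i := if i is j.+1 then rt j (u j) else u0.
have hu i : vb true 0 (u i - 1) by elim: i => [|i IH]; [exact: hu0|case: (hrt i _ IH)].
have uE i : u i = u i.+1 ^+ n i by case: (hrt i _ (hu i)).
have unit i : unit_val (a i * u i) by apply: unit_valM (ha i) (one_plus_unit (hu i)).
have auE i : a i * u i = w i * (a i.+1 * u i.+1) ^+ n i.
  by rewrite aE [in LHS]uE exprMn mulrA.
exists (fun i => a i * u i) => // i; split=> //.
elim: i => [//|i IH]; apply: (log_in_root (n0 i) (unit i.+1).1).
have -> : (a i.+1 * u i.+1) ^+ n i = (w i)^-1 * (a i * u i).
  by rewrite (auE i) mulKf //; case: (hw i) => _ [].
by apply: log_inM => //; apply: log_inV; case: (hw i).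
Qed.

Hypotheses (const_roots : root_system ((constants K `&` [set x | x != 0]) `&` @unit_val H K))
  (surj : forall g, exists2 x : K, x != 0 & v x = g)
  (pureK : forall n g, (0 < n)%N -> constant_value_group K (g *+ n) -> constant_value_group K g).

Theorem cross_section : exists s : H -> K,
  [/\ forall g, s g != 0 /\ v (s g) = g,
      forall g h, s (g + h) = s g * s h,
      forall g, exists a, der (s g) = iota a * s g
    & forall g, constant_value_group K g -> der (s g) = 0].
Proof.
pose C := constants K `&` [set x | x != 0].
have C1 : C 1 by split; [exact: der1|exact: oner_neq0].
have CM x y : C x -> C y -> C (x * y).
  move=> [dx x0] [dy y0]; split; last exact: mulf_neq0.
  by rewrite /constants /= derM dx dy mul0r mulr0 addr0.
have CV x : C x -> C x^-1.
  move=> [dx x0]; split; last by rewrite /= invr_eq0.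
  by rewrite /constants /= derV // dx oppr0 mul0r.
have C0 x : C x -> x != 0 by case.
pose S0 : set (H * K) := [set (0, 1)].
have pS0 : partial_section C S0.
  split=> //.
  - by move=> g h x y [-> ->] [-> ->]; rewrite /S0 /= addr0 mulr1.
  - by move=> g x [-> ->]; rewrite /S0 /= oppr0 invr1.
  - by move=> x [].
  - by move=> g x [-> ->]; rewrite Defs.val1.
  move=> n g n0 _ [x [gn _]]; exists 1; congr (_, _).
  by apply: (oag_mulIn n0); rewrite gn mul0rn.
have [S1 [pS1 _ domS1]] := splitting C0 C1 CM CV const_roots pS0.
(* Passing from the constants to [log_in] enlarges the group of values in which the domain has to be
   pure; [pureK] covers this. *)
have pS1' : partial_section log_in S1.
  case: (pS1) => h1 h2 h3 h4 h5 h6; split=> //.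
    move=> g x /h5[[dx x0] vx]; split=> //; split=> //.
    by exists 0; rewrite rmorph0 mul0r.
  move=> n g n0 _ [x /h5[Cx vx]]; apply: domS1.
  by apply: (pureK n0); exists x.
have [S2 [pS2 S12 domS2]] := splitting log_in_neq0 log_in1 log_inM log_inV
  log_in_root_system pS1'.
have dom g : exists x, S2 (g, x).
  apply: domS2; have [x x0 <-] := surj g.
  have [u hu Xu] := log_in_shift x0; exists (x * u) => //.
  by have [u0 vu] := one_plus_unit hu; rewrite Defs.valM // vu addr0.
have [s hs] := choice dom.
have fn g x y : S2 (g, x) -> S2 (g, y) -> x = y.
  move=> hx hy; have y0 := log_in_neq0 (psX pS2 hy).1.
  have := psM pS2 hx (psV pS2 hy); rewrite subrr => /(ps1 pS2) e.
  by rewrite -[x](divfK y0) e mul1r.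
exists s; split=> [g|g h|g|g Cg].
- by have [/log_in_neq0 ? ?] := psX pS2 (hs g).
- by apply: fn (hs _) _; apply: (psM pS2).
- by have [[_]] := psX pS2 (hs g).
have [x Sx] := domS1 g Cg; rewrite (fn g (s g) x (hs g) (S12 _ Sx)).
by have [[]] := psX pS1 Sx.
Qed.

End CrossSection.

(** The equation is solved in the valuation ring, and the solution is replaced by its representative
    in [k]. The error lies in the maximal ideal and comes from [k], so it vanishes. *)
Lemma hens_linearly_surjective (H : oagType) (K : valuedDiffFieldType H) (k : diffFieldType)
    (iota : {rmorphism k -> K}) : monotone K -> hens K ->
  (forall x, iota (der x) = der (iota x)) -> (forall x, x != 0 -> valuation (iota x) = 0) ->
  (forall a, vb false 0 a -> exists x, vb true 0 (a - iota x)) -> linearly_surjective k.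
Proof.
move=> mono hensK iota_der iota_unit iota_res n a [i0 ai0] g.
have iotaO x : vb false 0 (iota x).
  by have [->|x0] := eqVneq x 0; rewrite ?rmorph0 ?vb0 // vb_neq0 ?fmorph_eq0 // iota_unit.
have iota_inf x : vb true 0 (iota x) -> x = 0.
  by apply: contraTeq => x0; rewrite vb_neq0 ?fmorph_eq0 // iota_unit // ltxx.
have [|||y y0 yE] := @hens_linear _ K hensK n.+1 (fun i => iota (a i)) (iota g) => //.
  by exists i0; apply: contraNN ai0 => /iota_inf ->.
have [x yx] := iota_res y y0; exists x; apply/eqP; rewrite -subr_eq0; apply/eqP/iota_inf.
have iotaX i : iota (iter i der x) = iter i der (iota x).
  by elim: i => //= i <-.
rewrite rmorphB -yE rmorph_sum -sumrB; apply: vb_sum => i _ /=.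
rewrite rmorphM iotaX -mulrBr -iter_derN -iter_derD -vbN -mulrN -iter_derN opprB.
by have := vbM (iotaO (a i)) (vb_iter mono i yx); rewrite addr0.
Qed.

Theorem theorem3 (G : oagType) (F : valuedDiffFieldType G)
    (F_monotone : monotone F) (F_henselian : diff_henselian F)
    (F_pure : pure_subgroup (constant_value_group F) (value_group F)) :
  exists (k : diffFieldType) (H : oagType) (c : {additive H -> k}),
    [/\ linearly_surjective k,
        range c `&` logder_set k = [set 0]
      & elem_equiv F (hahn_c c)].
Proof.
have [U fu] := exists_free_ultra.
pose H : oagType := ugroup fu (vgroup F); pose K : valuedDiffFieldType H := ufield fu (vfield F).
have mono : monotone K by apply/ufield_mono/vfield_mono.
have hensK : hens K by apply/ufield_hens/vfield_hens/diff_henselian_hens.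
have FK : elem_equiv F K.
  by move=> phi; apply: iff_trans (vfield_equiv F phi) (ufield_equiv fu (vfield F) phi).
have pureK := ufield_pure (fu := fu) (vfield_pure F_pure).
have surj := ufield_surj (fu := fu) (@vfield_surj G F).
have [k [iota [iota_der iota_unit iota_res]]] := residue_lift mono hensK.
have lsk := hens_linearly_surjective mono hensK iota_der iota_unit iota_res.
have unitE f : unit_val (fcl fu f : K) <-> U [set j | unit_val (f j)].
  split=> [[/fcl_neq0 f0]|h].
    rewrite ufield_val -(ucl0 fu (vgroup F)) => /ucl_eq vf.
    by apply: (fu_S fu) (fu_I fu f0 vf) => j [].
  split; first by apply/fcl_neq0; apply: (fu_S fu) h => j [].
  by rewrite ufield_val -(ucl0 fu (vgroup F)); apply/ucl_eq; apply: (fu_S fu) h => j [].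
have unit1 : unit_val (1 : vfield F) by split; [exact: oner_neq0|exact: Defs.val1].
have roots : root_system (@unit_val _ K).
  by apply: ufield_root_system unitE => // x y; apply: unit_valM.
pose C (L : diffFieldType) : set L := constants L `&` [set x | x != 0].
have constE f : (C K `&` @unit_val _ K) (fcl fu f) <->
    U [set j | (C (vfield F) `&` @unit_val _ (vfield F)) (f j)].
  have dE : constants K (fcl fu f) <-> U [set j | der (f j) = 0].
    by rewrite /constants /= ufield_der -(rmorph0 (@fcl _ fu _ (vfield F))); apply: fcl_eq.
  split=> [[[/dE df _] /unitE uf]|h].
    by apply: (fu_S fu) (fu_I fu df uf) => j [/= dj uj]; split=> //; split=> //; case: uj.
  have uf : unit_val (fcl fu f : K) by apply/unitE; apply: (fu_S fu) h => j [].
  split=> //; split; last by case: uf.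
  by apply/dE; apply: (fu_S fu) h => j [[]].
have const_roots : root_system (C K `&` @unit_val _ K).
  apply: ufield_root_system constE => [|x y [[dx x0] ux] [[dy y0] uy]].
    by split=> //; split; [exact: der1|exact: oner_neq0].
  split; last exact: unit_valM.
  by split; [rewrite /constants /= derM dx dy mul0r mulr0 addr0|exact: mulf_neq0].
have [s [s_val s_mul s_der s_const]] :=
  cross_section mono hensK iota_res roots const_roots surj pureK.
have s0 g : s g != 0 by case: (s_val g).
have [c cE] := choice s_der.
(* [c g] is determined by [s g], since [s g] is nonzero and [iota] is injective. Differentiating
   [s (g + h) = s g * s h] then gives additivity. *)
have c_additive : zmod_morphism c.
  have cD g h : c (g + h) = c g + c h.
    apply: (fmorph_inj iota); apply: (mulIf (s0 (g + h))).
    by rewrite -cE s_mul derM !cE rmorphD mulrDl -mulrA [s g * (_ * _)]mulrCA.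
  by move=> g h; apply/eqP; rewrite eq_sym subr_eq -cD subrK.
pose c' : {additive H -> k} := HB.pack c (GRing.isZmodMorphism.Build H k c c_additive).
have hlK : hahn_like c iota s.
  split=> //; last exact: ufield_complete.
  by split=> // g; case: (s_val g).
exists k, H, c'; split=> //.
  apply/seteqP; split=> [z [[g _ <-] [a a0 az]]|_ ->].
    have ia0 : iota a != 0 by rewrite fmorph_eq0.
    have dsg : der (s g) = 0.
      apply: s_const; exists (s g / iota a).
        split; last by rewrite /= mulf_neq0 ?invr_eq0.
        have ca : iota (der a) = iota (c g) * iota a.
          by rewrite -[c g]/(c' g) -az -rmorphM divfK.
        rewrite /constants /= derM derV // cE -iota_der ca expr2 mulNr invfM mulrA mulfK //.
        by rewrite mulrN mulrCA mulrA subrr.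
      by rewrite Defs.valM ?invr_eq0 // valV // iota_unit // oppr0 addr0; case: (s_val g).
    apply: (fmorph_inj iota); apply: (mulIf (s0 g)).
    by rewrite -cE dsg rmorph0 mul0r.
  split; first by exists 0 => //; exact: (raddf0 c').
  by exists 1; rewrite /= ?oner_neq0 // der1 mul0r.
move=> phi; apply: iff_trans (FK phi) _.
exact: (hahn_like_equiv hlK (hahn_is_like c' lsk)).
Qed.
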